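(* Let $(M,\omega)$ be a symplectic manifold on which a connected Lie group $G$ with Lie algebra $\mathfrak{g}$ acts by a symplectic-Hamiltonian action $\sigma$, and let $\mu:M\to\mathfrak{g}^*$ be a moment map for $\sigma$. Let $\pi$ be the nondegenerate Poisson structure on $M$ induced by $\omega$, and for $t\in\Lambda^2\mathfrak{g}$ put $\pi_M^t:=\pi-t_M$. Then the following hold. 1. If $t\in\Lambda^2\mathfrak{g}$ satisfies $[t,t]_M=0$, then $\pi_M^t$ is a Poisson structure on $M$. Moreover, if in addition $t$ is an r-matrix, then $\sigma$ is a Poisson action of $(G,\pi_G^t)$ on $(M,\pi_M^t)$, where $\pi_G^t=t^L-t^R$. 2. If $t\in\Lambda^2\mathfrak{g}$ is such that the isotropic complement $\mathfrak{g}_t^*$ is admissible on $\mu(M)$ (that is, at every point of $\mu(M)$), then the $2$-vector field $\pi_M^t$ is nondegenerate. In particular, if $M$ is compact, then $\pi_M^t$ is nondegenerate for every $t$ sufficiently close to the origin $0$ in $\Lambda^2\mathfrak{g}$ (i.e. for all $t$ in some neighbourhood of $0$). Therefore, if $t$ satisfies both $[t,t]_M=0$ and the condition that $\mathfrak{g}_t^*$ is admissible on $\mu(M)$, then $\pi_M^t$ is a nondegenerate Poisson structure and hence $t$ deforms $\omega$ to a symplectic structure $\omega^t$ on $M$, namely the one induced by $\pi_M^t$.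
   Context: Symplectic-Hamiltonian action: a smooth left action $\sigma$ of $G$ on $(M,\omega)$ by symplectomorphisms with a moment map $\mu:M\to\mathfrak{g}^*$ satisfying (a) $d\mu^X=\iota_{X_M}\omega$ for all $X\in\mathfrak{g}$, where $\mu^X(p)=\langle\mu(p),X\rangle$ and $X_{M,p}=\frac{d}{ds}\big|_{s=0}\sigma_{\exp sX}(p)$, and (b) $\mu\circ\sigma_g=\mathrm{Ad}^*_g\circ\mu$ for all $g\in G$, where $\mathrm{Ad}^*$ is the coadjoint action; its infinitesimal version is $\langle\mathrm{ad}^*_X\xi,Y\rangle=-\langle\xi,[X,Y]\rangle$. For a $2$-vector field $\pi$, $\pi^\sharp:T^*M\to TM$ is defined by $\langle\pi^\sharp(\alpha),\beta\rangle=\pi(\alpha,\beta)$; $\pi$ is nondegenerate if $\pi^\sharp_p$ is an isomorphism for every $p$, and $\pi$ is a Poisson structure if $[\pi,\pi]=0$ (Schouten bracket). A symplectic form $\omega$ and a nondegenerate Poisson structure $\pi$ induce each other via $\pi^\sharp(\iota_v\omega)=v$ for all tangent vectors $v$ (so that $\pi^\sharp(d\mu^X)=X_M$). Elements $t\in\Lambda^2\mathfrak{g}$ are called twists. For $x\in\Lambda^\bullet\mathfrak{g}$, $x_M$ denotes the fundamental multivector field, given by extending $X\mapsto X_M$ multiplicatively: $(X_1\wedge\dots\wedge X_k)_M=(X_1)_M\wedge\dots\wedge(X_k)_M$. $t^L$ and $t^R$ are the left- and right-invariant $2$-vector fields on $G$ with value $t$ at the identity $e$, and $[t,t]:=[t^L,t^L]_e\in\Lambda^3\mathfrak{g}$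 (Schouten bracket). $t$ is an r-matrix if $[t,t]$ is $\mathrm{ad}$-invariant; in that case $\pi_G^t=t^L-t^R$ is a multiplicative Poisson structure, so $(G,\pi_G^t)$ is a Poisson Lie group. A Poisson action of a Poisson Lie group $(G,\pi_G)$ on a Poisson manifold $(M,\pi_M)$ is an action $G\times M\to M$ that is a Poisson map for the product Poisson structure on $G\times M$. Isotropic complement and admissibility: equip $\mathfrak{g}\oplus\mathfrak{g}^*$ with the pairing $(X+\xi|Y+\eta)=\langle\xi,Y\rangle+\langle\eta,X\rangle$ and the bracket $[X,Y]=[X,Y]_{\mathfrak{g}}$, $[X,\xi]=\mathrm{ad}^*_X\xi$, $[\xi,\eta]=0$; it is the Lie algebra of $T^*G\cong G\ltimes\mathfrak{g}^*$ (semidirect product via the coadjoint action). For $t\in\Lambda^2\mathfrak{g}$ let $t^\sharp:\mathfrak{g}^*\to\mathfrak{g}$, $\langle t^\sharp(\xi),\eta\rangle=t(\xi,\eta)$ (with $e_i\wedge e_j=e_i\otimes e_j-e_j\otimes e_i$), and $\mathfrak{g}^*_t:=\{\zeta+t^\sharp(\zeta):\zeta\in\mathfrak{g}^*\}$, an isotropic complement of $\mathfrak{g}$ in $\mathfrak{g}\oplus\mathfrak{g}^*$. The group $T^*G$ acts on $T^*G/G\cong\mathfrak{g}^*$ by the dressing action (induced by left multiplication), under which $G$ acts by $\mathrm{Ad}^*$ and $\mathfrak{g}^*$ by translations; the infinitesimal action of $X+\zeta\in\mathfrak{g}\oplus\mathfrak{g}^*$ at $\xi\in\mathfrak{g}^*$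 is, up to an overall sign, $\mathrm{ad}^*_X\xi+\zeta$. The complement $\mathfrak{g}^*_t$ is admissible at $\xi\in\mathfrak{g}^*$ if the infinitesimal dressing action restricted to $\mathfrak{g}^*_t$ is an isomorphism $\mathfrak{g}^*_t\to T_\xi\mathfrak{g}^*$; equivalently, if the linear map $\mathfrak{g}^*\to\mathfrak{g}^*$, $\zeta\mapsto\zeta+\mathrm{ad}^*_{t^\sharp(\zeta)}\xi$, is an isomorphism. *)

(* Defs.v *)
From HB Require Import structures.
From mathcomp Require Import all_boot all_order all_algebra.
From mathcomp Require Import all_classical all_reals all_analysis.
Set Implicit Arguments.
Unset Strict Implicit.
Unset Printing Implicit Defensive.
Import Order.TTheory GRing.Theory Num.Theory.
Import numFieldNormedType.Exports.
Local Open Scope classical_set_scope.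
Local Open Scope ring_scope.

Section smooth.
Context {R : realType} {E F : normedModType R}.

(* For an open set U: f is of class C^k on U. *)
Fixpoint class_C (k : nat) (U : set E) (f : E -> F) : Prop :=
  if k is k'.+1 then
    (forall x, U x -> differentiable f x) /\ (forall v, class_C k' U ('D_v f))
  else forall x, U x -> {for x, continuous f}.

Definition smooth_on (U : set E) (f : E -> F) := forall k, class_C k U f.

End smooth.

(* An atlas of n-dimensional charts indexed by [chart_index]; [chart_inv i] is
   the inverse of the chart [chart i] (the values of [chart i] outside
   [chart_dom i], and of [chart_inv i] outside [chart i @` chart_dom i], are
   irrelevant).

   [chart_at p] selects a chart around p.  The tangent space T_pM is 'rV[R]_n:
   a row vector v stands for the tangent vector whose components in the chart
   [chart_at p] are the entries of v.  Likewise, a covector at p is the row of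
   its components in the dual basis, so that <alpha, v> = alpha *m v^T, and
   elements of T_pM (x) T_pM and T_p^*M (x) T_p^*M are n x n matrices. *)
Record atlas (R : realType) (n : nat) (M : topologicalType) := Atlas {
  chart_index : Type ;
  chart_dom : chart_index -> set M ;
  chart : chart_index -> M -> 'rV[R]_n ;
  chart_inv : chart_index -> 'rV[R]_n -> M ;
  chart_at : M -> chart_index }.

Definition chart_img (R : realType) (n : nat) (M : topologicalType)
  (A : atlas R n M) (i : chart_index A) : set 'rV[R]_n :=
  chart i @` chart_dom i.

Record is_manifold (R : realType) (n : nat) (M : topologicalType)
    (A : atlas R n M) : Prop := IsManifold {
  manifold_hausdorff : hausdorff_space M ;
  manifold_second_countable : @second_countable M ;
  chart_dom_at : forall p, chart_dom (chart_at A p) p ;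
  chart_dom_open : forall i : chart_index A, open (chart_dom i) ;
  chart_img_open : forall i : chart_index A, open (chart_img i) ;
  chartK : forall (i : chart_index A) p,
    chart_dom i p -> chart_inv i (chart i p) = p ;
  chart_cts : forall (i : chart_index A) p,
    chart_dom i p -> {for p, continuous (chart i)} ;
  chart_inv_cts : forall (i : chart_index A) u,
    chart_img i u -> {for u, continuous (chart_inv i)} ;
  transition_smooth : forall i j : chart_index A,
    smooth_on (chart i @` (chart_dom i `&` chart_dom j))
              (chart j \o chart_inv i) }.

Definition prod_atlas (R : realType) (m n : nat) (M N : topologicalType)
    (A : atlas R m M) (B : atlas R n N) : atlas R (m + n) (M * N)%type :=
  {| chart_index := (chart_index A * chart_index B)%type ;
     chart_dom := fun i => chart_dom i.1 `*` chart_dom i.2 ;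
     chart := fun i p => row_mx (chart i.1 p.1) (chart i.2 p.2) ;
     chart_inv := fun i u =>
       (chart_inv i.1 (lsubmx u), chart_inv i.2 (rsubmx u)) ;
     chart_at := fun p => (chart_at A p.1, chart_at B p.2) |}.

Definition smooth_map (R : realType) (m n : nat) (M N : topologicalType)
    (A : atlas R m M) (B : atlas R n N) (f : M -> N) : Prop :=
  continuous f /\
  forall (i : chart_index A) (j : chart_index B),
    smooth_on (chart i @` (chart_dom i `&` f @^-1` chart_dom j))
              (chart j \o f \o chart_inv i).

(* The matrix of the tangent map T_pM -> T_{f p}N: it sends v to
   v *m tangent_map A B f p, and pulls the covector beta at f p back to
   beta *m (tangent_map A B f p)^T. *)
Definition tangent_map (R : realType) (m n : nat) (M N : topologicalType)
    (A : atlas R m M) (B : atlas R n N) (f : M -> N) (p : M) : 'M[R]_(m, n) :=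
  'J (chart (chart_at B (f p)) \o f \o chart_inv (chart_at A p))
     (chart (chart_at A p) p).

Section tensor_fields.
Context {R : realType} {n : nat} {M : topologicalType} (A : atlas R n M).

Definition smooth_fun (V : normedModType R) (f : M -> V) : Prop :=
  forall i : chart_index A, smooth_on (chart_img i) (f \o chart_inv i).

Definition dfun (f : M -> R) (p : M) (v : 'rV[R]_n) : R :=
  'd (f \o chart_inv (chart_at A p) : 'rV[R]_n -> R^o)
     (chart (chart_at A p) p) v.

(* Change of basis from the chart [chart_at p] to the chart i at
   p = chart_inv i u, and its inverse. *)
Definition to_chart (i : chart_index A) (u : 'rV[R]_n) : 'M[R]_n :=
  let p := chart_inv i u in
  'J (chart i \o chart_inv (chart_at A p)) (chart (chart_at A p) p).
Definition of_chart (i : chart_index A) (u : 'rV[R]_n) : 'M[R]_n :=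
  let p := chart_inv i u in
  'J (chart (chart_at A p) \o chart_inv i) u.

(* Expressions of a vector field, a contravariant and a covariant 2-tensor
   field in the chart i. *)
Definition vector_in (i : chart_index A) (X : M -> 'rV[R]_n)
    (u : 'rV[R]_n) : 'rV[R]_n :=
  X (chart_inv i u) *m to_chart i u.
Definition bivector_in (i : chart_index A) (pi : M -> 'M[R]_n)
    (u : 'rV[R]_n) : 'M[R]_n :=
  (to_chart i u)^T *m pi (chart_inv i u) *m to_chart i u.
Definition form_in (i : chart_index A) (w : M -> 'M[R]_n)
    (u : 'rV[R]_n) : 'M[R]_n :=
  of_chart i u *m w (chart_inv i u) *m (of_chart i u)^T.

Definition skew_mx (k : nat) (t : 'M[R]_k) : Prop := t^T = - t.

Definition partial (l : 'I_n) (F : 'rV[R]_n -> 'M[R]_n)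
    (u : 'rV[R]_n) : 'M[R]_n :=
  'D_(delta_mx 0 l) F u.

Definition vector_bracket (X Y : M -> 'rV[R]_n) (p : M) : 'rV[R]_n :=
  let i := chart_at A p in let u := chart i p in
  'D_(vector_in i X u) (vector_in i Y) u
  - 'D_(vector_in i Y u) (vector_in i X) u.

(* w p represents the bilinear form (v, v') |-> v *m w p *m v'^T. *)
Definition is_2form (w : M -> 'M[R]_n) : Prop :=
  (forall p, skew_mx (w p)) /\
  (forall i : chart_index A, smooth_on (chart_img i) (form_in i w)).

Definition interior_product (w : M -> 'M[R]_n) (p : M)
    (v : 'rV[R]_n) : 'rV[R]_n := v *m w p.

Definition extd (w : M -> 'M[R]_n) (p : M) (a b c : 'I_n) : R :=
  let W := form_in (chart_at A p) w in let u := chart (chart_at A p) p in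
  partial a W u b c + partial b W u c a + partial c W u a b.

Definition is_symplectic_form (w : M -> 'M[R]_n) : Prop :=
  [/\ is_2form w,
      forall p a b c, extd w p a b c = 0 &
      forall p, bijective (interior_product w p)].

(* pi p represents pi_p(alpha, beta) = alpha *m pi p *m beta^T; with
   e_i /\ e_j = e_i (x) e_j - e_j (x) e_i, the skew matrix pi stands for
   sum_(i < j) pi_ij e_i /\ e_j. *)
Definition is_2vector_field (pi : M -> 'M[R]_n) : Prop :=
  (forall p, skew_mx (pi p)) /\
  (forall i : chart_index A, smooth_on (chart_img i) (bivector_in i pi)).

Definition sharp_map (pi : M -> 'M[R]_n) (p : M)
    (alpha : 'rV[R]_n) : 'rV[R]_n :=
  alpha *m pi p.

Definition is_nondegenerate (pi : M -> 'M[R]_n) : Prop :=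
  is_2vector_field pi /\ forall p, bijective (sharp_map pi p).

(* Schouten bracket of 2-vector fields, a 3-vector field given by its
   components at p.  On functions it is
     [P, Q](f, g, h) = sum over cyclic permutations of
                         {{f, g}_Q, h}_P + {{f, g}_P, h}_Q,
   with {f, g}_P = P(df, dg), here applied to coordinate functions. *)
Definition schouten (P Q : M -> 'M[R]_n) (p : M) (a b c : 'I_n) : R :=
  let P' := bivector_in (chart_at A p) P in
  let Q' := bivector_in (chart_at A p) Q in
  let u := chart (chart_at A p) p in
  let term a b c :=
    \sum_l (partial l Q' u a b * P' u l c + partial l P' u a b * Q' u l c) in
  term a b c + term b c a + term c a b.

Definition is_poisson (pi : M -> 'M[R]_n) : Prop :=
  is_2vector_field pi /\ forall p a b c, schouten pi pi p a b c = 0.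

Definition induces (w pi : M -> 'M[R]_n) : Prop :=
  forall p v, sharp_map pi p (interior_product w p v) = v.

End tensor_fields.

Section poisson_maps.
Context {R : realType} {m n : nat} {M N : topologicalType}.

Definition push2 (A : atlas R m M) (B : atlas R n N) (f : M -> N) (p : M)
    (t : 'M[R]_m) : 'M[R]_n :=
  (tangent_map A B f p)^T *m t *m tangent_map A B f p.

Definition poisson_map (A : atlas R m M) (B : atlas R n N)
    (piM : M -> 'M[R]_m) (piN : N -> 'M[R]_n) (f : M -> N) : Prop :=
  smooth_map A B f /\ forall p, push2 A B f p (piM p) = piN (f p).

Definition prod_2vector (piM : M -> 'M[R]_m) (piN : N -> 'M[R]_n)
    (x : M * N) : 'M[R]_(m + n) :=
  block_mx (piM x.1) 0 0 (piN x.2).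

End poisson_maps.

#[short(type="topGroupType")]
HB.structure Definition TopGroup := {G of Group G & Topological G}.

Section lie_groups.
Context {R : realType} {m : nat} {G : topGroupType} (AG : atlas R m G).

Record is_lie_group : Prop := IsLieGroup {
  lie_group_manifold : is_manifold AG ;
  lie_group_mul : smooth_map (prod_atlas AG AG) AG (fun x => (x.1 * x.2)%g) ;
  lie_group_inv : smooth_map AG AG (fun g => (g^-1)%g) }.

(* The Lie algebra is T_eG = 'rV[R]_m, its dual is also 'rV[R]_m. *)
Definition pairing (xi X : 'rV[R]_m) : R := (xi *m X^T) 0 0.

Definition left_field (X : 'rV[R]_m) (g : G) : 'rV[R]_m :=
  X *m tangent_map AG AG (fun h => (g * h)%g) 1%g.

Definition lie_bracket (X Y : 'rV[R]_m) : 'rV[R]_m :=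
  vector_bracket AG (left_field X) (left_field Y) 1%g.

(* A continuous one-parameter subgroup is automatically smooth, and it is
   determined by its velocity X at 0. *)
Definition one_parameter_subgroup (X : 'rV[R]_m) (gamma : R -> G) : Prop :=
  [/\ continuous gamma,
      forall s t : R, gamma (s + t) = (gamma s * gamma t)%g &
      is_derive (0 : R) 1 (chart (chart_at AG 1%g) \o gamma) X].

Definition lie_exp (X : 'rV[R]_m) : G :=
  xget (fun _ => 1%g) [set gamma | one_parameter_subgroup X gamma] 1.

Definition Ad (g : G) (X : 'rV[R]_m) : 'rV[R]_m :=
  X *m tangent_map AG AG (fun h => (g * h * g^-1)%g) 1%g.

(* Ad^*_g xi and ad^*_X xi, by their values on the basis of the Lie algebra. *)
Definition coAd (g : G) (xi : 'rV[R]_m) : 'rV[R]_m :=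
  \row_j pairing xi (Ad (g^-1)%g (delta_mx 0 j)).
Definition coad (X xi : 'rV[R]_m) : 'rV[R]_m :=
  \row_j - pairing xi (lie_bracket X (delta_mx 0 j)).

Definition left_2vector (t : 'M[R]_m) (g : G) : 'M[R]_m :=
  push2 AG AG (fun h => (g * h)%g) 1%g t.
Definition right_2vector (t : 'M[R]_m) (g : G) : 'M[R]_m :=
  push2 AG AG (fun h => (h * g)%g) 1%g t.

Definition twist_bracket (t : 'M[R]_m) : 'I_m -> 'I_m -> 'I_m -> R :=
  schouten AG (left_2vector t) (left_2vector t) 1%g.

Definition ad_invariant (x : 'I_m -> 'I_m -> 'I_m -> R) : Prop :=
  forall (X : 'rV[R]_m) (a b c : 'I_m),
    let ad l a := lie_bracket X (delta_mx 0 l) 0 a in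
    \sum_l (ad l a * x l b c + ad l b * x a l c + ad l c * x a b l) = 0.

Definition is_r_matrix (t : 'M[R]_m) : Prop := ad_invariant (twist_bracket t).

Definition poisson_twist (t : 'M[R]_m) (g : G) : 'M[R]_m :=
  left_2vector t g - right_2vector t g.

Definition is_poisson_lie_group (piG : G -> 'M[R]_m) : Prop :=
  [/\ is_lie_group, is_poisson AG piG &
      poisson_map (prod_atlas AG AG) AG (prod_2vector piG piG) piG
        (fun x => (x.1 * x.2)%g)].

Definition twist_sharp (t : 'M[R]_m) (zeta : 'rV[R]_m) : 'rV[R]_m := zeta *m t.

Definition twist_complement (t : 'M[R]_m) : set ('rV[R]_m * 'rV[R]_m) :=
  [set (twist_sharp t zeta, zeta) | zeta in [set: 'rV[R]_m]].

(* Infinitesimal dressing action of X + zeta at xi, up to an overall sign. *)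
Definition dressing (xi : 'rV[R]_m) (x : 'rV[R]_m * 'rV[R]_m) : 'rV[R]_m :=
  coad x.1 xi + x.2.

Definition admissible (t : 'M[R]_m) (xi : 'rV[R]_m) : Prop :=
  set_bij (twist_complement t) [set: 'rV[R]_m] (dressing xi).

End lie_groups.

Section actions.
Context {R : realType} {m n : nat} {G : topGroupType} {M : topologicalType}.
Context (AG : atlas R m G) (AM : atlas R n M) (sigma : G -> M -> M).

Definition is_smooth_action : Prop :=
  [/\ smooth_map (prod_atlas AG AM) AM (fun x => sigma x.1 x.2),
      forall p, sigma 1%g p = p &
      forall g h p, sigma (g * h)%g p = sigma g (sigma h p)].

Definition fundamental (X : 'rV[R]_m) (p : M) : 'rV[R]_n :=
  'D_1 (fun s : R => chart (chart_at AM p) (sigma (lie_exp AG (s *: X)) p)) 0.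

(* Multiplicative extension to elements of the second and third exterior powers
   of the Lie algebra, seen as skew tensors. *)
Definition fundamental2 (t : 'M[R]_m) (p : M) : 'M[R]_n :=
  \matrix_(a, b) \sum_i \sum_j
    t i j * fundamental (delta_mx 0 i) p 0 a * fundamental (delta_mx 0 j) p 0 b.
Definition fundamental3 (x : 'I_m -> 'I_m -> 'I_m -> R) (p : M)
    (a b c : 'I_n) : R :=
  \sum_i \sum_j \sum_k
    x i j k * fundamental (delta_mx 0 i) p 0 a
      * fundamental (delta_mx 0 j) p 0 b * fundamental (delta_mx 0 k) p 0 c.

Definition is_symplectomorphism (w : M -> 'M[R]_n) (f : M -> M) : Prop :=
  [/\ smooth_map AM AM f,
      (exists2 f', smooth_map AM AM f' & cancel f f' /\ cancel f' f) &
      forall p, let T := tangent_map AM AM f p in T *m w (f p) *m T^T = w p].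

Record is_symplectic_hamiltonian (w : M -> 'M[R]_n)
    (mu : M -> 'rV[R]_m) : Prop := IsSymplecticHamiltonian {
  hamiltonian_action : is_smooth_action ;
  hamiltonian_symplectic : forall g, is_symplectomorphism w (sigma g) ;
  moment_smooth : smooth_fun AM mu ;
  moment_fundamental : forall (X : 'rV[R]_m) (p : M) (v : 'rV[R]_n),
    dfun AM (fun q => pairing (mu q) X) p v =
    (interior_product w p (fundamental X p) *m v^T) 0 0 ;
  moment_equivariant : forall g p, mu (sigma g p) = coAd AG g (mu p) }.

Definition is_poisson_action (piG : G -> 'M[R]_m) (piM : M -> 'M[R]_n) : Prop :=
  [/\ is_poisson_lie_group AG piG, is_poisson AM piM, is_smooth_action &
      poisson_map (prod_atlas AG AM) AM (prod_2vector piG piM) piM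
        (fun x => sigma x.1 x.2)].

Definition twisted (pi : M -> 'M[R]_n) (t : 'M[R]_m) (p : M) : 'M[R]_n :=
  pi p - fundamental2 t p.

End actions.

(* Main.v *)
(* In a chart, for a skew t and vector fields X_i, the Schouten bracket of a
   bivector field P with sum_ij t_ij X_i (x) X_j is the cyclic sum of
   sum_ij t_ij L_{X_i}P (x) X_j.  The fundamental fields of a Hamiltonian action
   are X_M = pi#(dmu^X), so that L_{X_M} pi = 0 and [pi, t_M] = 0.  Since
   X |-> X_M is an antihomomorphism, as is X |-> X^R, while X |-> X^L is a
   homomorphism and left-invariant fields commute with right-invariant ones,
   [t_M, t_M] = -[t, t]_M and [t^L - t^R, t^L - t^R] = [t, t]^L - [t, t]^R; the
   latter vanishes because an ad-invariant tensor is Ad-invariant on a connected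
   group.  The action is Poisson because the orbit map of p carries X^L_g to
   (sigma_g)_* X_M(p) and X^R_g to X_M(g p).

   If alpha lies in the kernel of pi - t_M, its pairings with the fundamental
   fields form, up to sign, a zeta with zeta + ad*_{t zeta} mu(p) = 0;
   admissibility forces zeta = 0 and then alpha = 0.  On a compact M the moment
   map is bounded, so that the same equation forces zeta = 0 for small t.

   X_M is defined by differentiating along the exponential map.  In a chart
   centred at 1 the product is x + y + O(|x||y|), so the 2^n-th powers of the
   points with coordinates X/2^n converge to a one-parameter subgroup. *)

Require Import Defs.
From HB Require Import structures.
From mathcomp Require Import all_boot all_order all_algebra.
From mathcomp Require Import all_classical all_reals all_analysis.
From mathcomp Require Import ring lra.
Set Implicit Arguments.
Unset Strict Implicit.
Unset Printing Implicit Defensive.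
Import Order.TTheory GRing.Theory Num.Theory.
Import numFieldNormedType.Exports.
Local Open Scope classical_set_scope.
Local Open Scope ring_scope.

(** * Calculus of smooth functions *)

(** Tangent vectors at p are written in [chart_at p], a chart that may jump with p, so a field can
    be differentiated only after it has been moved to one fixed chart; the chain rule for [Jloc]
    does this bookkeeping. No flow is integrated. Bracket identities come instead from one fact,
    that brackets of related fields are related; left translations, inversion, the product and the
    orbit maps supply the relations. Likewise L_X pi = 0 is proved in coordinates, from the symmetry
    of the Hessian and the Jacobi identity, and the latter from the derivative of an inverse matrix.
    The three Schouten squares, of t^L, t^R and t_M, are a single computation in a frame closed
    under brackets; only the sign of the structure constants changes. [lie_exp] is a choice among
    one-parameter subgroups. What has to be proved is that one exists for small X, and that each of
    them has chart value X + O(|X|^2) at time 1. This identifies X_M with the tangent map of the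
    orbit map, after which the exponential disappears: ad* is reached by differentiating Ad in the
    chart at 1. *)

Section class_C_theory.
Context {R : realType} {E F : normedModType R}.
Implicit Types (f g : E -> F) (x : E) (k : nat).

(** [g] is [f] plus a function that vanishes near x, whose differential is the zero map. *)
Lemma near_eq_differentiable f g x :
  (\forall y \near x, f y = g y) -> differentiable f x -> differentiable g x.
Proof.
move=> fg df; rewrite (_ : g = f + (g - f)); last first.
  by rewrite addrC subrK.
apply: differentiableD => //.
have h0 : \forall y \near x, (g - f) y = 0.
  by near=> y; rewrite -[LHS]/(g y - f y) -(near fg y)// subrr.
move: (g - f) h0 => h h0.
pose z : {linear E -> F} := \0.
have zc : continuous z by move=> ?; exact: cst_continuous.
have hz : h \o shift x = cst (h x) + z +o_ 0 id.
  have h0x : \forall y \near (0 : E), h (y + x) = 0.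
    by move: h0; rewrite (near_shift 0) /= subr0.
  apply/eqaddoP => _/posnumP[e]; near=> y.
  rewrite -[X in `|X|]/(h (y + x) - (h x + 0)) (nbhs_singleton h0) addr0 subr0.
  by rewrite (near h0x y)// normr0 mulr_ge0.
by apply/diff_locallyP; rewrite (diff_unique zc hz).
Unshelve. all: by end_near. Qed.

Lemma class_C_sub k (U V : set E) f : V `<=` U -> class_C k U f -> class_C k V f.
Proof.
move=> VU; elim: k f => [|k IH] f /=; first by move=> H x /VU; apply: H.
by move=> [H1 H2]; split => [x /VU|v]; [exact: H1|exact: IH].
Qed.

Lemma class_C_pointwise k (U : set E) f :
  (forall x, U x -> class_C k [set x] f) -> class_C k U f.
Proof.
elim: k f => [|k IH] f /= H; first by move=> x /H; apply.
by split=> [x /H[/(_ _ erefl)]//|v]; apply: IH => x /H[_].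
Qed.

Lemma class_C_near k f g x :
  (\forall y \near x, f y = g y) -> class_C k [set x] f -> class_C k [set x] g.
Proof.
elim: k f g => [|k IH] f g fg /=.
  move=> /(_ x erefl) fc _ ->; rewrite /prop_for /continuous_at.
  by rewrite -(nbhs_singleton fg); apply: cvg_trans fc; apply: near_eq_cvg.
move=> [df Df]; split=> [_ ->|v]; first exact: near_eq_differentiable (df _ erefl).
apply: IH (Df v); move/near_join: fg; apply: filterS => y fgy.
exact: near_eq_derive.
Qed.

(** One neighbourhood serves all orders k. This is what [smooth_on] gives inside an open set, and it
    lets smoothness at x pass to nearby points. *)
Definition smooth_at f x := \forall y \near x, forall k, class_C k [set y] f.

Lemma smooth_on_at (U : set E) f x : open U -> U x -> smooth_on U f -> smooth_at f x.
Proof.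
move=> oU Ux sf; near=> y; move=> k; apply: class_C_sub (sf k) => _ ->.
by near: y; exact: open_nbhs_nbhs.
Unshelve. all: by end_near. Qed.

Lemma smooth_at_on (U : set E) f : (forall x, U x -> smooth_at f x) -> smooth_on U f.
Proof. by move=> H k; apply: class_C_pointwise => x /H /nbhs_singleton. Qed.

Lemma smooth_at_near f g x :
  (\forall y \near x, f y = g y) -> smooth_at f x -> smooth_at g x.
Proof.
move=> /near_join fg; apply: filterS2 fg => y fgy H k; exact: class_C_near (H k).
Qed.

Lemma smooth_at_nbhs f x : smooth_at f x -> \forall y \near x, smooth_at f y.
Proof. exact: near_join. Qed.

Lemma smooth_at_differentiable f x : smooth_at f x -> differentiable f x.
Proof. by move=> /nbhs_singleton /(_ 1%N) [] /(_ _ erefl). Qed.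

Lemma smooth_at_continuous f x : smooth_at f x -> {for x, continuous f}.
Proof. by move=> /smooth_at_differentiable/differentiable_continuous. Qed.

Lemma smooth_at_derivable f x v : smooth_at f x -> derivable f x v.
Proof. by move=> /smooth_at_differentiable; exact: diff_derivable. Qed.

Lemma smooth_at_derive f x v : smooth_at f x -> smooth_at ('D_v f) x.
Proof. by apply: filterS => y H k; have [_ /(_ v)] := H k.+1. Qed.

(* A neighbourhood version of [class_C k [set x]] that can be unfolded
   inductively on k without keeping track of open sets. *)
Definition Ck_at k f x := \forall y \near x, class_C k [set y] f.

Lemma Ck_at0 f x : Ck_at 0 f x <-> \forall y \near x, {for y, continuous f}.
Proof.
by split; apply: filterS => y; [apply|move=> fc _ ->].
Qed.

Lemma Ck_atS k f x : Ck_at k.+1 f x <->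
  \forall y \near x, differentiable f y /\ forall v, Ck_at k ('D_v f) y.
Proof.
split=> [/near_join|]; last first.
  apply: filterS => y [df Df]; split=> [_ -> //|v].
  exact: nbhs_singleton (Df v).
apply: filterS => y H; split; first by have [/(_ _ erefl)] := nbhs_singleton H.
by move=> v; apply: filterS H => z [_]; apply.
Qed.

Lemma Ck_at_near k f g x :
  (\forall y \near x, f y = g y) -> Ck_at k f x -> Ck_at k g x.
Proof. by move=> /near_join; apply: filterS2 => y; exact: class_C_near. Qed.

Lemma smooth_at_Ck f x : smooth_at f x -> forall k, Ck_at k f x.
Proof. by move=> H k; apply: filterS H => y; apply. Qed.

Lemma Ck_smooth_at f x :
  (\forall y \near x, forall k, Ck_at k f y) -> smooth_at f x.
Proof. by apply: filterS => y H k; exact: nbhs_singleton (H k). Qed.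

Lemma Ck_at_pred k f x : Ck_at k.+1 f x -> Ck_at k f x.
Proof.
elim: k f x => [|k IH] f x /Ck_atS H.
  by apply/Ck_at0; apply: filterS H => y [/differentiable_continuous].
by apply/Ck_atS; apply: filterS H => y [? H]; split => // v; exact: IH.
Qed.

Lemma Ck_at_differentiable k f x : Ck_at k.+1 f x -> differentiable f x.
Proof. by move=> /Ck_atS /nbhs_singleton []. Qed.

Lemma Ck_at_cst k (c : F) x : Ck_at k (cst c) x.
Proof.
elim: k c x => [|k IH] c x; first by apply/Ck_at0; apply: nearW => y; exact: cst_continuous.
apply/Ck_atS; apply: nearW => y; split=> [|v]; first exact: differentiable_cst.
by apply: Ck_at_near (IH 0 y); apply: nearW => z; rewrite derive_cst.
Qed.

Lemma Ck_at_add k f g x : Ck_at k f x -> Ck_at k g x -> Ck_at k (fun y => f y + g y) x.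
Proof.
elim: k f g x => [|k IH] f g x.
  move=> /Ck_at0 H1 /Ck_at0 H2; apply/Ck_at0; apply: filterS2 H1 H2 => y H1 H2.
  exact: continuousD H1 H2.
move=> /Ck_atS H1 /Ck_atS H2; apply/Ck_atS.
near=> y.
have [d1 D1] : differentiable f y /\ forall v, Ck_at k ('D_v f) y by near: y.
have [d2 D2] : differentiable g y /\ forall v, Ck_at k ('D_v g) y by near: y.
split=> [|v]; first exact: differentiableD.
apply: Ck_at_near (IH _ _ _ (D1 v) (D2 v)).
suff : \forall z \near y, differentiable f z /\ differentiable g z.
  by apply: filterS => z [? ?]; rewrite deriveD//; exact: diff_derivable.
near: y; apply: near_join.
by apply: filterS2 H1 H2 => y [? _] [? _].
Unshelve. all: by end_near. Qed.


Lemma Ck_at_sum k n (f : 'I_n -> E -> F) x : (forall i, Ck_at k (f i) x) ->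
  Ck_at k (fun y => \sum_i f i y) x.
Proof.
elim: n f => [|n IH] f H.
  by apply: Ck_at_near (Ck_at_cst k 0 x); apply: nearW => y; rewrite big_ord0.
pose g y := (\sum_(i < n) f (widen_ord (leqnSn n) i) y) + f ord_max y.
apply: (@Ck_at_near _ g); first by apply: nearW => y; rewrite big_ord_recr.
by apply: Ck_at_add => //; apply: IH.
Qed.

Lemma derive_sumfun n (h : 'I_n -> E -> F) x v :
  (forall i, derivable (h i) x v) ->
  'D_v (fun y => \sum_i h i y) x = \sum_i 'D_v (h i) x.
Proof.
move=> H; rewrite -derive_sum//; congr ('D_v _ x).
by apply/funext => y; rewrite fct_sumE.
Qed.

Lemma differentiable_sumfun n (h : 'I_n -> E -> F) x :
  (forall i, differentiable (h i) x) ->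
  differentiable (fun y => \sum_i h i y) x.
Proof.
move=> H; rewrite (_ : (fun _ => _) = \sum_i h i).
  exact: differentiable_sum.
by apply/funext => y; rewrite fct_sumE.
Qed.

End class_C_theory.

Lemma derive_comp {R : realType} {E F H : normedModType R} (f : E -> F) (g : F -> H)
    (x v : E) : differentiable f x -> differentiable g (f x) ->
  'D_v (fun y => g (f y)) x = 'D_('D_v f x) g (f x).
Proof.
move=> df dg; rewrite [LHS](deriveE _ (differentiable_comp df dg)).
by rewrite diff_comp// deriveE// deriveE.
Qed.

Section matrix_valued.
Context {R : realType} {E : normedModType R} {m n : nat}.
Implicit Types (M : E -> 'M[R]_(m, n)) (x : E) (k : nat).

Lemma differentiable_mxP M x :
  (forall i j, differentiable (fun y => M y i j) x) <-> differentiable M x.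
Proof.
split=> H; last first.
  move=> i j.
  exact: (@differentiable_comp _ _ _ _ M (fun N => N i j) _ H (differentiable_coord _ _ _)).
rewrite (_ : M = fun y => \sum_i \sum_j M y i j *: delta_mx i j).
  apply: differentiable_sumfun => i; apply: differentiable_sumfun => j.
  exact: differentiableZl.
by apply/funext => y; exact: matrix_sum_delta.
Qed.

Lemma derive_mxE M x v i j : derivable M x v ->
  ('D_v M x) i j = 'D_v (fun y => M y i j) x.
Proof. by move=> H; rewrite derive_mx// mxE. Qed.

Lemma continuous_mxP {T : topologicalType} (M : T -> 'M[R]_(m, n)) (x : T) :
  (forall i j, {for x, continuous (fun y => M y i j)}) <-> {for x, continuous M}.
Proof.
split=> H; last first.
  move=> i j; rewrite /prop_for /continuous_at.
  exact: (continuous_comp H (@coord_continuous _ _ _ i j _)).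
apply/cvgrPdist_le => /= e e0; near=> y.
rewrite /Num.Def.normr/= mx_normrE (bigmax_le _ (ltW e0))//= => i _.
rewrite !mxE/=.
move: i; near: y; apply: filter_forall => /= i.
exact: ((cvgrPdist_le _ _).1 (H i.1 i.2)).
Unshelve. all: by end_near. Qed.

Lemma Ck_at_mxP k M x :
  (forall i j, Ck_at k (fun y => M y i j) x) <-> Ck_at k M x.
Proof.
elim: k M x => [|k IH] M x.
  split=> [H|H].
    apply/Ck_at0.
    have : \forall y \near x, forall ij, {for y, continuous (fun z => M z ij.1 ij.2)}.
      by apply: filter_forall => ij; apply/Ck_at0; exact: H.
    by apply: filterS => y H'; apply/continuous_mxP => i j; exact: (H' (i, j)).
  move=> i j; apply/Ck_at0; move/Ck_at0 : H.
  by apply: filterS => y /continuous_mxP; apply.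
split=> [H|H].
  have H' : \forall y \near x, forall ij, differentiable (fun z => M z ij.1 ij.2) y /\
     forall v, Ck_at k ('D_v (fun z => M z ij.1 ij.2)) y.
    by apply: filter_forall => ij; apply/Ck_atS; exact: H.
  apply/Ck_atS; move/near_join : H'; apply: filterS => y H'.
  split; first by apply/differentiable_mxP => i j; have [] := nbhs_singleton H' (i, j).
  move=> v; apply/IH => i j.
  have [_ /(_ v)] := nbhs_singleton H' (i, j); apply: Ck_at_near.
  apply: filterS H' => z H'; rewrite derive_mxE//; apply: diff_derivable.
  by apply/differentiable_mxP => i' j'; have [] := H' (i', j').
move=> i j; apply/Ck_atS; move/Ck_atS/near_join : H; apply: filterS => y H.
have [dM DM] := nbhs_singleton H.
split; first exact: (differentiable_mxP _ _).2 dM i j.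
move=> v; apply: Ck_at_near ((IH _ _).2 (DM v) i j).
apply: filterS H => z [dz _]; rewrite derive_mxE//.
exact: diff_derivable.
Unshelve. all: by end_near. Qed.

Lemma smooth_at_mxP M x :
  (forall i j, smooth_at (fun y => M y i j) x) <-> smooth_at M x.
Proof.
split=> H.
  have H' : \forall y \near x, forall ij k, class_C k [set y] (fun z => M z ij.1 ij.2).
    by apply: filter_forall => ij; exact: H.
  apply: Ck_smooth_at; move/near_join : H'; apply: filterS => y H' k.
  by apply/Ck_at_mxP => i j; apply: filterS H' => z /(_ (i, j)).
move=> i j; apply: Ck_smooth_at; move/smooth_at_nbhs : H.
by apply: filterS => y /smooth_at_Ck H k; exact: ((Ck_at_mxP _ _ _).2 (H k)).
Qed.

End matrix_valued.

Section scalar_valued.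
Context {R : realType} {E : normedModType R}.
Implicit Types (f g : E -> R) (x : E) (k : nat).

Lemma deriveMfun f g x v : derivable f x v -> derivable g x v ->
  'D_v (fun y => f y * g y) x = f x * 'D_v g x + g x * 'D_v f x.
Proof. exact: deriveM. Qed.

Lemma Ck_at_mul k f g x : Ck_at k f x -> Ck_at k g x -> Ck_at k (fun y => f y * g y) x.
Proof.
elim: k f g x => [|k IH] f g x.
  move=> /Ck_at0 H1 /Ck_at0 H2; apply/Ck_at0; apply: filterS2 H1 H2 => y H1 H2.
  exact: continuousM H1 H2.
move=> F1 G1; move: (F1) (G1) => /Ck_atS H1 /Ck_atS H2; apply/Ck_atS.
have F0 := Ck_at_pred F1; have G0 := Ck_at_pred G1.
near=> y.
have [d1 D1] : differentiable f y /\ forall v, Ck_at k ('D_v f) y by near: y.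
have [d2 D2] : differentiable g y /\ forall v, Ck_at k ('D_v g) y by near: y.
have F0y : Ck_at k f y by near: y; exact: near_join.
have G0y : Ck_at k g y by near: y; exact: near_join.
split=> [|v]; first exact: differentiableM.
apply: Ck_at_near (Ck_at_add (IH _ _ _ F0y (D2 v)) (IH _ _ _ G0y (D1 v))).
suff : \forall z \near y, differentiable f z /\ differentiable g z.
  by apply: filterS => z [? ?]; rewrite deriveMfun//; exact: diff_derivable.
near: y; apply: near_join.
by apply: filterS2 H1 H2 => y [? _] [? _].
Unshelve. all: by end_near. Qed.

(** Induction through (1/f)' = -(1/f)^2 f', whose right-hand side involves 1/f only at order k. The
    formula is available only near the point, where f stays nonzero. *)
Lemma Ck_at_inv k f x : f x != 0 -> Ck_at k f x -> Ck_at k (fun y => (f y)^-1) x.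
Proof.
elim: k f x => [|k IH] f x fx0.
  move=> /Ck_at0 H1; apply/Ck_at0.
  have f0 : \forall y \near x, f y != 0.
    exact: cvgr_neq0 (nbhs_singleton H1) fx0.
  by apply: filterS2 f0 H1 => y ? ?; exact: cvgV.
move=> F1; move: (F1) => /Ck_atS H1; apply/Ck_atS.
have F0 := Ck_at_pred F1.
have f0 : \forall y \near x, f y != 0.
  have /differentiable_continuous fc := Ck_at_differentiable F1.
  exact: cvgr_neq0 fc fx0.
near=> y.
have [d1 D1] : differentiable f y /\ forall v, Ck_at k ('D_v f) y by near: y.
have F0y : Ck_at k f y by near: y; exact: near_join.
have f0y : f y != 0 by near: y.
split=> [|v]; first exact: differentiableV.
have iv := IH _ _ f0y F0y.
apply: Ck_at_near (Ck_at_mul (Ck_at_cst k (-1 : R) y) (Ck_at_mul (Ck_at_mul iv iv) (D1 v))).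
suff : \forall z \near y, differentiable f z /\ f z != 0.
  apply: filterS => z [? ?]; rewrite deriveV//; last exact: diff_derivable.
  by rewrite [RHS]mulNr mulN1r expr2 invfM.
near: y; apply: near_join.
by apply: filterS2 H1 f0 => y [? _].
Unshelve. all: by end_near. Qed.

End scalar_valued.

Section composition.
Context {R : realType} {E : normedModType R} {m : nat}.
Implicit Types (f : E -> 'rV[R]_m) (x : E) (k : nat).

Lemma derive_comp_row (g : 'rV[R]_m -> R) f x v :
  differentiable f x -> differentiable g (f x) ->
  'D_v (fun y => g (f y)) x =
    \sum_j 'D_v (fun y => f y 0 j) x * 'D_(delta_mx 0 j) g (f x).
Proof.
move=> df dg; rewrite derive_comp// (row_sum_delta ('D_v f x)) deriveE// linear_sum.
apply: eq_bigr => j _; rewrite linearZ /= -deriveE// derive_mxE//.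
exact: diff_derivable.
Qed.

(** Since [g] is defined on row vectors, the chain rule gives a finite sum of products of partial
    derivatives of [g], taken along [f], with derivatives of the components of [f]; the induction
    applies to each factor. *)
Lemma Ck_at_comp_row k (g : 'rV[R]_m -> R) f x :
  Ck_at k g (f x) -> Ck_at k f x -> Ck_at k (fun y => g (f y)) x.
Proof.
elim: k g f x => [|k IH] g f x.
  move=> /Ck_at0 H1 /Ck_at0 H2; apply/Ck_at0.
  have := nbhs_singleton H2 _ H1; apply: filterS2 H2 => y fc gc.
  exact: continuous_comp fc gc.
move=> G1 F1; move: (G1) (F1) => /Ck_atS H1 /Ck_atS H2; apply/Ck_atS.
have fc := differentiable_continuous (Ck_at_differentiable F1).
have F0 := Ck_at_pred F1.
have {}H1 : \forall y \near x, differentiable g (f y) /\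
  forall v, Ck_at k ('D_v g) (f y) := fc _ H1.
near=> y.
have [d1 D1] : differentiable f y /\ forall v, Ck_at k ('D_v f) y by near: y.
have [d2 D2] : differentiable g (f y) /\ forall v, Ck_at k ('D_v g) (f y) by near: y.
have F0y : Ck_at k f y by near: y; exact: near_join.
split=> [|v]; first exact: differentiable_comp.
have T : Ck_at k (fun z => \sum_j ('D_v f z) 0 j * 'D_(delta_mx 0 j) g (f z)) y.
  apply: Ck_at_sum => j; apply: Ck_at_mul; first exact: ((Ck_at_mxP _ _ _).2 (D1 v)).
  exact: (IH ('D_(delta_mx 0 j) g)).
apply: Ck_at_near T.
suff : \forall z \near y, differentiable f z /\ differentiable g (f z).
  apply: filterS => z [? ?]; rewrite derive_comp_row//.
  by apply: eq_bigr => j _; rewrite derive_mxE//; exact: diff_derivable.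
near: y; apply: near_join.
by apply: filterS2 H1 H2 => y [? _] [? _].
Unshelve. all: by end_near. Qed.

Lemma Ck_at_comp k p q (g : 'rV[R]_m -> 'M[R]_(p, q)) f x :
  Ck_at k g (f x) -> Ck_at k f x -> Ck_at k (fun y => g (f y)) x.
Proof.
move=> /Ck_at_mxP G F; apply/Ck_at_mxP => i j.
exact: (@Ck_at_comp_row k (fun z => g z i j)).
Qed.

Lemma smooth_at_comp p q (g : 'rV[R]_m -> 'M[R]_(p, q)) f x :
  smooth_at g (f x) -> smooth_at f x -> smooth_at (fun y => g (f y)) x.
Proof.
move=> G F; apply: Ck_smooth_at.
have := smooth_at_continuous F (smooth_at_nbhs G).
apply: filterS2 (smooth_at_nbhs F) => y Fy Gy k.
by apply: Ck_at_comp; exact: smooth_at_Ck.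
Qed.

End composition.

(** The first derivatives are constant, so all higher orders follow from [Ck_at_cst]. Coordinates
    and parametrised lines enter the calculus here. *)
Lemma smooth_at_affine {R : realType} {E F : normedModType R} (f : E -> F) x :
  (forall y, differentiable f y) ->
  (forall v, exists c, forall y, 'D_v f y = c) -> smooth_at f x.
Proof.
move=> df Df; apply: Ck_smooth_at; apply: nearW => y [|k].
  by apply/Ck_at0; apply: nearW => z; exact: differentiable_continuous.
apply/Ck_atS; apply: nearW => z; split=> // v.
have [c fc] := Df v; apply: Ck_at_near (Ck_at_cst k c z).
by apply: nearW => u; rewrite fc.
Qed.

(** * Smoothness of algebraic and matrix operations *)

Section smooth_algebra.
Context {R : realType} {E : normedModType R}.
Implicit Types (f g : E -> R) (x : E).

Lemma smooth_at_cst {F : normedModType R} (c : F) x : smooth_at (cst c) x.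
Proof. by apply: Ck_smooth_at; apply: nearW => y k; exact: Ck_at_cst. Qed.

Lemma smooth_at_add {F : normedModType R} (f g : E -> F) x :
  smooth_at f x -> smooth_at g x -> smooth_at (fun y => f y + g y) x.
Proof.
move=> /smooth_at_nbhs F1 /smooth_at_nbhs G; apply: Ck_smooth_at.
by apply: filterS2 F1 G => y F1 G k; apply: Ck_at_add; exact: smooth_at_Ck.
Qed.

Lemma smooth_at_sum {F : normedModType R} (I : Type) (r : seq I) (f : I -> E -> F) x :
  (forall i, smooth_at (f i) x) -> smooth_at (fun y => \sum_(i <- r) f i y) x.
Proof.
move=> H; elim: r => [|i r IH].
  by apply: smooth_at_near (smooth_at_cst 0 x); apply: nearW => y; rewrite big_nil.
by apply: smooth_at_near (smooth_at_add (H i) IH); apply: nearW => y; rewrite big_cons.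
Qed.

Lemma smooth_at_mul f g x :
  smooth_at f x -> smooth_at g x -> smooth_at (fun y => f y * g y) x.
Proof.
move=> /smooth_at_nbhs F1 /smooth_at_nbhs G; apply: Ck_smooth_at.
by apply: filterS2 F1 G => y F1 G k; apply: Ck_at_mul; exact: smooth_at_Ck.
Qed.

Lemma smooth_at_prod (I : Type) (r : seq I) (f : I -> E -> R) x :
  (forall i, smooth_at (f i) x) -> smooth_at (fun y => \prod_(i <- r) f i y) x.
Proof.
move=> H; elim: r => [|i r IH].
  by apply: smooth_at_near (smooth_at_cst (1 : R) x); apply: nearW => y; rewrite big_nil.
by apply: smooth_at_near (smooth_at_mul (H i) IH); apply: nearW => y; rewrite big_cons.
Qed.

Lemma smooth_at_inv f x : f x != 0 -> smooth_at f x -> smooth_at (fun y => (f y)^-1) x.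
Proof.
move=> fx0 F; have fc := smooth_at_continuous F.
have f0 : \forall y \near x, f y != 0 by exact: cvgr_neq0 fc fx0.
apply: Ck_smooth_at; apply: filterS2 f0 (smooth_at_nbhs F) => y y0 Fy k.
by apply: Ck_at_inv => //; exact: smooth_at_Ck.
Qed.

Lemma smooth_at_opp {F : normedModType R} (f : E -> F) x :
  smooth_at f x -> smooth_at (fun y => - f y) x.
Proof.
suff C k z : Ck_at k f z -> Ck_at k (fun y => - f y) z.
  by move=> /smooth_at_nbhs H; apply: Ck_smooth_at; apply: filterS H => y H k; apply: C; exact: smooth_at_Ck.
elim: k f z => [|k IH] {}f z.
  by move=> /Ck_at0 H; apply/Ck_at0; apply: filterS H => y; exact: continuousN.
move=> /Ck_atS H; apply/Ck_atS; move/near_join : H; apply: filterS => y H.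
have [df Df] := nbhs_singleton H.
split=> [|v]; first exact: differentiableN.
apply: Ck_at_near (IH _ _ (Df v)); apply: filterS H => u [du _].
by rewrite -deriveN//; exact: diff_derivable.
Qed.

Lemma smooth_at_sub {F : normedModType R} (f g : E -> F) x :
  smooth_at f x -> smooth_at g x -> smooth_at (fun y => f y - g y) x.
Proof. by move=> F1 /smooth_at_opp; exact: smooth_at_add. Qed.

Lemma smooth_at_mulmx m n p (A : E -> 'M[R]_(m, n)) (B : E -> 'M[R]_(n, p)) x :
  smooth_at A x -> smooth_at B x -> smooth_at (fun y => A y *m B y) x.
Proof.
move=> /smooth_at_mxP HA /smooth_at_mxP HB; apply/smooth_at_mxP => i j.
apply: (@smooth_at_near _ _ _ (fun y => \sum_k A y i k * B y k j)).
  by apply: nearW => y; rewrite mxE.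
by apply: smooth_at_sum => k; exact: smooth_at_mul.
Qed.

Lemma smooth_at_trmx m n (A : E -> 'M[R]_(m, n)) x :
  smooth_at A x -> smooth_at (fun y => (A y)^T) x.
Proof.
move=> /smooth_at_mxP HA; apply/smooth_at_mxP => i j.
by apply: smooth_at_near (HA j i); apply: nearW => y; rewrite mxE.
Qed.

Lemma smooth_at_det n (A : E -> 'M[R]_n) x :
  smooth_at A x -> smooth_at (fun y => \det (A y)) x.
Proof.
move=> /smooth_at_mxP HA; rewrite /determinant.
apply: smooth_at_sum => s; apply: smooth_at_mul; first exact: smooth_at_cst.
exact: smooth_at_prod.
Qed.

(** Cramer's rule: near x the inverse is the adjugate divided by the determinant, and both are
    polynomial in the entries. *)
Lemma smooth_at_invmx n (A : E -> 'M[R]_n) x :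
  A x \in unitmx -> smooth_at A x -> smooth_at (fun y => invmx (A y)) x.
Proof.
move=> uA sA; have sd := smooth_at_det sA.
have d0 : \det (A x) != 0 by rewrite -unitfE -unitmxE.
have nd : \forall y \near x, \det (A y) != 0.
  exact: cvgr_neq0 (smooth_at_continuous sd) d0.
apply: (@smooth_at_near _ _ _ (fun y => (\det (A y))^-1 *: \adj (A y))).
  by apply: filterS nd => y dy; rewrite /invmx unitmxE unitfE dy.
apply/smooth_at_mxP => i j.
apply: (@smooth_at_near _ _ _ (fun y => (\det (A y))^-1 * ((-1) ^+ (j + i) *
   \det (row' j (col' i (A y)))))).
  by apply: nearW => y; rewrite !mxE.
apply: smooth_at_mul; first exact: smooth_at_inv.
apply: smooth_at_mul; first exact: smooth_at_cst.
apply: smooth_at_det; apply/smooth_at_mxP => k l.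
move/smooth_at_mxP : sA => /(_ (lift j k) (lift i l)); apply: smooth_at_near.
by apply: nearW => y; rewrite !mxE.
Qed.

Lemma smooth_at_scale m n f (A : E -> 'M[R]_(m, n)) x :
  smooth_at f x -> smooth_at A x -> smooth_at (fun y => f y *: A y) x.
Proof.
move=> sf /smooth_at_mxP sA; apply/smooth_at_mxP => i j.
by apply: smooth_at_near (smooth_at_mul sf (sA i j)); apply: nearW => y; rewrite mxE.
Qed.

End smooth_algebra.

Section matrix_domain.
Context {R : realType}.

Lemma derive_coord m n (i : 'I_m) (j : 'I_n) (x v : 'M[R]_(m, n)) :
  'D_v (fun N : 'M[R]_(m, n) => N i j) x = v i j.
Proof.
have dc : differentiable (fun N : 'M[R]_(m, n) => N : 'M[R]_(m, n)) x by [].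
by rewrite -[LHS](@derive_mxE _ _ _ _ id) ?derive_id//; exact: diff_derivable.
Qed.

Lemma smooth_at_coord m n (i : 'I_m) (j : 'I_n) (x : 'M[R]_(m, n)) :
  smooth_at (fun N : 'M[R]_(m, n) => N i j) x.
Proof.
apply: smooth_at_affine => [y|v]; first exact: differentiable_coord.
by exists (v i j) => y; rewrite derive_coord.
Qed.

Lemma smooth_at_id m n (x : 'M[R]_(m, n)) : smooth_at id x.
Proof. by apply/smooth_at_mxP => i j; exact: smooth_at_coord. Qed.

Lemma smooth_at_row_mx m n1 n2 (E : normedModType R) (f : E -> 'M[R]_(m, n1))
    (g : E -> 'M[R]_(m, n2)) x :
  smooth_at f x -> smooth_at g x -> smooth_at (fun y => row_mx (f y) (g y)) x.
Proof.
move=> /smooth_at_mxP F /smooth_at_mxP G; apply/smooth_at_mxP => i j.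
case: (split_ordP j) => k ->.
  by apply: smooth_at_near (F i k); apply: nearW => y; rewrite row_mxEl.
by apply: smooth_at_near (G i k); apply: nearW => y; rewrite row_mxEr.
Qed.

Lemma smooth_at_lsubmx m n1 n2 (E : normedModType R) (f : E -> 'M[R]_(m, n1 + n2)) x :
  smooth_at f x -> smooth_at (fun y => lsubmx (f y)) x.
Proof.
move=> /smooth_at_mxP F; apply/smooth_at_mxP => i j.
by apply: smooth_at_near (F i (lshift n2 j)); apply: nearW => y; rewrite mxE.
Qed.

Lemma smooth_at_rsubmx m n1 n2 (E : normedModType R) (f : E -> 'M[R]_(m, n1 + n2)) x :
  smooth_at f x -> smooth_at (fun y => rsubmx (f y)) x.
Proof.
move=> /smooth_at_mxP F; apply/smooth_at_mxP => i j.
by apply: smooth_at_near (F i (rshift n1 j)); apply: nearW => y; rewrite mxE.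
Qed.

Lemma smooth_at_jacobian m n (f : 'rV[R]_m -> 'rV[R]_n) x :
  smooth_at f x -> smooth_at (fun y => 'J f y) x.
Proof.
move=> F; apply/smooth_at_mxP => i j.
move/smooth_at_mxP : (smooth_at_derive (delta_mx 0 i) F) => /(_ 0 j).
apply: smooth_at_near; apply: filterS (smooth_at_nbhs F) => y Fy.
by rewrite deriveEjacobian -?rowE ?mxE//; exact: smooth_at_differentiable.
Qed.

End matrix_domain.

Section scalar_domain.
Context {R : realType} {E : normedModType R}.
Implicit Types (a v : E) (t : R).

Lemma is_derive_line a v t : is_derive t (1 : R) (fun s : R => a + s *: v) v.
Proof.
have dv : is_diff t (fun s : R => s *: v) (fun s => s *: v) by exact: is_diff_scalel.
have -> : (fun s : R => a + s *: v) = cst a + (fun s : R => s *: v) by [].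
apply: DeriveDef; first by apply: diff_derivable; apply: differentiableD.
rewrite deriveD//; last by apply: diff_derivable.
by rewrite derive_cst add0r deriveE// diff_val scale1r.
Qed.

Lemma smooth_at_line a v t : smooth_at (fun s : R => a + s *: v) t.
Proof.
have D u : differentiable (fun s : R => a + s *: v) u.
  by apply: differentiableD; [exact: differentiable_cst|exact: differentiableZl].
apply: smooth_at_affine => // w.
exists (w *: v) => y; rewrite deriveE//.
have -> : w = w *: (1 : R) by rewrite /GRing.scale /= mulr1.
by rewrite linearZ /= -deriveE// (@derive_val _ _ _ _ _ _ _ (is_derive_line a v y)) /GRing.scale /= mulr1.
Qed.

End scalar_domain.

Opaque derive.

Lemma dist_le_half {R : realFieldType} (p q w e : R) :
  `|p - w| < e / 2 -> `|q - w| < e / 2 -> `|p - q| <= e.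
Proof.
move=> pw qw; rewrite [e]splitr -(subrKA w) (le_trans (ler_normD _ _))//.
by rewrite lerD ?ltW// distrC.
Qed.

Lemma ball_segment {R : realType} {E : normedModType R} (x y z : E) (r s : R) :
  ball x r y -> ball x r z -> 0 <= s <= 1 -> ball x r (z + s *: (y - z)).
Proof.
rewrite -!ball_normE /= => xy xz /andP[s0 s1].
have -> : x - (z + s *: (y - z)) = (1 - s) *: (x - z) + s *: (x - y).
  transitivity (x - z + s *: (z - y)); first by rewrite opprD addrA -scalerN opprB.
  rewrite scalerBl scale1r -[RHS]addrA; congr (x - z + _).
  by rewrite -scalerN -scalerDr opprB subrKA.
rewrite (le_lt_trans (ler_normD _ _))// !normrZ [`|s|]ger0_norm// ger0_norm ?subr_ge0//.
(* At s = 1 the term that carries the strict inequality has weight 0, so this end point is treated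
   apart. *)
have [->|s1'] := eqVneq s 1; first by rewrite subrr mul0r add0r mul1r.
apply: (@lt_le_trans _ _ ((1 - s) * r + s * r)); last by rewrite -mulrDl subrK mul1r.
rewrite ltr_leD//; first by rewrite ltr_pM2l// subr_gt0 lt_neqAle s1'.
by rewrite ler_wpM2l// ltW.
Qed.

(** * Mean value theorem and symmetry of second derivatives *)

Section mean_value.
Context {R : realType} {E : normedModType R}.
Implicit Types (f : E -> R) (a v : E).

Lemma is_derive_comp_line {F : normedModType R} (f : E -> F) a v (t : R) :
  differentiable f (a + t *: v) ->
  is_derive t (1 : R) (fun s : R => f (a + s *: v)) ('D_v f (a + t *: v)).
Proof.
move=> df; have L := is_derive_line a v t.
have dl : differentiable (fun s : R => a + s *: v) t.
  exact/smooth_at_differentiable/smooth_at_line.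
apply: DeriveDef; first by apply: diff_derivable; exact: differentiable_comp.
by rewrite (@derive_comp _ _ _ _ (fun s : R => a + s *: v) f)// (@derive_val _ _ _ _ _ _ _ L).
Qed.

Lemma mean_value_line f a v (h : R) : 0 <= h ->
  (forall s : R, 0 <= s <= h -> differentiable f (a + s *: v)) ->
  exists2 c, 0 <= c <= h & f (a + h *: v) - f a = h * 'D_v f (a + c *: v).
Proof.
move=> h0 df.
have := @MVT_segment R (fun s => f (a + s *: v)) (fun s => 'D_v f (a + s *: v)) 0 h h0.
case=> [x||c].
- by rewrite in_itv/= => /andP[x0 xh]; apply/is_derive_comp_line/df; rewrite !ltW.
- apply: derivable_within_continuous => x; rewrite in_itv/= => xh.
  by have [] := is_derive_comp_line (df _ xh).
- by rewrite in_itv/= scale0r addr0 subr0 mulrC => ch ->; exists c.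
Qed.

(** The mean value theorem is used along u for the increment y -> f(y + hv) - f(y), then along v for
    ['D_u f]. Smoothness is asked on the whole parallelogram because the intermediate point is
    unknown. *)
Lemma second_difference f a u v (h : R) : 0 <= h ->
  (forall s t : R, 0 <= s <= h -> 0 <= t <= h -> smooth_at f (a + s *: u + t *: v)) ->
  exists s t : R, [/\ 0 <= s <= h, 0 <= t <= h &
    f (a + h *: u + h *: v) - f (a + h *: u) - (f (a + h *: v) - f a) =
    h * (h * 'D_v ('D_u f) (a + s *: u + t *: v))].
Proof.
move=> h0 sf.
have h00 : (0 : R) <= 0 <= h by rewrite lexx.
have hh : 0 <= h <= h by rewrite h0 lexx.
have sf0 s : 0 <= s <= h -> smooth_at f (a + s *: u).
  by move=> sh; have := sf s 0 sh h00; rewrite scale0r addr0.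
have sfh s : 0 <= s <= h -> smooth_at f (a + s *: u + h *: v).
  by move=> sh; exact: sf.
pose g := fun y => f (y + h *: v) - f y.
have tr y : is_diff y (fun z => z + h *: v) id.
  have -> : (fun z => z + h *: v) = id + cst (h *: v) by [].
  by apply: is_diff_eq; rewrite addr0.
have dfs s : 0 <= s <= h -> differentiable (fun y => f (y + h *: v)) (a + s *: u).
  move=> sh; apply: (@differentiable_comp _ _ _ _ (fun y => y + h *: v)) => //.
  exact/smooth_at_differentiable/sfh.
have dg s : 0 <= s <= h -> differentiable g (a + s *: u).
  move=> sh; apply: differentiableB; first exact: dfs.
  exact/smooth_at_differentiable/sf0.
have [s sh sE] := mean_value_line h0 dg.
have D2 t : 0 <= t <= h -> differentiable ('D_u f) (a + s *: u + t *: v).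
  by move=> th; exact/smooth_at_differentiable/smooth_at_derive/sf.
have [t th tE] := mean_value_line h0 D2.
exists s, t; split=> //.
rewrite -tE -[LHS]/(g (a + h *: u) - (f (a + h *: v) - f a)) -[_ - _ in X in _ - X]/(g a) sE.
congr (_ * _).
have E1 : 'D_u (fun y => f (y + h *: v)) (a + s *: u) = 'D_u f (a + s *: u + h *: v).
  rewrite (@derive_comp _ _ _ _ (fun y => y + h *: v))//; last first.
    exact/smooth_at_differentiable/sfh.
  by rewrite [in X in 'D_X f _]deriveE// diff_val.
rewrite -E1 -[LHS]/('D_u ((fun y => f (y + h *: v)) - f) _) deriveB//.
  exact/diff_derivable/dfs.
exact/smooth_at_derivable/sf0.
Qed.

(** The second difference over a small parallelogram, read in the two orders, is h^2 times either
    mixed derivative at points close to a. Dividing by h^2 and using the continuity of both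
    derivatives gives equality up to any e. *)
Lemma derive_swap_scalar f a u v :
  smooth_at f a -> 'D_u ('D_v f) a = 'D_v ('D_u f) a.
Proof.
move=> sf.
have c1 := smooth_at_continuous (smooth_at_derive u (smooth_at_derive v sf)).
have c2 := smooth_at_continuous (smooth_at_derive v (smooth_at_derive u sf)).
apply/eqP; rewrite -subr_eq0 -normr_le0; apply/ler_addgt0Pl => e e0; rewrite addr0.
have e2 : 0 < e / 2 by rewrite divr_gt0.
have /nbhs_ballP[r /= r0 rP] : nbhs a (fun y => [/\ smooth_at f y,
    `|'D_u ('D_v f) a - 'D_u ('D_v f) y| < e / 2 &
    `|'D_v ('D_u f) a - 'D_v ('D_u f) y| < e / 2]).
  have n1 : \forall y \near a, `|'D_u ('D_v f) a - 'D_u ('D_v f) y| < e / 2.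
    by move/cvgrPdist_lt : c1; apply.
  have n2 : \forall y \near a, `|'D_v ('D_u f) a - 'D_v ('D_u f) y| < e / 2.
    by move/cvgrPdist_lt : c2; apply.
  by move: (smooth_at_nbhs sf) n1 n2; apply: filterS3 => y; split.
(* With this h the parallelogram of sides hu and hv stays within r / 2 of a; the + 1 avoids dividing
   by 0 when u and v vanish. *)
pose h := r / 2 / (`|u| + `|v| + 1).
have N0 : 0 < `|u| + `|v| + 1 by rewrite ltr_wpDl// addr_ge0.
have h0 : 0 < h by rewrite !divr_gt0.
have inball s t : 0 <= s <= h -> 0 <= t <= h -> ball a r (a + s *: u + t *: v).
  move=> /andP[s0 sh] /andP[t0 th]; rewrite -ball_normE /= -addrA opprD addNKr.
  rewrite normrN (le_lt_trans (ler_normD _ _))// !normrZ !ger0_norm//.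
  apply: (@le_lt_trans _ _ (h * (`|u| + `|v| + 1))).
    by rewrite !mulrDr mulr1 ler_wpDr ?(ltW h0)//; apply: lerD; rewrite ler_wpM2r.
  by rewrite /h divfK ?gt_eqF// ltr_pdivrMr// ltr_pMr// ltr1n.
have inball' s t : 0 <= s <= h -> 0 <= t <= h -> ball a r (a + t *: v + s *: u).
  by move=> sh th; rewrite addrAC; exact: inball.
have [s [t [sh th E1]]] := @second_difference f a u v h (ltW h0)
  (fun s t sh th => let: And3 H _ _ := rP _ (inball s t sh th) in H).
have [t' [s' [th' sh' E2]]] := @second_difference f a v u h (ltW h0)
  (fun t s th sh => let: And3 H _ _ := rP _ (inball' s t sh th) in H).
have EE : 'D_v ('D_u f) (a + s *: u + t *: v) = 'D_u ('D_v f) (a + t' *: v + s' *: u).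
  have hn0 : h != 0 by rewrite gt_eqF.
  rewrite (addrAC a (h *: v)) in E2.
  have S (p q w z : R) : p - q - (w - z) = p - w - (q - z) by ring.
  exact: (mulfI hn0 (mulfI hn0 (etrans (esym E1) (etrans (S _ _ _ _) E2)))).
have [_ _ H1] := rP _ (inball _ _ sh th).
have [_ H2 _] := rP _ (inball' _ _ sh' th').
rewrite EE in H1.
exact: dist_le_half H2 H1.
Unshelve. all: by end_near. Qed.

End mean_value.

Section matrix_norm.
Context {R : realType} {m n : nat}.

Lemma norm_entry_le (A : 'M[R]_(m, n)) i j : `|A i j| <= `|A|.
Proof.
rewrite [leRHS]/Num.Def.normr/= mx_normrE.
exact: (le_bigmax _ (fun ij : 'I_m * 'I_n => `|A ij.1 ij.2|) (i, j)).
Qed.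

Lemma mx_norm_le (A : 'M[R]_(m, n)) (c : R) : 0 <= c ->
  (forall i j, `|A i j| <= c) -> `|A| <= c.
Proof.
by move=> c0 H; rewrite [leLHS]/Num.Def.normr/= mx_normrE bigmax_le.
Qed.

End matrix_norm.

Lemma near_forall_fin {T : topologicalType} {I : finType} (P : I -> T -> Prop) (x : T) :
  (forall i, \forall y \near x, P i y) -> (\forall y \near x, forall i, P i y).
Proof. exact: filter_forall. Qed.

Section vector_calculus.
Context {R : realType}.

Lemma derive_subdir {E F : normedModType R} (f : E -> F) (x u v : E) :
  differentiable f x -> 'D_(u - v) f x = 'D_u f x - 'D_v f x.
Proof. by move=> df; rewrite !deriveE// linearB. Qed.

Lemma derive_adddir {E F : normedModType R} (f : E -> F) (x u v : E) :
  differentiable f x -> 'D_(u + v) f x = 'D_u f x + 'D_v f x.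
Proof. by move=> df; rewrite !deriveE// linearD. Qed.

Lemma derive_scaledir {E F : normedModType R} (f : E -> F) (x u : E) (c : R) :
  differentiable f x -> 'D_(c *: u) f x = c *: 'D_u f x.
Proof. by move=> df; rewrite !deriveE// linearZ. Qed.


Lemma derive_rowE {F : normedModType R} m (f : 'rV[R]_m -> F) (x v : 'rV[R]_m) :
  differentiable f x -> 'D_v f x = \sum_j v 0 j *: 'D_(delta_mx 0 j) f x.
Proof.
move=> df; rewrite deriveE// {1}(row_sum_delta v) linear_sum.
by apply: eq_bigr => j _; rewrite linearZ /= -deriveE.
Qed.

Lemma derive_swap {E : normedModType R} {m n} (f : E -> 'M[R]_(m, n)) a u v :
  smooth_at f a -> 'D_u ('D_v f) a = 'D_v ('D_u f) a.
Proof.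
move=> sf; apply/matrixP => i j.
have H w1 w2 : 'D_w1 ('D_w2 f) a i j = 'D_w1 ('D_w2 (fun y => f y i j)) a.
  rewrite derive_mxE; last exact/smooth_at_derivable/smooth_at_derive.
  apply: near_eq_derive; apply: filterS (smooth_at_nbhs sf) => y sy.
  by rewrite derive_mxE//; exact: smooth_at_derivable.
have /smooth_at_mxP/(_ i j) sij := sf.
exact: etrans (H u v) (etrans (derive_swap_scalar u v sij) (esym (H v u))).
Qed.

(** Mean value theorem for each entry along a segment, which stays in the ball by convexity. *)
Lemma smooth_at_lipschitz m p q (f : 'rV[R]_m -> 'M[R]_(p, q)) (a : 'rV[R]_m) : smooth_at f a ->
  exists K, 0 <= K /\ exists2 r, 0 < r &
    forall y z, ball a r y -> ball a r z -> `|f y - f z| <= K * `|y - z|.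
Proof.
move=> sf.
have nb : \forall y \near a, smooth_at f y /\
    forall i, `|'D_(delta_mx 0 i) f a - 'D_(delta_mx 0 i) f y| < 1.
  have := smooth_at_nbhs sf.
  have H : \forall y \near a, forall i : 'I_m, `|'D_(delta_mx 0 i) f a - 'D_(delta_mx 0 i) f y| < 1.
    apply: near_forall_fin => i.
    have := smooth_at_continuous (smooth_at_derive (delta_mx 0 i) sf).
    by move/cvgrPdist_lt; apply.
  by move: H; apply: filterS2.
have /nbhs_ballP[r /= r0 rP] := nb.
(* On the ball each partial derivative is within 1 of its value at a; the increment is a combination
   of them with coefficients at most |y - z|. *)
pose K := \sum_(i < m) (`|'D_(delta_mx 0 i) f a| + 1).
have K0 : 0 <= K by apply: sumr_ge0 => i _; rewrite addr_ge0.
exists K; split=> //; exists r => // y z ya za.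
apply: mx_norm_le => [|i j]; first by rewrite mulr_ge0.
rewrite !mxE.
have seg s : 0 <= s <= 1 -> ball a r (z + s *: (y - z)).
  move=> /andP[s0 s1]; move: ya za; rewrite -!ball_normE /= => ya za.
  have -> : a - (z + s *: (y - z)) = (1 - s) *: (a - z) + s *: (a - y).
    by apply/matrixP => i' j'; rewrite !mxE; ring.
  rewrite (le_lt_trans (ler_normD _ _))// !normrZ [`|s|]ger0_norm// ger0_norm ?subr_ge0//.
  have [->|s1'] := eqVneq s 1; first by rewrite subrr mul0r add0r mul1r.
  apply: (@lt_le_trans _ _ ((1 - s) * r + s * r)); last by rewrite -mulrDl subrK mul1r.
  rewrite ltr_leD//; first by rewrite ltr_pM2l// subr_gt0 lt_neqAle s1'.
  by rewrite ler_wpM2l// ltW.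
have ds s : 0 <= s <= 1 -> differentiable (fun w => f w i j) (z + s *: (y - z)).
  move=> sh; have [/smooth_at_mxP/(_ i j) sy _] := rP _ (seg _ sh).
  exact: smooth_at_differentiable.
have [c ch] := mean_value_line ler01 ds.
rewrite mul1r scale1r [z + (y - z)]addrC subrK => ->.
have [sc Dc] := rP _ (seg _ ch).
have dc := smooth_at_differentiable sc.
rewrite -(@derive_mxE _ _ _ _ f)//; last exact: diff_derivable.
rewrite derive_rowE// summxE (le_trans (ler_norm_sum _ _ _))// /K mulr_suml.
apply: ler_sum => k _; rewrite mxE normrM mulrC.
apply: ler_pM => //; last exact: norm_entry_le.
rewrite (le_trans (norm_entry_le _ _ _))//.
rewrite -[X in `|X|](subKr ('D_(delta_mx 0 k) f a)) (le_trans (ler_normB _ _))//.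
by rewrite lerD2l ltW.
Qed.

(* The derivative along the integral curve of a non-constant field splits off
   a second derivative that is symmetric by Schwarz's theorem. *)
Lemma derive_along_field m n (h : 'rV[R]_m -> 'rV[R]_n) (X : 'rV[R]_m -> 'rV[R]_m) (a w : 'rV[R]_m) :
  smooth_at h a -> smooth_at X a ->
  'D_w (fun y => 'D_(X y) h y) a = 'D_('D_w X a) h a + 'D_w ('D_(X a) h) a.
Proof.
move=> sh sX; have dX := smooth_at_differentiable sX.
have dh := smooth_at_differentiable sh.
have E1 (y v : 'rV[R]_m) : smooth_at h y -> 'D_v h y = \sum_j v 0 j *: 'D_(delta_mx 0 j) h y.
  by move=> /smooth_at_differentiable /derive_rowE.
have N : \forall y \near a, smooth_at h y by exact: smooth_at_nbhs.
have Dj (k : 'I_n) (j : 'I_m) : smooth_at (fun y => 'D_(delta_mx 0 j) h y 0 k) a.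
  by have /smooth_at_mxP := smooth_at_derive (delta_mx 0 j) sh; apply.
have Xj j : smooth_at (fun y => X y 0 j) a by move/smooth_at_mxP : sX; apply.
have L (v : 'rV[R]_m) : 'D_w ('D_v h) a = \sum_j v 0 j *: 'D_w ('D_(delta_mx 0 j) h) a.
  apply/matrixP => i k; rewrite (ord1 i) summxE.
  rewrite derive_mxE; last exact/smooth_at_derivable/smooth_at_derive.
  rewrite (@near_eq_derive _ _ _ _ (fun y => \sum_j v 0 j * 'D_(delta_mx 0 j) h y 0 k)).
    rewrite derive_sumfun => [|j].
      apply: eq_bigr => j _; rewrite deriveMfun.
      - by rewrite derive_cst mulr0 addr0 mxE derive_mxE//; exact/smooth_at_derivable/smooth_at_derive.
      - exact: derivable_cst.
      - exact: smooth_at_derivable.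
    by apply/smooth_at_derivable/smooth_at_mul => //; exact: smooth_at_cst.
  by apply: filterS N => y /E1 ->; rewrite summxE; apply: eq_bigr => j _; rewrite mxE.
rewrite (L (X a)).
rewrite (E1 a)// -big_split /=.
apply/matrixP => i k; rewrite (ord1 i).
have sXh : smooth_at (fun y => \sum_j X y 0 j *: 'D_(delta_mx 0 j) h y) a.
  by apply: smooth_at_sum => j; apply: smooth_at_scale => //; exact: smooth_at_derive.
rewrite (@near_eq_derive _ _ _ _ (fun y => \sum_j X y 0 j *: 'D_(delta_mx 0 j) h y)); last first.
  by apply: filterS N => y /E1 ->.
rewrite derive_mxE; last exact: smooth_at_derivable.
rewrite (_ : (fun _ => _) = (fun y => \sum_j X y 0 j * 'D_(delta_mx 0 j) h y 0 k)); last first.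
  by apply/funext => y; rewrite summxE; apply: eq_bigr => j _; rewrite mxE.
rewrite derive_sumfun => [|j]; last by apply/smooth_at_derivable/smooth_at_mul.
rewrite summxE; apply: eq_bigr => j _.
rewrite deriveMfun; [|exact: smooth_at_derivable|exact: smooth_at_derivable].
rewrite !mxE -(derive_mxE 0 j (@smooth_at_derivable _ _ _ _ _ w sX)).
rewrite -(derive_mxE 0 k (@smooth_at_derivable _ _ _ _ _ w (smooth_at_derive (delta_mx 0 j) sh))).
by rewrite [X in _ + X]mulrC addrC.
Qed.

Definition local_bracket n (X Y : 'rV[R]_n -> 'rV[R]_n) u :=
  'D_(X u) Y u - 'D_(Y u) X u.

(** Each relation is differentiated along the other field. This produces the image of a derivative
    of the fields plus a second derivative of [h]; the second derivatives cancel in the difference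
    by Schwarz's theorem. *)
Lemma related_local_bracket m n (h : 'rV[R]_m -> 'rV[R]_n)
    (X1 X2 : 'rV[R]_m -> 'rV[R]_m) (Y1 Y2 : 'rV[R]_n -> 'rV[R]_n) (a : 'rV[R]_m) :
  smooth_at h a -> smooth_at X1 a -> smooth_at X2 a ->
  smooth_at Y1 (h a) -> smooth_at Y2 (h a) ->
  (\forall y \near a, 'D_(X1 y) h y = Y1 (h y)) ->
  (\forall y \near a, 'D_(X2 y) h y = Y2 (h y)) ->
  local_bracket Y1 Y2 (h a) = 'D_(local_bracket X1 X2 a) h a.
Proof.
move=> sh s1 s2 t1 t2 r1 r2; have dh := smooth_at_differentiable sh.
have H (X X' : 'rV[R]_m -> 'rV[R]_m) (Y Y' : 'rV[R]_n -> 'rV[R]_n) :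
    smooth_at X' a -> smooth_at Y' (h a) ->
    (\forall y \near a, 'D_(X y) h y = Y (h y)) ->
    (\forall y \near a, 'D_(X' y) h y = Y' (h y)) ->
    'D_(Y (h a)) Y' (h a) = 'D_('D_(X a) X' a) h a + 'D_(X a) ('D_(X' a) h) a.
  move=> sX' sY' r r'; rewrite -(nbhs_singleton r) -derive_comp//; last first.
    exact: smooth_at_differentiable.
  rewrite -derive_along_field//; apply: near_eq_derive.
  by apply: filterS r' => y ->.
rewrite /local_bracket (H _ _ _ _ s2 t2 r1 r2) (H _ _ _ _ s1 t1 r2 r1).
have S (V : zmodType) (p q r s : V) : q = s -> p + q - (r + s) = p - r.
  by move=> ->; rewrite opprD addrACA subrr addr0.
by apply: etrans (S _ _ _ _ _ (derive_swap (X1 a) (X2 a) sh)) _; rewrite derive_subdir.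
Qed.

End vector_calculus.

Section jacobian_theory.
Context {R : realType}.

Lemma row_jacobian m n (f : 'rV[R]_m -> 'rV[R]_n) (a : 'rV[R]_m) i :
  differentiable f a -> row i ('J f a) = 'D_(delta_mx 0 i) f a.
Proof. by move=> df; rewrite deriveEjacobian// -rowE. Qed.

Lemma jacobian_near m n (f g : 'rV[R]_m -> 'rV[R]_n) (a : 'rV[R]_m) :
  (\forall u \near a, f u = g u) -> differentiable f a -> 'J f a = 'J g a.
Proof.
move=> fg df; have dg := near_eq_differentiable fg df.
apply/row_matrixP => i; apply: etrans (row_jacobian i df) _.
by apply: etrans _ (esym (row_jacobian i dg)); exact: near_eq_derive.
Qed.

(** Matrices act on row vectors from the right, so Jacobians multiply in the order in which the maps
    are applied. *)
Lemma jacobian_comp m n l (f : 'rV[R]_m -> 'rV[R]_n) (g : 'rV[R]_n -> 'rV[R]_l)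
    (a : 'rV[R]_m) : differentiable f a -> differentiable g (f a) ->
  'J (g \o f) a = 'J f a *m 'J g (f a).
Proof.
move=> df dg; apply/row_matrixP => i; rewrite row_mul.
rewrite (row_jacobian i (differentiable_comp df dg)) (row_jacobian i df).
by rewrite (derive_comp _ df dg) deriveEjacobian.
Qed.

Lemma jacobian_id m (a : 'rV[R]_m) : 'J id a = 1%:M.
Proof.
apply/row_matrixP => i; rewrite row_jacobian// derive_id rowE mulmx1//.
Qed.

End jacobian_theory.

(** * Charts, tangent maps and vector fields *)

(* The part of [is_manifold] that is purely about charts; unlike separation
   and countability, it passes to [prod_atlas] at no cost. *)
Record is_charted (R : realType) (n : nat) (M : topologicalType)
    (A : atlas R n M) : Prop := IsCharted {
  ch_dom_at : forall p, chart_dom (chart_at A p) p ;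
  ch_dom_open : forall i : chart_index A, open (chart_dom i) ;
  ch_img_open : forall i : chart_index A, open (chart_img i) ;
  ch_chartK : forall (i : chart_index A) p,
    chart_dom i p -> chart_inv i (chart i p) = p ;
  ch_cts : forall (i : chart_index A) p,
    chart_dom i p -> {for p, continuous (chart i)} ;
  ch_inv_cts : forall (i : chart_index A) u,
    chart_img i u -> {for u, continuous (chart_inv i)} ;
  ch_transition : forall (i j : chart_index A) p, chart_dom i p -> chart_dom j p ->
    smooth_at (chart j \o chart_inv i) (chart i p) }.

Section charts.
Context {R : realType} {n : nat} {M : topologicalType} {A : atlas R n M}.
Hypothesis HA : is_charted A.
Implicit Types (i j k : chart_index A) (p : M) (u : 'rV[R]_n).

Lemma chart_img_chart i p : chart_dom i p -> chart_img i (chart i p).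
Proof. by move=> ip; exists p. Qed.

Lemma chart_inv_dom i u : chart_img i u -> chart_dom i (chart_inv i u).
Proof. by move=> [p ip <-]; rewrite (ch_chartK HA). Qed.

Lemma chart_invK i u : chart_img i u -> chart i (chart_inv i u) = u.
Proof. by move=> [p ip <-]; rewrite (ch_chartK HA). Qed.

Lemma near_chart_dom i p : chart_dom i p -> \forall q \near p, chart_dom i q.
Proof. by move=> ip; apply: open_nbhs_nbhs; split=> //; exact: ch_dom_open. Qed.

Lemma near_chart_img i p : chart_dom i p -> \forall u \near chart i p, chart_img i u.
Proof.
move=> ip; apply: open_nbhs_nbhs; split; first exact: ch_img_open.
exact: chart_img_chart.
Qed.

Lemma near_chart_inv i p (P : M -> Prop) : chart_dom i p ->
  (\forall q \near p, P q) -> \forall u \near chart i p, P (chart_inv i u).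
Proof.
move=> ip Pp; have := ch_inv_cts HA (chart_img_chart ip).
by rewrite /prop_for /continuous_at (ch_chartK HA)//; apply.
Qed.

Lemma near_chart i p (P : 'rV[R]_n -> Prop) : chart_dom i p ->
  (\forall u \near chart i p, P u) -> \forall q \near p, P (chart i q).
Proof. by move=> ip Pp; apply: (ch_cts HA ip). Qed.

End charts.

(** The image of the overlap of two domains is a neighbourhood of [chart i p], which turns
    smoothness on that set into smoothness at the point. *)
Lemma manifold_charted (R : realType) (n : nat) (M : topologicalType)
  (A : atlas R n M) : is_manifold A -> is_charted A.
Proof.
case=> _ _ h1 h2 h3 h4 h5 h6 h7; split=> // i j p ip jp.
have H : \forall u \near chart i p, (chart i @` (chart_dom i `&` chart_dom j)) u.
  have ui : chart_img i (chart i p) by exists p.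
  have N1 : \forall u \near chart i p, chart_img i u.
    by apply: open_nbhs_nbhs.
  have N2 : \forall u \near chart i p, chart_dom j (chart_inv i u).
    apply: (h6 i _ ui); rewrite h4//; exact: open_nbhs_nbhs.
  move: N1 N2; apply: filterS2 => u [q iq <-]; rewrite h4// => jq.
  by exists q.
by apply: filterS H => u Hu k; apply: class_C_sub (h7 i j k) => _ ->.
Qed.

Section smooth_maps.
Context {R : realType} {m n : nat} {M N : topologicalType}.
Context {A : atlas R m M} {B : atlas R n N}.

Definition locmap (i : chart_index A) (j : chart_index B) (f : M -> N) :=
  chart j \o f \o chart_inv i.

(** For [f = id] this is the change of basis between two charts, so one chain rule, [Jloc_comp],
    covers both tangent maps and changes of chart. *)
Definition Jloc i j f p : 'M[R]_(m, n) := 'J (locmap i j f) (chart i p).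

Definition smooth_map_at (f : M -> N) (p : M) :=
  {for p, continuous f} /\
  forall i j, chart_dom i p -> chart_dom j (f p) -> smooth_at (locmap i j f) (chart i p).

Lemma tangent_mapE f p :
  tangent_map A B f p = Jloc (chart_at A p) (chart_at B (f p)) f p.
Proof. by []. Qed.

Hypotheses (HA : is_charted A) (HB : is_charted B).

Lemma smooth_map_at_of f p : smooth_map A B f -> smooth_map_at f p.
Proof.
move=> [cf sf]; split; first exact: cf.
move=> i j ip jp.
have H : \forall u \near chart i p, (chart i @` (chart_dom i `&` f @^-1` chart_dom j)) u.
  have N2 : \forall q \near p, chart_dom i q /\ chart_dom j (f q).
    have N1 := near_chart_dom HA ip.
    have := cf p _ (near_chart_dom HB jp).
    by move: N1; apply: filterS2.
  move: (near_chart_inv HA ip N2) (near_chart_img HA ip).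
  apply: filterS2 => u [h1 h2] h3; exists (chart_inv i u) => //.
  exact: chart_invK.
by apply: filterS H => u Hu k; apply: class_C_sub (sf i j k) => _ ->.
Qed.

End smooth_maps.

Arguments smooth_map_at {R m n M N} A B f p.

Section composition.
Context {R : realType} {m n l : nat} {M N P : topologicalType}.
Context {A : atlas R m M} {B : atlas R n N} {C : atlas R l P}.
Hypotheses (HA : is_charted A) (HB : is_charted B) (HC : is_charted C).
Implicit Types (f : M -> N) (g : N -> P).

Lemma locmap_comp (i : chart_index A) (j : chart_index B) (k : chart_index C) f g p : {for p, continuous f} -> chart_dom i p ->
  chart_dom j (f p) -> \forall u \near chart i p,
  locmap  i k (g \o f) u = locmap  j k g (locmap i j f u).
Proof.
move=> fc ip jp; have := near_chart_inv HA ip (fc _ (near_chart_dom HB jp)).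
by apply: filterS => u /= h; rewrite /locmap /= (ch_chartK HB).
Qed.

Lemma smooth_map_at_comp f g p : smooth_map_at A B f p ->
  smooth_map_at B C g (f p) -> smooth_map_at A C (g \o f) p.
Proof.
move=> [fc sf] [gc sg]; split; first exact: continuous_comp.
move=> i k ip kp; have jp := ch_dom_at HB (f p).
have := locmap_comp k g fc ip jp => E.
apply: smooth_at_near; first by apply: filterS E => u /esym; apply.
apply: smooth_at_comp (sf _ _ ip jp).
by rewrite /locmap /= (ch_chartK HA)//; exact: sg.
Qed.

Lemma Jloc_comp (i : chart_index A) (j : chart_index B) (k : chart_index C) f g p : smooth_map_at A B f p ->
  smooth_map_at B C g (f p) ->
  chart_dom i p -> chart_dom j (f p) -> chart_dom k (g (f p)) ->
  Jloc  i k (g \o f) p = Jloc i j f p *m Jloc j k g (f p).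
Proof.
move=> sf sg ip jp kp.
have d2 := smooth_at_differentiable (sf.2 i j ip jp).
have d3 := smooth_at_differentiable (sg.2 j k jp kp).
have e : locmap i j f (chart i p) = chart j (f p) by rewrite /locmap /= (ch_chartK HA).
rewrite -[RHS](_ : 'J (locmap j k g \o locmap i j f) (chart i p) = _); last first.
  by rewrite jacobian_comp ?e.
apply: jacobian_near; first exact: (locmap_comp k g sf.1 ip jp).
exact: smooth_at_differentiable ((smooth_map_at_comp sf sg).2 i k ip kp).
Qed.

Lemma tangent_map_comp f g p : smooth_map_at A B f p ->
  smooth_map_at B C g (f p) ->
  tangent_map A C (g \o f) p = tangent_map A B f p *m tangent_map B C g (f p).
Proof.
by move=> sf sg; rewrite !tangent_mapE -(Jloc_comp sf sg)//; exact: ch_dom_at.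
Qed.

End composition.

Section identity.
Context {R : realType} {n : nat} {M : topologicalType} {A : atlas R n M}.
Hypothesis HA : is_charted A.
Implicit Types (i j k : chart_index A).

Lemma smooth_map_at_id p : smooth_map_at A A id p.
Proof. by split=> // i j ip jp; apply: ch_transition. Qed.

Lemma Jloc_id i p : chart_dom i p -> Jloc i i id p = 1%:M.
Proof.
move=> ip; rewrite -(jacobian_id (chart i p)); apply: jacobian_near.
  by apply: filterS (near_chart_img HA ip) => u; exact: chart_invK.
exact: smooth_at_differentiable ((smooth_map_at_id p).2 i i ip ip).
Qed.

Lemma tangent_map_id p : tangent_map A A id p = 1%:M.
Proof. by rewrite tangent_mapE Jloc_id//; exact: ch_dom_at. Qed.

Lemma Jloc_trans i j k p : chart_dom i p -> chart_dom j p -> chart_dom k p ->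
  Jloc i j id p *m Jloc j k id p = Jloc i k id p.
Proof.
move=> ip jp kp; rewrite -(Jloc_comp HA HA (smooth_map_at_id p) (smooth_map_at_id p))//.
Qed.

Lemma Jloc_inv i j p : chart_dom i p -> chart_dom j p ->
  Jloc i j id p *m Jloc j i id p = 1%:M.
Proof. by move=> ip jp; rewrite Jloc_trans// Jloc_id. Qed.

Lemma to_chartE i p : chart_dom i p ->
  to_chart (A:=A) i (chart i p) = Jloc (chart_at A p) i id p.
Proof. by move=> ip; rewrite /to_chart (ch_chartK HA). Qed.

Lemma of_chartE i p : chart_dom i p ->
  of_chart (A:=A) i (chart i p) = Jloc i (chart_at A p) id p.
Proof. by move=> ip; rewrite /of_chart (ch_chartK HA). Qed.

Lemma vector_inE i X p : chart_dom i p ->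
  vector_in (A:=A) i X (chart i p) = X p *m Jloc (chart_at A p) i id p.
Proof. by move=> ip; rewrite /vector_in to_chartE// (ch_chartK HA). Qed.

Lemma bivector_inE i X p : chart_dom i p ->
  bivector_in (A:=A) i X (chart i p) =
  (Jloc (chart_at A p) i id p)^T *m X p *m Jloc (chart_at A p) i id p.
Proof. by move=> ip; rewrite /bivector_in to_chartE// (ch_chartK HA). Qed.

Lemma form_inE i X p : chart_dom i p ->
  form_in (A:=A) i X (chart i p) =
  Jloc i (chart_at A p) id p *m X p *m (Jloc i (chart_at A p) id p)^T.
Proof. by move=> ip; rewrite /form_in of_chartE// (ch_chartK HA). Qed.

End identity.

(** * Related vector fields *)

Section related_fields.
Context {R : realType} {m n : nat} {M N : topologicalType}.
Context {A : atlas R m M} {B : atlas R n N}.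
Hypotheses (HA : is_charted A) (HB : is_charted B).
Implicit Types (i : chart_index A) (j : chart_index B).

Definition smooth_field_at {k} {L : topologicalType} (D : atlas R k L)
    (X : L -> 'rV[R]_k) p :=
  forall i : chart_index D, chart_dom i p -> smooth_at (vector_in i X) (chart i p).

(** The hypothesis is written in charts selected by q and by f q. The chain rule absorbs the changes
    of basis and leaves a relation in the fixed charts i and j, to which the local calculus
    applies. *)
Lemma derive_locmap_related i j (f : M -> N) X Y p :
  (forall q, smooth_map_at A B f q) -> chart_dom i p -> chart_dom j (f p) ->
  (forall q, X q *m tangent_map A B f q = Y (f q)) ->
  \forall u \near chart i p,
    'D_(vector_in (A:=A) i X u) (locmap i j f) u = vector_in (A:=B) j Y (locmap i j f u).
Proof.
move=> sf ip jp XY.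
have N2 : \forall q \near p, chart_dom i q /\ chart_dom j (f q).
  have N1 := near_chart_dom HA ip.
  have := (sf p).1 _ (near_chart_dom HB jp).
  by move: N1; apply: filterS2.
have := near_chart_inv HA ip N2; apply: filterS2 (near_chart_img HA ip) => u [q iq <-].
rewrite (ch_chartK HA)// => -[_ jq].
have sq := sf q.
have aq := ch_dom_at HA q; have bq := ch_dom_at HB (f q).
rewrite deriveEjacobian; last exact: smooth_at_differentiable (sq.2 _ _ iq jq).
rewrite vector_inE// {2}/locmap /= (ch_chartK HA)// vector_inE// -XY -!mulmxA.
congr (_ *m _); rewrite -[LHS](Jloc_comp HA HA (smooth_map_at_id HA q) sq)// tangent_mapE.
by rewrite -(Jloc_comp HA HB sq (smooth_map_at_id HB (f q))).
Qed.

(** The source of all the bracket formulas below: it is applied to left translations, inversion, the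
    product of G and the orbit maps. *)
Lemma related_vector_bracket (f : M -> N) X1 X2 Y1 Y2 p :
  (forall q, smooth_map_at A B f q) ->
  smooth_field_at A X1 p -> smooth_field_at A X2 p ->
  smooth_field_at B Y1 (f p) -> smooth_field_at B Y2 (f p) ->
  (forall q, X1 q *m tangent_map A B f q = Y1 (f q)) ->
  (forall q, X2 q *m tangent_map A B f q = Y2 (f q)) ->
  vector_bracket B Y1 Y2 (f p) = vector_bracket A X1 X2 p *m tangent_map A B f p.
Proof.
move=> sf sX1 sX2 sY1 sY2 r1 r2.
have ap := ch_dom_at HA p; have bp := ch_dom_at HB (f p).
have sp := (sf p).2 _ _ ap bp.
rewrite tangent_mapE -[RHS]deriveEjacobian; last exact: smooth_at_differentiable.
have e : locmap (chart_at A p) (chart_at B (f p)) f (chart (chart_at A p) p) =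
  chart (chart_at B (f p)) (f p) by rewrite /locmap /= (ch_chartK HA).
rewrite -[LHS]/(local_bracket _ _ _) -e.
by apply: related_local_bracket; rewrite ?e; [|exact: sX1|exact: sX2|
  exact: sY1|exact: sY2|exact: derive_locmap_related|exact: derive_locmap_related].
Qed.

End related_fields.

Section row_mx_calculus.
Context {R : realType} {E : normedModType R}.

Lemma derive_row_mx m n1 n2 (f : E -> 'M[R]_(m, n1)) (g : E -> 'M[R]_(m, n2)) x v :
  smooth_at f x -> smooth_at g x ->
  'D_v (fun y => row_mx (f y) (g y)) x = row_mx ('D_v f x) ('D_v g x).
Proof.
move=> sf sg; apply/matrixP => i j; rewrite derive_mxE; last first.
  exact/smooth_at_derivable/smooth_at_row_mx.
case: (split_ordP j) => k ->.
  rewrite row_mxEl derive_mxE; last exact: smooth_at_derivable.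
  by apply: near_eq_derive; apply: nearW => y; rewrite row_mxEl.
rewrite row_mxEr derive_mxE; last exact: smooth_at_derivable.
by apply: near_eq_derive; apply: nearW => y; rewrite row_mxEr.
Qed.

End row_mx_calculus.

Section row_mx_jacobian.
Context {R : realType}.

Lemma jacobian_row_mx l n1 n2 (f : 'rV[R]_l -> 'rV[R]_n1) (g : 'rV[R]_l -> 'rV[R]_n2)
    (x : 'rV[R]_l) : smooth_at f x -> smooth_at g x ->
  'J (fun y => row_mx (f y) (g y)) x = row_mx ('J f x) ('J g x).
Proof.
move=> sf sg; apply/row_matrixP => i; rewrite row_row_mx.
have df := smooth_at_differentiable sf; have dg := smooth_at_differentiable sg.
have dfg := smooth_at_differentiable (smooth_at_row_mx sf sg).
rewrite (row_jacobian i dfg) (derive_row_mx _ sf sg).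
by congr (row_mx _ _); rewrite row_jacobian.
Qed.

Lemma jacobian_cst l n (c : 'rV[R]_n) (x : 'rV[R]_l) : 'J (fun=> c) x = 0.
Proof.
apply/row_matrixP => i; rewrite row_jacobian; last exact: differentiable_cst.
by rewrite derive_cst row0.
Qed.

End row_mx_jacobian.

Lemma continuous_pair {T U V : topologicalType} (f : T -> U) (g : T -> V) (x : T) :
  {for x, continuous f} -> {for x, continuous g} ->
  {for x, continuous (fun y => (f y, g y))}.
Proof. exact: cvg_pair. Qed.

Lemma continuous_near {T U : topologicalType} (f : T -> U) (x : T) (y : U) (P : U -> Prop) :
  {for x, continuous f} -> f x = y -> (\forall z \near y, P z) -> \forall z \near x, P (f z).
Proof. by move=> fc <-; apply: fc. Qed.

(** * Product atlases and partial tangent maps *)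

Section product.
Context {R : realType} {m n : nat} {M N : topologicalType}.
Context {A : atlas R m M} {B : atlas R n N}.
Hypotheses (HA : is_charted A) (HB : is_charted B).

Lemma prod_chart_imgE (i : chart_index (prod_atlas A B)) u :
  chart_img i u <-> chart_img (A:=A) i.1 (lsubmx u) /\ chart_img (A:=B) i.2 (rsubmx u).
Proof.
split=> [[[p q] [/= ip iq] <-]|[[p ip e1] [q iq e2]]].
  by rewrite row_mxKl row_mxKr; split; [exists p|exists q].
by exists (p, q) => //=; rewrite e1 e2 hsubmxK.
Qed.

Lemma prod_charted : is_charted (prod_atlas A B).
Proof.
split=> /=.
- by move=> p; split; [exact: (ch_dom_at HA)|exact: (ch_dom_at HB)].
- move=> i; rewrite (_ : _ `*` _ = (fst @^-1` chart_dom i.1) `&` (snd @^-1` chart_dom i.2))//.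
  apply: openI; apply: open_comp.
  + by move=> ? _; exact: cvg_fst.
  + exact: (ch_dom_open HA).
  + by move=> ? _; exact: cvg_snd.
  + exact: (ch_dom_open HB).
- move=> i.
  have -> : chart_img (A:=prod_atlas A B) i = (lsubmx @^-1` chart_img (A:=A) i.1) `&`
      (rsubmx @^-1` chart_img (A:=B) i.2) :> set 'rV[R]_(m + n).
    by apply/seteqP; split=> u /= /(prod_chart_imgE (i : chart_index (prod_atlas A B))).
  apply: openI; apply: open_comp.
  + by move=> u _; exact: continuous_lsubmx.
  + exact: (ch_img_open HA).
  + by move=> u _; exact: continuous_rsubmx.
  + exact: (ch_img_open HB).
- move=> i [p q] /= [ip iq].
  by rewrite row_mxKl row_mxKr (ch_chartK HA)// (ch_chartK HB).
- move=> i [p q] [/= ip iq]; apply/continuous_mxP => r c.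
  have c1 : {for (p, q), continuous (chart i.1 \o fst)}.
    by apply: continuous_comp; [exact: cvg_fst|exact: (ch_cts HA)].
  have c2 : {for (p, q), continuous (chart i.2 \o snd)}.
    by apply: continuous_comp; [exact: cvg_snd|exact: (ch_cts HB)].
  case: (split_ordP c) => k ->.
    move: c1 => /continuous_mxP/(_ r k); rewrite /prop_for /continuous_at /=.
    rewrite (_ : (fun y : M * N => row_mx _ _ r (lshift n k)) = (fun y => chart i.1 y.1 r k)).
      by rewrite row_mxEl.
    by apply/funext => y; rewrite row_mxEl.
  move: c2 => /continuous_mxP/(_ r k); rewrite /prop_for /continuous_at /=.
  rewrite (_ : (fun y : M * N => row_mx _ _ r (rshift m k)) = (fun y => chart i.2 y.2 r k)).
    by rewrite row_mxEr.
  by apply/funext => y; rewrite row_mxEr.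
- move=> i u /(prod_chart_imgE (i : chart_index (prod_atlas A B)))[u1 u2].
  have c1 : {for u, continuous (chart_inv i.1 \o (lsubmx : 'rV[R]_(m + n) -> 'rV[R]_m))}.
    by apply: continuous_comp; [exact: continuous_lsubmx|exact: (ch_inv_cts HA)].
  have c2 : {for u, continuous (chart_inv i.2 \o (rsubmx : 'rV[R]_(m + n) -> 'rV[R]_n))}.
    by apply: continuous_comp; [exact: continuous_rsubmx|exact: (ch_inv_cts HB)].
  exact: continuous_pair c1 c2.
- move=> i j [p q] /= [ip iq] [jp jq]; apply: smooth_at_row_mx.
  + apply: (@smooth_at_comp _ _ _ _ _ (chart j.1 \o chart_inv i.1)).
      by rewrite row_mxKl; exact: (ch_transition HA).
    exact/smooth_at_lsubmx/smooth_at_id.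
  + apply: (@smooth_at_comp _ _ _ _ _ (chart j.2 \o chart_inv i.2)).
      by rewrite row_mxKr; exact: (ch_transition HB).
    exact/smooth_at_rsubmx/smooth_at_id.
Qed.

Lemma smooth_map_at_fst x : smooth_map_at (prod_atlas A B) A fst x.
Proof.
split; first exact: cvg_fst.
move=> i j [i1 i2] j1.
apply: (@smooth_at_comp _ _ _ _ _ (chart j \o chart_inv i.1)).
  by rewrite row_mxKl; exact: (ch_transition HA).
exact/smooth_at_lsubmx/smooth_at_id.
Qed.

Lemma smooth_map_at_snd x : smooth_map_at (prod_atlas A B) B snd x.
Proof.
split; first exact: cvg_snd.
move=> i j [i1 i2] j1.
apply: (@smooth_at_comp _ _ _ _ _ (chart j \o chart_inv i.2)).
  by rewrite row_mxKr; exact: (ch_transition HB).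
exact/smooth_at_rsubmx/smooth_at_id.
Qed.

End product.

Section pairing_maps.
Context {R : realType} {l m n : nat} {L M N : topologicalType}.
Context {D : atlas R l L} {A : atlas R m M} {B : atlas R n N}.
Hypotheses (HD : is_charted D) (HA : is_charted A) (HB : is_charted B).
Implicit Types (f : L -> M) (g : L -> N).

Lemma smooth_map_at_cst (q : M) p : smooth_map_at D A (fun=> q) p.
Proof. by split=> [|i j ip jp]; [exact: cst_continuous|exact: smooth_at_cst]. Qed.

Lemma Jloc_cst (i : chart_index D) (j : chart_index A) (q : M) p :
  Jloc i j (fun=> q) p = 0.
Proof. exact: jacobian_cst. Qed.

Lemma smooth_map_at_pair f g p : smooth_map_at D A f p -> smooth_map_at D B g p ->
  smooth_map_at D (prod_atlas A B) (fun x => (f x, g x)) p.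
Proof.
move=> [fc sf] [gc sg]; split; first exact: cvg_pair.
move=> i j ip [j1 j2]; apply: smooth_at_row_mx; [exact: sf|exact: sg].
Qed.

Lemma Jloc_pair (i : chart_index D) (j : chart_index (prod_atlas A B)) f g p :
  smooth_map_at D A f p -> smooth_map_at D B g p ->
  chart_dom i p -> chart_dom j.1 (f p) -> chart_dom j.2 (g p) ->
  Jloc i j (fun x => (f x, g x)) p = row_mx (Jloc i j.1 f p) (Jloc i j.2 g p).
Proof.
move=> [fc sf] [gc sg] ip j1 j2.
by apply: jacobian_row_mx; [exact: (sf i j.1)|exact: (sg i j.2)].
Qed.

Lemma tangent_map_pair f g p :
  smooth_map_at D A f p -> smooth_map_at D B g p ->
  tangent_map D (prod_atlas A B) (fun x => (f x, g x)) p =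
  row_mx (tangent_map D A f p) (tangent_map D B g p).
Proof.
by move=> sf sg; rewrite tangent_mapE Jloc_pair//; [exact: (ch_dom_at HD)|
  exact: (ch_dom_at HA)|exact: (ch_dom_at HB)].
Qed.

Lemma tangent_map_cst (q : M) p : tangent_map D A (fun=> q) p = 0.
Proof. exact: Jloc_cst. Qed.

End pairing_maps.

Section partial_tangent.
Context {R : realType} {m n l : nat} {M N P : topologicalType}.
Context {A : atlas R m M} {B : atlas R n N} {C : atlas R l P}.
Hypotheses (HA : is_charted A) (HB : is_charted B) (HC : is_charted C).
Variables (f : M * N -> P) (p : M) (q : N).
Hypothesis sf : smooth_map_at (prod_atlas A B) C f (p, q).

Lemma smooth_map_at_partial1 : smooth_map_at A C (fun x => f (x, q)) p.
Proof.
have s1 : smooth_map_at A (prod_atlas A B) (fun x => (x, q)) p.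
  by apply: smooth_map_at_pair; [exact: smooth_map_at_id|exact: smooth_map_at_cst].
exact: (smooth_map_at_comp HA (prod_charted HA HB) s1 sf).
Qed.

Lemma smooth_map_at_partial2 : smooth_map_at B C (fun y => f (p, y)) q.
Proof.
have s1 : smooth_map_at B (prod_atlas A B) (fun y => (p, y)) q.
  by apply: smooth_map_at_pair; [exact: smooth_map_at_cst|exact: smooth_map_at_id].
exact: (smooth_map_at_comp HB (prod_charted HA HB) s1 sf).
Qed.

Lemma tangent_map_partial1 : tangent_map A C (fun x => f (x, q)) p =
  row_mx 1%:M 0 *m tangent_map (prod_atlas A B) C f (p, q).
Proof.
have s1 : smooth_map_at A (prod_atlas A B) (fun x => (x, q)) p.
  by apply: smooth_map_at_pair; [exact: smooth_map_at_id|exact: smooth_map_at_cst].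
rewrite -[LHS]/(tangent_map A C (f \o (fun x => (x, q))) p).
rewrite (tangent_map_comp HA (prod_charted HA HB) HC s1 sf).
congr (_ *m _); rewrite tangent_map_pair ?tangent_map_id ?tangent_map_cst//.
  exact: smooth_map_at_id.
exact: smooth_map_at_cst.
Qed.

Lemma tangent_map_partial2 : tangent_map B C (fun y => f (p, y)) q =
  row_mx 0 1%:M *m tangent_map (prod_atlas A B) C f (p, q).
Proof.
have s1 : smooth_map_at B (prod_atlas A B) (fun y => (p, y)) q.
  by apply: smooth_map_at_pair; [exact: smooth_map_at_cst|exact: smooth_map_at_id].
rewrite -[LHS]/(tangent_map B C (f \o (fun y => (p, y))) q).
rewrite (tangent_map_comp HB (prod_charted HA HB) HC s1 sf).
congr (_ *m _); rewrite tangent_map_pair ?tangent_map_id ?tangent_map_cst//.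
  exact: smooth_map_at_cst.
exact: smooth_map_at_id.
Qed.

Lemma tangent_map_prod : tangent_map (prod_atlas A B) C f (p, q) =
  col_mx (tangent_map A C (fun x => f (x, q)) p) (tangent_map B C (fun y => f (p, y)) q).
Proof.
rewrite tangent_map_partial1 tangent_map_partial2 -mul_col_mx -[LHS]mul1mx.
by congr (_ *m _); rewrite -/(block_mx 1%:M 0 0 1%:M) -scalar_mx_block.
Qed.

End partial_tangent.

(** * Vector fields generated by a smooth map *)

Section generated_field.
Context {R : realType} {m n : nat} {G M : topologicalType}.
Context {A : atlas R m G} {B : atlas R n M}.
Hypotheses (HA : is_charted A) (HB : is_charted B).
Variables (e : G) (phi : G * M -> M).
Hypothesis phie : forall p, phi (e, p) = p.
Hypothesis sphi : forall x, smooth_map_at (prod_atlas A B) B phi x.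

(** Treats three cases at once: right-invariant fields ([phi] the product of G), left-invariant
    fields (the opposite product) and fundamental fields (the action). *)
Definition generated_field (X : 'rV[R]_m) (p : M) : 'rV[R]_n :=
  X *m tangent_map A B (fun h => phi (h, p)) e.

Lemma vector_in_generated (i : chart_index B) X p : chart_dom i p ->
  vector_in i (generated_field X) (chart i p) =
  row_mx X 0 *m 'J (locmap (A:=prod_atlas A B) (chart_at A e, i) i phi)
    (row_mx (chart (chart_at A e) e) (chart i p)).
Proof.
move=> ip; have ae := ch_dom_at HA e; have sp := smooth_map_at_partial1 HA HB (sphi (e, p)).
rewrite vector_inE// /generated_field tangent_mapE -mulmxA phie.
have -> : Jloc (chart_at A e) (chart_at B p) (fun h => phi (h, p)) e *m
    Jloc (A:=B) (B:=B) (chart_at B p) i id p =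
    Jloc (A:=A) (B:=B) (chart_at A e) i (fun h => phi (h, p)) e.
  have := Jloc_comp (i:=chart_at A e) (j:=chart_at B p) (k:=i) HA HB sp
    (smooth_map_at_id HB (phi (e, p))).
  rewrite phie => /(_ ae (ch_dom_at HB p) ip) => H.
  by rewrite -[RHS]/(Jloc _ _ (id \o _) _) H.
have s1 : smooth_map_at A (prod_atlas A B) (fun x => (x, p)) e.
  by apply: smooth_map_at_pair; [exact: smooth_map_at_id|exact: smooth_map_at_cst].
rewrite -[in LHS]/(Jloc _ _ (phi \o (fun h => (h, p))) e).
rewrite (Jloc_comp (j := (chart_at A e, i)) HA (prod_charted HA HB) s1 (sphi (e, p)))//; last first.
  by rewrite /= phie.
rewrite mulmxA; congr (_ *m _).
rewrite (Jloc_pair (smooth_map_at_id HA e) (smooth_map_at_cst p e))//=.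
by rewrite Jloc_id// Jloc_cst mul_mx_row mulmx1 mulmx0.
Qed.

(** In a fixed chart the field is a block of the Jacobian of [phi] along the slice through e, hence
    smooth, although its definition uses charts that change with the point. *)
Lemma smooth_field_generated X p : smooth_field_at B (generated_field X) p.
Proof.
move=> i ip; pose c := chart (chart_at A e) e.
pose F := locmap (A:=prod_atlas A B) (chart_at A e, i) i phi.
apply: (@smooth_at_near _ _ _ (fun u => row_mx X 0 *m 'J F (row_mx c u))).
  apply: filterS (near_chart_img HB ip) => u [q iq <-].
  by rewrite vector_in_generated.
apply: smooth_at_mulmx; first exact: smooth_at_cst.
apply: (@smooth_at_comp _ _ _ _ _ (fun v => 'J F v)).
  apply: smooth_at_jacobian.
  have := (sphi (e, p)).2 (chart_at A e, i) i; apply; last by rewrite phie.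
  by split => //=; exact: ch_dom_at.
by apply: smooth_at_row_mx; [exact: smooth_at_cst|exact: smooth_at_id].
Qed.

End generated_field.

Lemma near_all {T : topologicalType} (P : T -> Prop) (x : T) :
  (forall y, P y) -> (\forall y \near x, P y).
Proof. exact: nearW. Qed.

Lemma lin_comb_sub {R : pzRingType} {V : lmodType R} (a : R) (p q r s : V) :
  a *: p + q - (a *: r + s) = a *: (p - r) + (q - s).
Proof. by rewrite scalerBr opprD addrACA. Qed.

Section vector_brackets.
Context {R : realType} {n : nat} {M : topologicalType} {A : atlas R n M}.
Hypothesis HA : is_charted A.
Implicit Types (X Y Z : M -> 'rV[R]_n).

Lemma vector_bracketC X Y p : vector_bracket A Y X p = - vector_bracket A X Y p.
Proof. by rewrite /vector_bracket opprB. Qed.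

Lemma vector_bracket_linearl X Y Z (a : R) p :
  smooth_field_at A X p -> smooth_field_at A Y p -> smooth_field_at A Z p ->
  vector_bracket A (fun q => a *: X q + Y q) Z p =
  a *: vector_bracket A X Z p + vector_bracket A Y Z p.
Proof.
move=> sX sY sZ; have ap := ch_dom_at HA p; rewrite /vector_bracket /=.
set u := chart _ p.
have dX := @smooth_at_derivable _ _ _ _ _ (vector_in (chart_at A p) Z u) (sX _ ap).
have dY := @smooth_at_derivable _ _ _ _ _ (vector_in (chart_at A p) Z u) (sY _ ap).
have dZ := smooth_at_differentiable (sZ _ ap).
have E : vector_in (chart_at A p) (fun q => a *: X q + Y q) =
   a \*: vector_in (chart_at A p) X + vector_in (chart_at A p) Y.
  by apply/funext => v; rewrite /vector_in mulmxDl -scalemxAl.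
have Eu : vector_in (chart_at A p) (fun q => a *: X q + Y q) u =
  a *: vector_in (chart_at A p) X u + vector_in (chart_at A p) Y u by rewrite E.
have D2 : 'D_(vector_in (chart_at A p) (fun q => a *: X q + Y q) u) (vector_in (chart_at A p) Z) u =
    a *: 'D_(vector_in (chart_at A p) X u) (vector_in (chart_at A p) Z) u +
    'D_(vector_in (chart_at A p) Y u) (vector_in (chart_at A p) Z) u.
  by rewrite Eu (derive_adddir _ _ dZ) (derive_scaledir _ _ dZ).
have D1 : 'D_(vector_in (chart_at A p) Z u) (vector_in (chart_at A p) (fun q => a *: X q + Y q)) u =
    a *: 'D_(vector_in (chart_at A p) Z u) (vector_in (chart_at A p) X) u +
    'D_(vector_in (chart_at A p) Z u) (vector_in (chart_at A p) Y) u.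
  by rewrite E (deriveD (derivableZ dX) dY) (deriveZ a dX).
exact: etrans (congr2 (fun p q => p - q) D2 D1) (lin_comb_sub _ _ _ _ _).
Qed.

End vector_brackets.

Section product_fields.
Context {R : realType} {m n : nat} {M N : topologicalType}.
Context {A : atlas R m M} {B : atlas R n N}.
Hypotheses (HA : is_charted A) (HB : is_charted B).
Implicit Types (X : M -> 'rV[R]_m) (Y : N -> 'rV[R]_n).

Lemma jacobian_lsubmx (u : 'rV[R]_(m + n)) :
  'J (lsubmx : 'rV[R]_(m + n) -> 'rV[R]_m) u = col_mx 1%:M 0.
Proof.
have sl : smooth_at (lsubmx : 'rV[R]_(m + n) -> 'rV[R]_m) u.
  exact/smooth_at_lsubmx/smooth_at_id.
apply/row_matrixP => i; rewrite (row_jacobian i (smooth_at_differentiable sl)) rowE.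
rewrite -[RHS](_ : lsubmx (delta_mx 0 i : 'rV[R]_(m + n)) = _); last first.
  by rewrite -[in LHS](hsubmxK (delta_mx 0 i)) -[X in X *m _](hsubmxK (delta_mx 0 i))
    row_mxKl mul_row_col mulmx1 mulmx0 addr0.
apply/rowP => j; rewrite derive_mxE; last exact: smooth_at_derivable.
rewrite [RHS]mxE -(derive_coord 0 (lshift n j) u (delta_mx 0 i)).
by apply: near_eq_derive; apply: near_all => v; rewrite mxE.
Qed.

Lemma jacobian_rsubmx (u : 'rV[R]_(m + n)) :
  'J (rsubmx : 'rV[R]_(m + n) -> 'rV[R]_n) u = col_mx 0 1%:M.
Proof.
have sl : smooth_at (rsubmx : 'rV[R]_(m + n) -> 'rV[R]_n) u.
  exact/smooth_at_rsubmx/smooth_at_id.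
apply/row_matrixP => i; rewrite (row_jacobian i (smooth_at_differentiable sl)) rowE.
rewrite -[RHS](_ : rsubmx (delta_mx 0 i : 'rV[R]_(m + n)) = _); last first.
  by rewrite -[in LHS](hsubmxK (delta_mx 0 i)) -[X in X *m _](hsubmxK (delta_mx 0 i))
    row_mxKr mul_row_col mulmx1 mulmx0 add0r.
apply/rowP => j; rewrite derive_mxE; last exact: smooth_at_derivable.
rewrite [RHS]mxE -(derive_coord 0 (rshift m j) u (delta_mx 0 i)).
by apply: near_eq_derive; apply: near_all => v; rewrite mxE.
Qed.

Lemma vector_in_prod (i : chart_index (prod_atlas A B)) X Y p q :
  chart_dom i.1 p -> chart_dom i.2 q ->
  vector_in i (fun x => row_mx (X x.1) (Y x.2)) (chart i (p, q)) =
  row_mx (vector_in i.1 X (chart i.1 p)) (vector_in i.2 Y (chart i.2 q)).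
Proof.
move=> ip iq; have HP := prod_charted HA HB.
have ap := ch_dom_at HA p; have bq := ch_dom_at HB q.
rewrite (vector_inE HP) ?(vector_inE HA)// ?(vector_inE HB)//=.
rewrite -[Jloc _ _ _ _]/(Jloc (chart_at (prod_atlas A B) (p, q)) i (fun x => (x.1, x.2)) (p, q)).
have -> : (fun x : M * N => (x.1, x.2)) = (fun x => (fst x, snd x)) by [].
rewrite (Jloc_pair (smooth_map_at_fst HA (p, q)) (smooth_map_at_snd HB (p, q)))//=.
have t1 := smooth_at_differentiable (ch_transition HA ap ip).
have t2 := smooth_at_differentiable (ch_transition HB bq iq).
have sl u : differentiable (lsubmx : 'rV[R]_(m + n) -> 'rV[R]_m) u.
  exact/smooth_at_differentiable/smooth_at_lsubmx/smooth_at_id.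
have sr u : differentiable (rsubmx : 'rV[R]_(m + n) -> 'rV[R]_n) u.
  exact/smooth_at_differentiable/smooth_at_rsubmx/smooth_at_id.
have -> : Jloc (A:=prod_atlas A B) (B:=A) (chart_at A p, chart_at B q) i.1 fst (p, q) =
    col_mx (Jloc (chart_at A p) i.1 id p) 0.
  rewrite /Jloc -[LHS]/('J ((chart i.1 \o chart_inv (chart_at A p)) \o lsubmx) _).
  rewrite jacobian_comp//= ?row_mxKl// jacobian_lsubmx mul_col_mx mul1mx mul0mx; by [].
have -> : Jloc (A:=prod_atlas A B) (B:=B) (chart_at A p, chart_at B q) i.2 snd (p, q) =
    col_mx 0 (Jloc (chart_at B q) i.2 id q).
  rewrite /Jloc -[LHS]/('J ((chart i.2 \o chart_inv (chart_at B q)) \o rsubmx) _).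
  rewrite jacobian_comp//= ?row_mxKr// jacobian_rsubmx mul_col_mx mul1mx mul0mx; by [].
by rewrite mul_mx_row !mul_row_col !mulmx0 addr0 add0r.
Qed.

Lemma near_vector_in_prod (i : chart_index (prod_atlas A B)) X Y x : chart_dom i x ->
  \forall u \near chart i x, vector_in i (fun x => row_mx (X x.1) (Y x.2)) u =
  row_mx (vector_in i.1 X (lsubmx u)) (vector_in i.2 Y (rsubmx u)).
Proof.
move=> ix; have HP := prod_charted HA HB.
apply: filterS (near_chart_img HP ix) => u [[p q] [/= ip iq] <-].
rewrite row_mxKl row_mxKr; exact: vector_in_prod.
Qed.

Lemma smooth_field_prod X Y x :
  smooth_field_at A X x.1 -> smooth_field_at B Y x.2 ->
  smooth_field_at (prod_atlas A B) (fun x => row_mx (X x.1) (Y x.2)) x.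
Proof.
move=> sX sY i ix; have [i1 i2] := ix.
apply: smooth_at_near.
  by have := near_vector_in_prod X Y ix; apply: filterS => u /esym; apply.
apply: smooth_at_row_mx.
  apply: (@smooth_at_comp _ _ _ _ _ (vector_in i.1 X)).
    by rewrite row_mxKl; exact: sX.
  exact/smooth_at_lsubmx/smooth_at_id.
apply: (@smooth_at_comp _ _ _ _ _ (vector_in i.2 Y)).
  by rewrite row_mxKr; exact: sY.
exact/smooth_at_rsubmx/smooth_at_id.
Qed.

Lemma derive_rsubmx_comp {k} (F : 'rV[R]_n -> 'rV[R]_k) (a : 'rV[R]_m) (u : 'rV[R]_(m + n)) :
  smooth_at F (rsubmx u) -> 'D_(row_mx a 0) (fun v => F (rsubmx v)) u = 0.
Proof.
move=> sF.
have sr : differentiable (rsubmx : 'rV[R]_(m + n) -> 'rV[R]_n) u.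
  exact/smooth_at_differentiable/smooth_at_rsubmx/smooth_at_id.
rewrite (derive_comp _ sr (smooth_at_differentiable sF)).
by rewrite (deriveEjacobian _ sr) jacobian_rsubmx mul_row_col mulmx0 mul0mx addr0 derive0.
Qed.

Lemma derive_lsubmx_comp {k} (F : 'rV[R]_m -> 'rV[R]_k) (a : 'rV[R]_n) (u : 'rV[R]_(m + n)) :
  smooth_at F (lsubmx u) -> 'D_(row_mx 0 a) (fun v => F (lsubmx v)) u = 0.
Proof.
move=> sF.
have sr : differentiable (lsubmx : 'rV[R]_(m + n) -> 'rV[R]_m) u.
  exact/smooth_at_differentiable/smooth_at_lsubmx/smooth_at_id.
rewrite (derive_comp _ sr (smooth_at_differentiable sF)).
by rewrite (deriveEjacobian _ sr) jacobian_lsubmx mul_row_col mulmx0 mul0mx addr0 derive0.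
Qed.

(** In a product chart the components of each field depend only on the coordinates along which the
    other field vanishes. *)
Lemma vector_bracket_prod0 X Y x :
  smooth_field_at A X x.1 -> smooth_field_at B Y x.2 ->
  vector_bracket (prod_atlas A B) (fun x => row_mx (X x.1) 0)
    (fun x => row_mx 0 (Y x.2)) x = 0.
Proof.
move=> sX sY; have HP := prod_charted HA HB; have ax := ch_dom_at HP x.
have [a1 a2] := ax.
have V0 k (P : topologicalType) (C : atlas R k P) j u : vector_in (A:=C) j (fun=> 0) u = 0.
  by rewrite /vector_in mul0mx.
have E1 := near_vector_in_prod X (fun=> 0) ax.
have E2 := near_vector_in_prod (fun=> 0) Y ax.
rewrite /vector_bracket (nbhs_singleton E1) (nbhs_singleton E2).
rewrite (near_eq_derive _ E1) (near_eq_derive _ E2) !V0.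
have sl : smooth_at (fun v => vector_in (A:=A) (chart_at A x.1) X (lsubmx v))
    (row_mx (chart (chart_at A x.1) x.1) (chart (chart_at B x.2) x.2)).
  apply: (@smooth_at_comp _ _ _ _ _ (vector_in _ X)).
    by rewrite row_mxKl; exact: sX.
  exact/smooth_at_lsubmx/smooth_at_id.
have sr : smooth_at (fun v => vector_in (A:=B) (chart_at B x.2) Y (rsubmx v))
    (row_mx (chart (chart_at A x.1) x.1) (chart (chart_at B x.2) x.2)).
  apply: (@smooth_at_comp _ _ _ _ _ (vector_in _ Y)).
    by rewrite row_mxKr; exact: sY.
  exact/smooth_at_rsubmx/smooth_at_id.
have F0 k (P : topologicalType) (C : atlas R k P) j (f : 'rV[R]_(m + n) -> 'rV[R]_k) :
    (fun u => vector_in (A:=C) j (fun=> 0) (f u)) = fun=> 0.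
  by apply/funext => u; rewrite V0.
rewrite !derive_row_mx ?F0 ?derive_cst//; try exact: smooth_at_cst.
rewrite derive_rsubmx_comp ?row_mxKr; last exact: sY.
rewrite derive_lsubmx_comp ?row_mxKl; last exact: sX.
by rewrite subrr.
Qed.

End product_fields.

Opaque vector_bracket tangent_map.

(** * Invariant vector fields on a Lie group *)

Section skew_bracket.
Context {R : pzRingType} {V : lmodType R} (b : V -> V -> V).
Hypothesis bC : forall X Y, b Y X = - b X Y.
Hypothesis bl : forall a X Y Z, b (a *: X + Y) Z = a *: b X Z + b Y Z.

Lemma skew_0l X : b 0 X = 0.
Proof.
have := bl 1 0 0 X; rewrite !scale1r addr0 => /eqP.
by rewrite -subr_eq0 opprD addrA subrr sub0r oppr_eq0 => /eqP.
Qed.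

Lemma skew_Nl X Y : b (- X) Y = - b X Y.
Proof. by have := bl (-1) X 0 Y; rewrite !scaleN1r !addr0 skew_0l addr0. Qed.

Lemma skew_Nr X Y : b X (- Y) = - b X Y.
Proof. by rewrite bC skew_Nl -bC. Qed.

(** Inversion relates X^L to (-X)^R, so the bracket of right-invariant fields is first obtained with
    both arguments negated; bilinearity removes the signs. *)
Lemma skew_opp_related (r : V -> V -> V) X Y :
  (forall X Y, r (- X) (- Y) = - b X Y) -> r X Y = - b X Y.
Proof.
by move=> rb; rewrite -{1}[X]opprK -{1}[Y]opprK rb skew_Nl skew_Nr opprK.
Qed.

End skew_bracket.

Section lie_group.
Context {R : realType} {m : nat} {G : topGroupType} {AG : atlas R m G}.
Hypothesis HL : is_lie_group AG.

Let HG : is_charted AG := manifold_charted (lie_group_manifold HL).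

Lemma smooth_mul x :
  smooth_map_at (prod_atlas AG AG) AG (fun x => (x.1 * x.2)%g) x.
Proof. exact (smooth_map_at_of (prod_charted HG HG) HG x (lie_group_mul HL)). Qed.

Lemma smooth_inv g : smooth_map_at AG AG (fun g => (g^-1)%g) g.
Proof. exact (smooth_map_at_of HG HG g (lie_group_inv HL)). Qed.

Lemma smooth_mulr g h : smooth_map_at AG AG (fun k => (k * g)%g) h.
Proof. exact (smooth_map_at_partial1 HG HG (smooth_mul (h, g))). Qed.

Lemma smooth_mull g h : smooth_map_at AG AG (fun k => (g * k)%g) h.
Proof. exact (smooth_map_at_partial2 HG HG (smooth_mul (g, h))). Qed.

Lemma smooth_opmul x :
  smooth_map_at (prod_atlas AG AG) AG (fun x => (x.2 * x.1)%g) x.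
Proof.
have s1 : smooth_map_at (prod_atlas AG AG) (prod_atlas AG AG) (fun y => (y.2, y.1)) x.
  apply: smooth_map_at_pair; [exact: smooth_map_at_snd|exact: smooth_map_at_fst].
exact: (smooth_map_at_comp (prod_charted HG HG) (prod_charted HG HG) s1 (smooth_mul _)).
Qed.

Lemma smooth_conj g h : smooth_map_at AG AG (fun k => (g * k * g^-1)%g) h.
Proof. exact: (smooth_map_at_comp HG HG (smooth_mull g h) (smooth_mulr _ _)). Qed.

Definition right_field (X : 'rV[R]_m) (g : G) : 'rV[R]_m :=
  X *m tangent_map AG AG (fun h => (h * g)%g) 1%g.

Lemma smooth_left_field X g : smooth_field_at AG (left_field AG X) g.
Proof.
exact: (smooth_field_generated HG HG (e := 1%g) (phi := fun x => (x.2 * x.1)%g)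
  (@mulg1 G) smooth_opmul).
Qed.

Lemma smooth_right_field X g : smooth_field_at AG (right_field X) g.
Proof.
exact: (smooth_field_generated HG HG (e := 1%g) (phi := fun x => (x.1 * x.2)%g)
  (@mul1g G) smooth_mul).
Qed.

Arguments smooth_left_field X g : clear implicits.
Arguments smooth_right_field X g : clear implicits.

Lemma left_field1 X : left_field AG X 1%g = X.
Proof.
rewrite /left_field; have -> : (fun h : G => (1 * h)%g) = id.
  by apply/funext => h; rewrite mul1g.
by rewrite tangent_map_id// mulmx1.
Qed.

Lemma right_field1 X : right_field X 1%g = X.
Proof.
rewrite /right_field; have -> : (fun h : G => (h * 1)%g) = id.
  by apply/funext => h; rewrite mulg1.
by rewrite tangent_map_id// mulmx1.
Qed.

Lemma left_field_linear a X Y g :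
  left_field AG (a *: X + Y) g = a *: left_field AG X g + left_field AG Y g.
Proof. by rewrite /left_field mulmxDl -scalemxAl. Qed.

Lemma left_field_translate X h g :
  left_field AG X g *m tangent_map AG AG (fun k => (h * k)%g) g = left_field AG X (h * g)%g.
Proof.
rewrite /left_field -mulmxA; congr (_ *m _).
have := tangent_map_comp HG HG HG (smooth_mull g 1%g) (smooth_mull h _).
rewrite mulg1 => <-; congr (tangent_map _ _ _ _).
by apply/funext => k /=; rewrite mulgA.
Qed.

Lemma right_field_translate X h g :
  right_field X g *m tangent_map AG AG (fun k => (k * h)%g) g = right_field X (g * h)%g.
Proof.
rewrite /right_field -mulmxA; congr (_ *m _).
have := tangent_map_comp HG HG HG (smooth_mulr g 1%g) (smooth_mulr h _).
rewrite mul1g => <-; congr (tangent_map _ _ _ _).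
by apply/funext => k /=; rewrite mulgA.
Qed.

(** The map g -> g g^-1 is constant, and its tangent map at 1 is the identity plus that of
    inversion. *)
Lemma tangent_inv1 : tangent_map AG AG (fun g => (g^-1)%g) 1%g = - 1%:M.
Proof.
have sp : smooth_map_at AG (prod_atlas AG AG) (fun g => (g, g^-1)%g) 1%g.
  by apply: smooth_map_at_pair; [exact: smooth_map_at_id|exact: smooth_inv].
have := tangent_map_comp HG (prod_charted HG HG) HG sp (smooth_mul _).
have -> : (fun x : G * G => (x.1 * x.2)%g) \o (fun g => (g, g^-1)%g) = fun=> 1%g.
  by apply/funext => g /=; rewrite mulgV.
rewrite tangent_map_cst.
rewrite (tangent_map_pair HG HG HG (smooth_map_at_id HG _) (smooth_inv _)).
rewrite (tangent_map_prod HG HG HG (smooth_mul _)) tangent_map_id//= invg1.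
have -> : (fun h : G => (h * 1)%g) = id by apply/funext => h; rewrite mulg1.
have -> : (fun h : G => (1 * h)%g) = id by apply/funext => h; rewrite mul1g.
rewrite tangent_map_id// mul_row_col !mulmx1 => /esym/eqP.
by rewrite addrC addr_eq0 => /eqP.
Qed.

(** From (gk)^-1 = k^-1 g^-1; the sign is that of [tangent_inv1]. *)
Lemma left_right_inv X g :
  left_field AG X g *m tangent_map AG AG (fun g => (g^-1)%g) g = right_field (- X) (g^-1)%g.
Proof.
rewrite /left_field /right_field -mulmxA.
have := tangent_map_comp HG HG HG (smooth_mull g 1%g) (smooth_inv _).
rewrite mulg1 => <-.
have := tangent_map_comp HG HG HG (smooth_inv 1%g) (smooth_mulr (g^-1)%g _).
rewrite invg1 tangent_inv1 mulNmx mul1mx => H.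
rewrite mulNmx -mulmxN -H; congr (_ *m tangent_map _ _ _ _).
by apply/funext => k /=; rewrite invgM.
Qed.

Opaque left_field right_field.

(** Left translation by g relates a left-invariant field to itself, so the bracket at g is the
    translate of the bracket at 1. *)
Lemma bracket_left_field X Y g :
  vector_bracket AG (left_field AG X) (left_field AG Y) g =
  left_field AG (lie_bracket AG X Y) g.
Proof.
have := related_vector_bracket HG HG (p := 1%g) (smooth_mull g)
  (smooth_left_field X _) (smooth_left_field Y _) (smooth_left_field X _)
  (smooth_left_field Y _) (fun q => left_field_translate X g q)
  (fun q => left_field_translate Y g q).
by rewrite mulg1.
Qed.

Lemma lie_bracketC X Y : lie_bracket AG Y X = - lie_bracket AG X Y.
Proof. exact: vector_bracketC. Qed.

Lemma lie_bracket_linearl a X Y Z : lie_bracket AG (a *: X + Y) Z =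
  a *: lie_bracket AG X Z + lie_bracket AG Y Z.
Proof.
rewrite /lie_bracket -(vector_bracket_linearl HG a (smooth_left_field X _)
  (smooth_left_field Y _) (smooth_left_field Z _)).
have -> : left_field AG (a *: X + Y) = fun g => a *: left_field AG X g + left_field AG Y g.
  by apply/funext => g; exact: left_field_linear.
by [].
Qed.

(** Inversion relates left-invariant to right-invariant fields and is minus the identity at 1. *)
Lemma bracket_right_field1 X Y :
  vector_bracket AG (right_field X) (right_field Y) 1%g = - lie_bracket AG X Y.
Proof.
apply: (skew_opp_related lie_bracketC lie_bracket_linearl
  (r := fun X Y => vector_bracket AG (right_field X) (right_field Y) 1%g)) => {}X {}Y.
have := related_vector_bracket HG HG (p := 1%g) smooth_inv
  (smooth_left_field X _) (smooth_left_field Y _) (smooth_right_field _ _)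
  (smooth_right_field _ _) (fun q => left_right_inv X q)
  (fun q => left_right_inv Y q).
by rewrite invg1 tangent_inv1 mulmxN mulmx1.
Qed.

(* Both fields are related, under the product, to fields on different factors
   of G x G. *)
Lemma bracket_left_right X Y g :
  vector_bracket AG (left_field AG X) (right_field Y) g = 0.
Proof.
have HP := prod_charted HG HG.
pose V (x : G * G) : 'rV[R]_(m + m) := row_mx (right_field Y x.1) 0.
pose W (x : G * G) : 'rV[R]_(m + m) := row_mx 0 (left_field AG X x.2).
have s0 (p : G) : smooth_field_at AG (fun=> 0) p.
  move=> i ip; apply: (@smooth_at_near _ _ _ (fun=> 0)).
    by apply: near_all => u; rewrite /vector_in mul0mx.
  exact: smooth_at_cst.
have sV x : smooth_field_at (prod_atlas AG AG) V x.
  exact: (smooth_field_prod HG HG (smooth_right_field Y _) (s0 _)).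
have sW x : smooth_field_at (prod_atlas AG AG) W x.
  exact: (smooth_field_prod HG HG (s0 _) (smooth_left_field X _)).
have rV x : V x *m tangent_map (prod_atlas AG AG) AG (fun x => (x.1 * x.2)%g) x =
    right_field Y (x.1 * x.2)%g.
  case: x => h k; rewrite (tangent_map_prod HG HG HG (smooth_mul _)) /V mul_row_col.
  by rewrite mul0mx addr0 /= right_field_translate.
have rW x : W x *m tangent_map (prod_atlas AG AG) AG (fun x => (x.1 * x.2)%g) x =
    left_field AG X (x.1 * x.2)%g.
  case: x => h k; rewrite (tangent_map_prod HG HG HG (smooth_mul _)) /W mul_row_col.
  by rewrite mul0mx add0r /= left_field_translate.
have := related_vector_bracket HP HG (p := (1, g)%g) smooth_mul (sV _) (sW _)
  (smooth_right_field Y _) (smooth_left_field X _) rV rW.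
rewrite (vector_bracket_prod0 HG HG (smooth_right_field Y _) (smooth_left_field X _)).
rewrite mul0mx /= mul1g => H.
rewrite (vector_bracketC (right_field Y) (left_field AG X) g) H.
exact: oppr0.
Qed.

Transparent left_field right_field.

(** Differentiates (g h g^-1) g = g h at h = 1. *)
Lemma right_field_Ad g X : right_field (Ad AG g X) g = left_field AG X g.
Proof.
rewrite /right_field /left_field /Ad -mulmxA; congr (_ *m _).
have := tangent_map_comp HG HG HG (smooth_conj g 1%g) (smooth_mulr g _).
rewrite mulg1 mulgV => <-; congr (tangent_map _ _ _ _).
by apply/funext => h /=; rewrite mulgVK.
Qed.

Lemma Ad1 X : Ad AG 1%g X = X.
Proof. by rewrite -[RHS]left_field1 -right_field_Ad right_field1. Qed.

End lie_group.

Arguments right_field {R m G} AG X g.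
Arguments smooth_left_field {R m G AG} HL X g.
Arguments smooth_right_field {R m G AG} HL X g.

Lemma derive_mulmx {R : realType} {E : normedModType R} m n p (A : E -> 'M[R]_(m, n))
    (B : E -> 'M[R]_(n, p)) x v : smooth_at A x -> smooth_at B x ->
  'D_v (fun y => A y *m B y) x = 'D_v A x *m B x + A x *m 'D_v B x.
Proof.
move=> sA sB; have /smooth_at_mxP sA' := sA; have /smooth_at_mxP sB' := sB.
apply/matrixP => i j; rewrite derive_mxE; last exact/smooth_at_derivable/smooth_at_mulmx.
rewrite !mxE -big_split /=.
have -> : (fun y => (A y *m B y) i j) = (fun y => \sum_k A y i k * B y k j).
  by apply/funext => y; rewrite mxE.
rewrite derive_sumfun => [|k]; last by apply/smooth_at_derivable/smooth_at_mul.
apply: eq_bigr => k _; rewrite deriveMfun; try exact: smooth_at_derivable.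
rewrite derive_mxE; last exact: smooth_at_derivable.
rewrite derive_mxE; last exact: smooth_at_derivable.
by rewrite addrC; congr (_ + _); exact: mulrC.
Qed.

Lemma vector_bracketE {R : realType} {n : nat} {M : topologicalType} {A : atlas R n M}
    (HA : is_charted A) (X Y : M -> 'rV[R]_n) p :
  'D_(X p) (vector_in (chart_at A p) Y) (chart (chart_at A p) p) -
  'D_(Y p) (vector_in (chart_at A p) X) (chart (chart_at A p) p) =
  vector_bracket A X Y p.
Proof.
Transparent vector_bracket.
have V Z : vector_in (chart_at A p) Z (chart (chart_at A p) p) = Z p.
  by rewrite (vector_inE HA) ?(Jloc_id HA) ?mulmx1//; exact: (ch_dom_at HA).
by rewrite -{1}(V X) -{1}(V Y).
Opaque vector_bracket.
Qed.

(** * Fundamental vector fields *)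

Section actions.
Context {R : realType} {m n : nat} {G : topGroupType} {M : topologicalType}.
Context {AG : atlas R m G} {AM : atlas R n M} {sigma : G -> M -> M}.
Hypothesis HL : is_lie_group AG.
Hypothesis HM : is_charted AM.
Hypothesis Hs : is_smooth_action AG AM sigma.

Let HG : is_charted AG := manifold_charted (lie_group_manifold HL).

Lemma act1 p : sigma 1%g p = p. Proof. by have [_ H _] := Hs. Qed.

Lemma actM g h p : sigma (g * h)%g p = sigma g (sigma h p).
Proof. by have [_ _ H] := Hs. Qed.

Lemma smooth_act x : smooth_map_at (prod_atlas AG AM) AM (fun x => sigma x.1 x.2) x.
Proof.
have [H _ _] := Hs; exact (smooth_map_at_of (prod_charted HG HM) HM x H).
Qed.

Lemma smooth_orbit p g : smooth_map_at AG AM (fun h => sigma h p) g.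
Proof. exact (smooth_map_at_partial1 HG HM (smooth_act (g, p))). Qed.

Lemma smooth_translate g p : smooth_map_at AM AM (sigma g) p.
Proof. exact (smooth_map_at_partial2 HG HM (smooth_act (g, p))). Qed.

Definition act_field (X : 'rV[R]_m) (p : M) : 'rV[R]_n :=
  X *m tangent_map AG AM (fun h => sigma h p) 1%g.

Lemma smooth_act_field X p : smooth_field_at AM (act_field X) p.
Proof.
exact: (smooth_field_generated HG HM (e := 1%g) (phi := fun x => sigma x.1 x.2)
  act1 smooth_act).
Qed.
Arguments smooth_act_field X p : clear implicits.

Lemma right_field_orbit X p g :
  right_field AG X g *m tangent_map AG AM (fun h => sigma h p) g =
  act_field X (sigma g p).
Proof.
rewrite /right_field /act_field -mulmxA; congr (_ *m _).
have := tangent_map_comp HG HG HM (smooth_mulr HL g 1%g) (smooth_orbit p _).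
rewrite mul1g => <-; congr (tangent_map _ _ _ _).
by apply/funext => k /=; rewrite actM.
Qed.

Lemma left_field_orbit X p g :
  left_field AG X g *m tangent_map AG AM (fun h => sigma h p) g =
  act_field X p *m tangent_map AM AM (sigma g) p.
Proof.
rewrite /left_field /act_field -!mulmxA; congr (_ *m _).
have := tangent_map_comp HG HG HM (smooth_mull HL g 1%g) (smooth_orbit p _).
rewrite mulg1 => <-.
have := tangent_map_comp HG HM HM (smooth_orbit p 1%g) (smooth_translate g _).
rewrite act1 => <-; congr (tangent_map _ _ _ _).
by apply/funext => k /=; rewrite actM.
Qed.

(** The orbit map of p relates right-invariant fields to fundamental ones, which therefore inherit
    the sign of the former. *)
Lemma bracket_act_field X Y p :
  vector_bracket AM (act_field X) (act_field Y) p = - act_field (lie_bracket AG X Y) p.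
Proof.
have := related_vector_bracket HG HM (p := 1%g) (smooth_orbit p)
  (smooth_right_field HL X _) (smooth_right_field HL Y _)
  (smooth_act_field X _) (smooth_act_field Y _)
  (fun q => right_field_orbit X p q) (fun q => right_field_orbit Y p q).
by rewrite act1 (bracket_right_field1 HL) mulNmx.
Qed.

End actions.

Arguments act_field {R m n G M} AG AM sigma X p.
Arguments smooth_act_field {R m n G M AG AM sigma} HL HM Hs X p.
Arguments smooth_orbit {R m n G M AG AM sigma} HL HM Hs p g.
Arguments smooth_translate {R m n G M AG AM sigma} HL HM Hs g p.

(** * The adjoint representation and its derivative *)

Section adjoint_action.
Context {R : realType} {m : nat} {G : topGroupType} {AG : atlas R m G}.
Hypothesis HL : is_lie_group AG.

Let HG : is_charted AG := manifold_charted (lie_group_manifold HL).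

Lemma mul_smooth_action : is_smooth_action AG AG (fun g h : G => (g * h)%g).
Proof.
split; [exact: lie_group_mul HL|exact: mul1g|by move=> g h p; rewrite mulgA].
Qed.

(** Right-invariant fields are the fundamental fields of left multiplication, which extends the
    formula from 1 to all g. *)
Lemma bracket_right_field X Y g :
  vector_bracket AG (right_field AG X) (right_field AG Y) g =
  - right_field AG (lie_bracket AG X Y) g.
Proof. exact (bracket_act_field HL HG mul_smooth_action X Y g). Qed.

Let i1 := chart_at AG 1%g.
Let e1 := chart i1 1%g.
Let d1 : chart_dom i1 1%g := ch_dom_at HG 1%g.

Definition Ad_mx (g : G) : 'M[R]_m :=
  tangent_map AG AG (fun h => (g * h * g^-1)%g) 1%g.

Lemma AdE g X : Ad AG g X = X *m Ad_mx g. Proof. by []. Qed.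

Lemma Ad_mxM g h : Ad_mx (g * h)%g = Ad_mx h *m Ad_mx g.
Proof.
have := tangent_map_comp HG HG HG (smooth_conj HL h 1%g) (smooth_conj HL g _).
rewrite mulg1 mulgV => <-; congr (tangent_map _ _ _ _).
by apply/funext => k /=; rewrite invgM !mulgA.
Qed.

Lemma Ad_mx1 : Ad_mx 1%g = 1%:M.
Proof. by apply/row_matrixP => i; rewrite !rowE -AdE (Ad1 HL) mulmx1. Qed.

Let RM u : 'M[R]_m := tangent_map AG AG (fun h => (h * chart_inv i1 u)%g) 1%g *m to_chart i1 u.

Let RME X u : vector_in i1 (right_field AG X) u = X *m RM u.
Proof. by rewrite /vector_in /right_field /RM mulmxA. Qed.

Let vLE X u : vector_in i1 (left_field AG X) u = Ad AG (chart_inv i1 u) X *m RM u.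
Proof.
have E := right_field_Ad HL (chart_inv i1 u) X.
apply: etrans (congr1 (mulmx ^~ (to_chart i1 u)) (esym E)) _.
exact: esym (mulmxA _ _ _).
Qed.

Let vector_in1 (X : G -> 'rV[R]_m) : vector_in i1 X e1 = X 1%g.
Proof. by rewrite /e1 (vector_inE HG)// (Jloc_id HG)// mulmx1. Qed.

Let RM1 : RM e1 = 1%:M.
Proof.
apply/row_matrixP => i.
by rewrite !rowE -RME vector_in1 (right_field1 HL) mulmx1.
Qed.

Let smooth_RM : smooth_at RM e1.
Proof.
apply/smooth_at_mxP => i j.
have /smooth_at_mxP/(_ 0 j) := smooth_right_field HL (delta_mx 0 i) 1%g i1 d1.
apply: smooth_at_near; apply: near_all => u; rewrite RME.
by rewrite -rowE mxE.
Qed.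

(** In the chart at 1 the matrix of the left-invariant frame is [Ad_mx] times the matrix [RM] of the
    right-invariant frame. Both frames are smooth and [RM] is invertible near 1. *)
Lemma smooth_Ad_mx : smooth_at (fun u => Ad_mx (chart_inv i1 u)) e1.
Proof.
have n1 : \forall u \near e1, \det (RM u) != 0.
  apply: cvgr_neq0 (smooth_at_continuous (smooth_at_det smooth_RM)) _.
  by rewrite RM1 det1 oner_neq0.
have H : smooth_at (fun u => \matrix_i vector_in i1 (left_field AG (delta_mx 0 i)) u) e1.
  apply/smooth_at_mxP => i j.
  have /smooth_at_mxP/(_ 0 j) := smooth_left_field HL (delta_mx 0 i) 1%g i1 d1.
  by apply: smooth_at_near; apply: near_all => u; rewrite [RHS]mxE.
have U : RM e1 \in unitmx by rewrite RM1 unitmx1.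
apply: smooth_at_near (smooth_at_mulmx H (smooth_at_invmx U smooth_RM)).
apply: filterS n1 => u du.
apply/row_matrixP => i; rewrite row_mul rowK vLE mulmxK ?unitmxE ?unitfE//.
by rewrite AdE rowE.
Qed.

(** Since Y^L = Y Ad RM, the derivative of Ad is D_X Y^L - D_X Y^R at 1. As X^L and Y^R commute, D_X
    Y^R = D_Y X^L, and the difference becomes the bracket of X^L and Y^L. *)
Lemma derive_Ad_mx X Y :
  Y *m 'D_X (fun u => Ad_mx (chart_inv i1 u)) e1 = lie_bracket AG X Y.
Proof.
have sA := smooth_Ad_mx.
have sL Z := smooth_left_field HL Z 1%g i1 d1.
have sR Z := smooth_right_field HL Z 1%g i1 d1.
have E1 : 'D_X (vector_in i1 (left_field AG Y)) e1 =
    Y *m 'D_X (fun u => Ad_mx (chart_inv i1 u)) e1 + Y *m 'D_X RM e1.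
  have -> : vector_in i1 (left_field AG Y) =
      fun u => Y *m (Ad_mx (chart_inv i1 u) *m RM u).
    by apply/funext => u; rewrite vLE; exact: esym (mulmxA _ _ _).
  rewrite derive_mulmx; [|exact: smooth_at_cst|exact: smooth_at_mulmx].
  rewrite derive_cst mul0mx add0r derive_mulmx// RM1 mulmx1 mulmxDr.
  by rewrite {1}/e1 (ch_chartK HG)// Ad_mx1 mul1mx.
have E2 : 'D_X (vector_in i1 (right_field AG Y)) e1 = Y *m 'D_X RM e1.
  have -> : vector_in i1 (right_field AG Y) = fun u => Y *m RM u.
    by apply/funext => u; rewrite RME.
  rewrite derive_mulmx//; last exact: smooth_at_cst.
  by rewrite derive_cst mul0mx add0r.
have B3 := bracket_left_right HL X Y 1%g.
have B1 := etrans (vector_bracketE HG (left_field AG X) (right_field AG Y) 1%g) B3.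
have B2 := vector_bracketE HG (left_field AG X) (left_field AG Y) 1%g.
rewrite (left_field1 HL X) (right_field1 HL Y) in B1.
rewrite (left_field1 HL X) (left_field1 HL Y) in B2.
apply: etrans _ B2.
have E3 := subr0_eq B1.
apply: etrans _ (congr2 (fun p q => p - q) (esym E1) (etrans (esym E2) E3)).
by rewrite addrK.
Qed.

Lemma Jloc_mull_unit q : chart_dom i1 q ->
  Jloc i1 i1 (fun h => (q * h)%g) 1%g *m Jloc i1 i1 (fun h => (q^-1 * h)%g) q = 1%:M.
Proof.
move=> iq; have := Jloc_comp (i:=i1) (j:=i1) (k:=i1) HG HG (smooth_mull HL q 1%g)
  (smooth_mull HL (q^-1)%g _).
rewrite mulg1 mulVg => /(_ d1 iq d1) <-.
have -> : (fun h : G => (q^-1 * h)%g) \o (fun h => (q * h)%g) = id.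
  by apply/funext => h /=; rewrite mulKg.
exact: Jloc_id.
Qed.

End adjoint_action.

(** The third tensor power of B applied to x. The sums are nested so that composition and
    differentiation can be handled one index at a time; [tri_actE] gives the flat form. *)
Definition tri_act {R : realType} {m n : nat} (x : 'I_m -> 'I_m -> 'I_m -> R) (B : 'M[R]_(m, n)) a b c : R :=
  \sum_k (\sum_j (\sum_i x i j k * B i a) * B j b) * B k c.

Section trilinear.
Context {R : realType} {m : nat}.
Implicit Types (x : 'I_m -> 'I_m -> 'I_m -> R).

Lemma contract_mulmx l p q (f : 'I_l -> R) (A : 'M[R]_(l, p)) (B : 'M[R]_(p, q)) c :
  \sum_k f k * (A *m B) k c = \sum_r (\sum_k f k * A k r) * B r c.
Proof.
under eq_bigr do rewrite mxE big_distrr /=.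
rewrite exchange_big /=; apply: eq_bigr => r _; rewrite big_distrl /=.
by apply: eq_bigr => k _; rewrite mulrA.
Qed.

Lemma contract_swap p q p' q' (f : 'I_p -> 'I_q -> R) (A : 'M[R]_(p, p')) (B : 'M[R]_(q, q')) b c :
  \sum_k (\sum_j f j k * A j b) * B k c = \sum_j (\sum_k f j k * B k c) * A j b.
Proof.
under eq_bigr do rewrite big_distrl /=.
rewrite exchange_big /=; apply: eq_bigr => j _; rewrite big_distrl /=.
by apply: eq_bigr => k _; rewrite mulrAC.
Qed.

Lemma tri_actM p n x (A : 'M[R]_(m, p)) (B : 'M[R]_(p, n)) a b c :
  tri_act x (A *m B) a b c = tri_act (tri_act x A) B a b c.
Proof.
rewrite /tri_act contract_mulmx; apply: eq_bigr => r _; congr (_ * _).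
under eq_bigr do rewrite contract_mulmx.
rewrite (contract_swap (fun q k => \sum_j (\sum_i x i j k * (A *m B) i a) * A j q)).
apply: eq_bigr => q _; congr (_ * _).
under eq_bigr => k _ do under eq_bigr => j _ do rewrite contract_mulmx.
under eq_bigr => k _ do
  rewrite (contract_swap (fun p j => \sum_i x i j k * A i p)).
by rewrite (contract_swap (fun p k => \sum_j (\sum_i x i j k * A i p) * A j q)).
Qed.

Lemma contract1 (f : 'I_m -> R) c : \sum_k f k * (1%:M : 'M[R]_m) k c = f c.
Proof.
rewrite (bigD1 c)//= mxE eqxx mulr1 big1 ?addr0// => k kc.
by rewrite mxE (negbTE kc) mulr0.
Qed.

Lemma tri_act1 x a b c : tri_act x 1%:M a b c = x a b c.
Proof.
rewrite /tri_act contract1 -[RHS](contract1 (fun j => x a j c)).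
by apply: eq_bigr => j _; rewrite contract1.
Qed.

Lemma tri_act_ext n x y (B : 'M[R]_(m, n)) a b c : (forall i j k, x i j k = y i j k) ->
  tri_act x B a b c = tri_act y B a b c.
Proof.
move=> xy; apply: eq_bigr => k _; congr (_ * _); apply: eq_bigr => j _; congr (_ * _).
by apply: eq_bigr => i _; rewrite xy.
Qed.

End trilinear.
Arguments tri_actM {R m p n}.
Arguments contract1 {R m}.
Arguments tri_act1 {R m}.

Section trilinear_derivative.
Context {R : realType} {m : nat} {E : normedModType R}.
Variables (A : E -> 'M[R]_m) (e v : E).
Hypotheses (sA : smooth_at A e) (A1 : A e = 1%:M).

Let sAij i j : smooth_at (fun u => A u i j) e.
Proof. by move/smooth_at_mxP : sA; apply. Qed.

Lemma smooth_contract (g : 'I_m -> E -> R) c : (forall k, smooth_at (g k) e) ->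
  smooth_at (fun u => \sum_k g k u * A u k c) e.
Proof. by move=> sg; apply: smooth_at_sum => k; exact: smooth_at_mul. Qed.

Lemma derive_contract (g : 'I_m -> E -> R) c : (forall k, smooth_at (g k) e) ->
  'D_v (fun u => \sum_k g k u * A u k c) e =
  \sum_k g k e * 'D_v A e k c + 'D_v (g c) e.
Proof.
move=> sg; rewrite derive_sumfun => [|k]; last exact/smooth_at_derivable/smooth_at_mul.
rewrite -[in RHS](contract1 (fun k => 'D_v (g k) e)) -A1 -big_split /=.
apply: eq_bigr => k _; rewrite deriveMfun; try exact: smooth_at_derivable.
rewrite derive_mxE; last exact: smooth_at_derivable.
by congr (_ + _); exact: mulrC.
Qed.

(** Leibniz's rule at a point where A is the identity. For A = Ad this is the expression that
    [ad_invariant] sets to 0. *)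
Lemma derive_tri_act (x : 'I_m -> 'I_m -> 'I_m -> R) a b c :
  'D_v (fun u => tri_act x (A u) a b c) e =
  \sum_l ('D_v A e l a * x l b c + 'D_v A e l b * x a l c + 'D_v A e l c * x a b l).
Proof.
have s0 j k i : smooth_at (fun=> x i j k : R) e by exact: smooth_at_cst.
have s1 j k : smooth_at (fun u => \sum_i x i j k * A u i a) e.
  exact: smooth_contract.
have s2 k : smooth_at (fun u => \sum_j (\sum_i x i j k * A u i a) * A u j b) e.
  exact: (smooth_contract b (s1 ^~ k)).
rewrite (derive_contract c s2) (derive_contract b (s1 ^~ c)) (derive_contract a (s0 b c)).
rewrite derive_cst addr0 !big_split /= [LHS]addrC [X in X + _]addrC; congr (_ + _ + _).
- by apply: eq_bigr => l _; exact: mulrC.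
- by apply: eq_bigr => l _; rewrite A1 contract1; exact: mulrC.
- apply: eq_bigr => l _; rewrite A1 mulrC; congr (_ * _).
  by rewrite -[RHS](contract1 (fun j => x a j l)); apply: eq_bigr => j _; rewrite contract1.
Qed.

Lemma smooth_tri_act (x : 'I_m -> 'I_m -> 'I_m -> R) a b c :
  smooth_at (fun u => tri_act x (A u) a b c) e.
Proof.
apply: (@smooth_contract (fun k u => \sum_j (\sum_i x i j k * A u i a) * A u j b)) => k.
apply: (@smooth_contract (fun j u => \sum_i x i j k * A u i a)) => j.
by apply: (@smooth_contract (fun i u => x i j k)) => i; exact: smooth_at_cst.
Qed.

End trilinear_derivative.


Arguments Ad_mx {R m G} AG g.

Lemma near_constant {R : realType} {E : normedModType R} (f : E -> R) x :
  (\forall y \near x, differentiable f y /\ forall v, 'D_v f y = 0) ->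
  \forall y \near x, f y = f x.
Proof.
move=> /nbhs_ballP[r /= r0 rP]; apply/nbhs_ballP; exists r => //= y xy.
have seg s : 0 <= s <= 1 -> ball x r (x + s *: (y - x)).
  by move=> s01; apply: ball_segment => //; exact: ballxx.
have [s s01|c c01] := mean_value_line (f := f) (a := x) (v := y - x) ler01.
  by have [] := rP _ (seg s s01).
have [_ ->] := rP _ (seg c c01).
by rewrite mulr0 scale1r [x + _]addrC subrK => /eqP; rewrite subr_eq0 => /eqP.
Qed.

(** * From ad-invariance to Ad-invariance *)

Section Ad_invariance.
Context {R : realType} {m : nat} {G : topGroupType} {AG : atlas R m G}.
Hypothesis HL : is_lie_group AG.
Hypothesis Gconn : connected [set: G].
Variable x : 'I_m -> 'I_m -> 'I_m -> R.
Hypothesis xinv : ad_invariant AG x.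

Let HG : is_charted AG := manifold_charted (lie_group_manifold HL).
Let i1 := chart_at AG 1%g.
Let e1 := chart i1 1%g.
Let d1 : chart_dom i1 1%g := ch_dom_at HG 1%g.
Let F a b c u := tri_act x (Ad_mx AG (chart_inv i1 u)) a b c.

Let A1 : Ad_mx AG (chart_inv i1 e1) = 1%:M.
Proof. by rewrite /e1 (ch_chartK HG)// (Ad_mx1 HL). Qed.

Let derive_F1 X a b c : 'D_X (F a b c) e1 = 0.
Proof.
have sA := smooth_Ad_mx HL.
rewrite (derive_tri_act X sA A1) -[RHS](xinv X a b c).
have E l k : 'D_X (fun u => Ad_mx AG (chart_inv i1 u)) e1 l k =
    lie_bracket AG X (delta_mx 0 l) 0 k.
  by rewrite -(derive_Ad_mx HL X (delta_mx 0 l)) -rowE mxE.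
by apply: eq_bigr => l _; rewrite !E.
Qed.

Let smooth_F a b c : smooth_at (F a b c) e1.
Proof. exact (smooth_tri_act (smooth_Ad_mx HL) x a b c). Qed.

Lemma derive_tri_act_arg (E : normedModType R) (y : 'I_m -> 'I_m -> 'I_m -> E -> R)
    (B : 'M[R]_m) (e v : E) a b c :
  (forall i j k, smooth_at (y i j k) e) -> (forall i j k, 'D_v (y i j k) e = 0) ->
  'D_v (fun w => tri_act (fun i j k => y i j k w) B a b c) e = 0.
Proof.
move=> sy Dy.
have L (g : 'I_m -> E -> R) d : (forall k, smooth_at (g k) e) ->
    (forall k, 'D_v (g k) e = 0) ->
    smooth_at (fun w => \sum_k g k w * B k d) e /\
    'D_v (fun w => \sum_k g k w * B k d) e = 0.
  move=> sg Dg.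
  have s k : smooth_at (fun w => g k w * B k d) e.
    by apply: smooth_at_mul => //; exact: smooth_at_cst.
  split; first exact: smooth_at_sum.
  rewrite derive_sumfun => [|k]; last exact: smooth_at_derivable.
  rewrite big1// => k _; rewrite deriveMfun; [|exact: smooth_at_derivable|exact: derivable_cst].
  by rewrite derive_cst Dg !mulr0 addr0.
have L1 j k := L (fun i => y i j k) a (fun i => sy i j k) (fun i => Dy i j k).
have L2 k := L _ b (fun j => (L1 j k).1) (fun j => (L1 j k).2).
exact: (L _ c (fun k => (L2 k).1) (fun k => (L2 k).2)).2.
Qed.

(** Left translation by q carries 1 to q, and Ad of qh is Ad of h followed by the constant Ad of q.
    A derivative at q is thus a combination of derivatives at 1, which vanish by ad-invariance. *)
Let derive_F a b c : \forall u \near e1,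
  differentiable (F a b c) u /\ forall v, 'D_v (F a b c) u = 0.
Proof.
apply: filterS2 (near_chart_img HG d1) (smooth_at_nbhs (smooth_F a b c)).
move=> u [q iq <-] sF; have dF := smooth_at_differentiable sF; split=> // v.
have := Jloc_mull_unit HL iq; rewrite -/i1.
set J := Jloc _ _ _ _; set J' := Jloc _ _ _ _ => JJ'.
have -> : v = v *m J' *m J by rewrite -mulmxA (mulmx1C JJ') mulmx1.
pose L := locmap (A:=AG) (B:=AG) i1 i1 (fun h => (q * h)%g).
have sq := smooth_mull HL q 1%g; have iq1 : chart_dom i1 (q * 1)%g by rewrite mulg1.
have dL : differentiable L e1 := smooth_at_differentiable (sq.2 _ _ d1 iq1).
have Le : L e1 = chart i1 q by rewrite /L /locmap /= /e1 (ch_chartK HG)// mulg1.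
have -> : v *m J' *m J = 'D_(v *m J') L e1 by rewrite (deriveEjacobian _ dL).
rewrite -Le in dF *.
rewrite -(derive_comp (v *m J') dL dF).
rewrite (@near_eq_derive _ _ _ _ (fun w => tri_act
  (fun i j k => F i j k w) (Ad_mx AG q) a b c)).
  by apply: (derive_tri_act_arg (y := F)) => i j k; [exact: smooth_F|exact: derive_F1].
have N : \forall h \near 1%g, chart_dom i1 (q * h)%g.
  by apply: sq.1; exact: near_chart_dom.
have := near_chart_inv HG d1 N; apply: filterS => w iw.
have E : chart_inv i1 (L w) = (q * chart_inv i1 w)%g := ch_chartK HG iw.
apply: etrans (congr1 (fun g => tri_act x (Ad_mx AG g) a b c) E) _.
by rewrite (Ad_mxM HL); exact: tri_actM.
Qed.

Let invariant g := forall a b c, tri_act x (Ad_mx AG g) a b c = x a b c.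

Let invariant1 : invariant 1%g.
Proof. by move=> a b c; rewrite (Ad_mx1 HL) tri_act1. Qed.

Let invariantM g h : invariant g -> invariant h -> invariant (g * h)%g.
Proof.
by move=> ig ih a b c; rewrite (Ad_mxM HL) tri_actM -(ig a b c); exact: tri_act_ext.
Qed.

Let invariantV g : invariant g -> invariant (g^-1)%g.
Proof.
move=> ig a b c; rewrite -[RHS](invariant1 a b c) -(mulVg g) (Ad_mxM HL) tri_actM.
by apply: tri_act_ext => i j k; rewrite ig.
Qed.

Let near_invariant1 : \forall g \near (1%g : G), invariant g.
Proof.
have H : \forall u \near e1, forall abc : 'I_m * 'I_m * 'I_m,
    F abc.1.1 abc.1.2 abc.2 u = F abc.1.1 abc.1.2 abc.2 e1.
  by apply: near_forall_fin => -[[a b] c]; exact: near_constant (derive_F a b c).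
apply: filterS2 (near_chart HG d1 H) (near_chart_dom HG d1) => g Hg ig a b c.
have E := ch_chartK HG ig.
apply: etrans (congr1 (fun k => tri_act x (Ad_mx AG k) a b c) (esym E)) _.
apply: etrans (Hg (a, b, c)) _.
exact: etrans (congr1 (fun B => tri_act x B a b c) A1) (tri_act1 _ _ _ _).
Qed.

Let near_translate (g : G) : \forall h \near g, invariant (g^-1 * h)%g.
Proof.
exact (continuous_near (smooth_mull HL (g^-1)%g g).1 (mulVg g) near_invariant1).
Qed.

(* Ad_g x is constant near 1, having zero derivative there, so the stabiliser
   of x is an open subgroup of the connected group G. *)
Lemma ad_invariant_Ad g a b c : tri_act x (Ad_mx AG g) a b c = x a b c.
Proof.
suff : [set g | invariant g] = [set: G].
  by move=> /seteqP[_ /(_ g I)]; apply.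
apply: Gconn; first by exists 1%g; exact: invariant1.
- exists [set g | invariant g]; last by rewrite setTI.
  rewrite openE => h ih; rewrite /interior /=.
  apply: filterS (near_translate h) => k ik.
  have := invariantM (ih : invariant h) ik; rewrite mulVKg; exact.
- exists [set g | invariant g]; last by rewrite setTI.
  (* An open subgroup is closed: if k is close to h and lies in the stabiliser, so does h = k (h^-1
     k)^-1. *)
  rewrite -[X in closed X]setCK; apply: open_closedC.
  rewrite openE => h ih; rewrite /interior /=.
  apply: filterS (near_translate h) => k ik /= kinv; apply: ih.
  have := invariantM (kinv : invariant k) (invariantV ik).
  rewrite invgM invgK mulVKg; exact.
Qed.

End Ad_invariance.

Lemma mulmx_sub_entry {R : pzRingType} {p q : nat} (w : 'rV[R]_p) (A B : 'M[R]_(p, q)) k :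
  (w *m A) 0 k - (w *m B) 0 k = \sum_l w 0 l * (A - B) l k.
Proof.
by rewrite !mxE -sumrB; apply: eq_bigr => l _; rewrite !mxE mulrBr.
Qed.

Lemma sub_cancel1 {R : comPzRingType} {p q : nat} (x y s t u : 'M[R]_(p, q)) :
  x - s - t - (y - s - u) = x - y - (t - u).
Proof. by apply/matrixP => i j; rewrite !mxE; ring. Qed.

Lemma sub_cancel2 {R : comPzRingType} {p q : nat} (x y s t u : 'M[R]_(p, q)) :
  x - t - s - (y - u - s) = x - y - (t - u).
Proof. by apply/matrixP => i j; rewrite !mxE; ring. Qed.

(** * The group law in a chart around the identity *)

Section bilinear_estimate.
Context {R : realType} {m : nat}.
Implicit Types (x y v : 'rV[R]_m).

Lemma norm_row_mx x y : `|row_mx x y| <= `|x| + `|y|.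
Proof.
apply: mx_norm_le => [|i j]; first by rewrite addr_ge0.
case: (split_ordP j) => k ->; rewrite ?row_mxEl ?row_mxEr.
  by rewrite (le_trans (norm_entry_le _ _ _))// lerDl.
by rewrite (le_trans (norm_entry_le _ _ _))// lerDr.
Qed.

Variable H : 'rV[R]_(m + m) -> 'rV[R]_m.
Hypothesis sH : smooth_at H 0.
Hypothesis H0 : \forall y \near (0 : 'rV[R]_m), H (row_mx 0 y) = 0.

Lemma derive_fiber0 : \forall y \near (0 : 'rV[R]_m),
  smooth_at H (row_mx 0 y) -> forall v, 'D_(row_mx 0 v) H (row_mx 0 y) = 0.
Proof.
move/near_join : H0; apply: filterS => y Hy sy v.
have dy := smooth_at_differentiable sy.
have := is_derive_comp_line (f := H) (a := row_mx 0 y) (v := row_mx 0 v) (t := 0).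
rewrite scale0r addr0 => /(_ dy)/(@derive_val _ _ _ _ _ _ _) <-.
rewrite (@near_eq_derive _ _ _ _ (fun=> 0)) ?derive_cst//.
have lc := smooth_at_continuous (smooth_at_line y v (0 : R)).
have ly : y + (0 : R) *: v = y by rewrite scale0r addr0.
have := continuous_near lc ly Hy.
by apply: filterS => s; rewrite scale_row_mx scaler0 add_row_mx addr0.
Qed.

(** The mean value theorem in y leaves the derivative of [H] along y at a point (x, yc). This
    derivative vanishes on the slice x = 0 and the Jacobian is Lipschitz, so it is O(|x|). *)
Lemma bilinear_estimate : exists C, 0 <= C /\ exists2 r, 0 < r &
  forall x y y', `|x| < r -> `|y| < r -> `|y'| < r ->
  `|H (row_mx x y) - H (row_mx x y')| <= C * `|x| * `|y - y'|.
Proof.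
have [L [L0 [r1 r10 Lip]]] := smooth_at_lipschitz (smooth_at_jacobian sH).
have /nbhs_ballP[r2 /= r20 r2P] := smooth_at_nbhs sH.
have /nbhs_ballP[r3 /= r30 r3P] := derive_fiber0.
(* Halves, because |(x, y)| is bounded by |x| + |y|; [r3] bounds y alone, on the slice x = 0. *)
pose r := Num.min (r1 / 2) (Num.min (r2 / 2) r3).
have r0 : 0 < r by rewrite !lt_min r30 !divr_gt0.
have ball2 x y : `|x| < r -> `|y| < r -> ball (0 : 'rV[R]_(m + m)) r1 (row_mx x y) /\
    ball (0 : 'rV[R]_(m + m)) r2 (row_mx x y).
  rewrite !lt_min => /and3P[x1 x2 _] /and3P[y1 y2 _]; rewrite -!ball_normE /= sub0r normrN.
  by split; rewrite (le_lt_trans (norm_row_mx _ _))// [ltRHS]splitr ltrD.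
(* A row of length m + m times a matrix whose entries are at most L|x|. *)
exists ((m + m)%:R * L); split; first by rewrite mulr_ge0.
exists r => // x y y' xr yr y'r; apply: mx_norm_le => [|i k].
  by rewrite !mulr_ge0.
rewrite {i}(ord1 i) !mxE.
have n0 : `|0 : 'rV[R]_m| < r by rewrite normr0.
have seg s : 0 <= s <= 1 -> `|y' + s *: (y - y')| < r.
  move=> s01; have := @ball_segment _ _ 0 y y' r s; rewrite -!ball_normE /= !sub0r !normrN.
  exact.
have E s : row_mx x y' + s *: row_mx 0 (y - y') = row_mx x (y' + s *: (y - y')).
  by rewrite scale_row_mx scaler0 add_row_mx addr0.
have sm s : 0 <= s <= 1 -> smooth_at H (row_mx x y' + s *: row_mx 0 (y - y')).
  by move=> s01; rewrite E; apply: r2P; have [] := ball2 x _ xr (seg s s01).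
have [s s01|c c01] := mean_value_line (f := fun z => H z 0 k) (a := row_mx x y')
    (v := row_mx 0 (y - y')) ler01.
  have /smooth_at_mxP/(_ 0 k) := sm s s01; exact: smooth_at_differentiable.
have Dc := smooth_at_differentiable (sm c c01).
have EE : y' + 1 *: (y - y') = y by rewrite scale1r addrC subrK.
rewrite mul1r (E 1) EE => ->.
rewrite -(derive_mxE 0 k (diff_derivable Dc)) (deriveEjacobian _ Dc) (E c).
set yc := y' + c *: (y - y').
have yc0 : ball (0 : 'rV[R]_m) r3 yc.
  rewrite -ball_normE /= sub0r normrN.
  by have := seg c c01; rewrite !lt_min => /and3P[].
have s0c : smooth_at H (row_mx 0 yc) by apply: r2P; have [] := ball2 0 _ n0 (seg c c01).
have D0 := r3P _ yc0 s0c (y - y').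
rewrite (deriveEjacobian _ (smooth_at_differentiable s0c)) in D0.
rewrite -[X in `|X|]subr0 -[X in _ - X](_ : (row_mx 0 (y - y') *m 'J H (row_mx 0 yc)) 0 k = 0);
  last by rewrite D0 mxE.
have := Lip _ _ (ball2 x yc xr (seg c c01)).1 (ball2 0 yc n0 (seg c c01)).1.
set JJ := 'J H (row_mx x yc); set J0 := 'J H (row_mx 0 yc) => JL.
rewrite mulmx_sub_entry.
rewrite (le_trans (ler_norm_sum _ _ _))//.
rewrite (@le_trans _ _ (\sum_(l < m + m) (L * `|x| * `|y - y'|)))//; last first.
  by rewrite sumr_const card_ord -[X in X <= _]mulr_natl !mulrA.
apply: ler_sum => l _; rewrite normrM mulrC ler_pM//.
  rewrite (le_trans (norm_entry_le _ _ _))// (le_trans JL)// ler_wpM2l//.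
  rewrite opp_row_mx add_row_mx subrr subr0 (le_trans (norm_row_mx _ _))//.
  by rewrite normr0 addr0.
rewrite (le_trans (norm_entry_le _ _ _))// (le_trans (norm_row_mx _ _))//.
by rewrite normr0 add0r.
Qed.

End bilinear_estimate.

Section chart_estimates.
Context {R : realType} {m : nat} {G : topGroupType} {AG : atlas R m G}.
Hypothesis HL : is_lie_group AG.

Let HG : is_charted AG := manifold_charted (lie_group_manifold HL).
Let i1 := chart_at AG 1%g.
Let e1 := chart i1 1%g.
Let d1 : chart_dom i1 1%g := ch_dom_at HG 1%g.

Definition centred (g : G) : 'rV[R]_m := chart i1 g - e1.
Definition near_one (r : R) (g : G) := chart_dom i1 g /\ `|centred g| < r.

Lemma centred1 : centred 1%g = 0.
Proof. by rewrite /centred subrr. Qed.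

Lemma near_one1 r : 0 < r -> near_one r 1%g.
Proof. by move=> r0; split=> //; rewrite centred1 normr0. Qed.

(* In the centred chart the product is x + y + O(|x||y|). *)
Lemma product_estimate : exists r C : R, [/\ 0 < r, 0 <= C, C * r <= 1,
  forall x : 'rV[R]_m, `|x| < r -> exists2 g, chart_dom i1 g & centred g = x &
  forall g h h', near_one r g -> near_one r h -> near_one r h' ->
  [/\ chart_dom i1 (g * h)%g,
      `|centred (g * h)%g - centred (g * h')%g - (centred h - centred h')| <=
        C * `|centred g| * `|centred h - centred h'| &
      `|centred (h * g)%g - centred (h' * g)%g - (centred h - centred h')| <=
        C * `|centred g| * `|centred h - centred h'|]].
Proof.
have smul := smooth_map_at_of (prod_charted HG HG) HG (1, 1)%g (lie_group_mul HL).
have dd : chart_dom (a:=prod_atlas AG AG) (i1, i1) (1, 1)%g by split.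
have d11 : chart_dom i1 (1 * 1)%g by rewrite mulg1.
pose P := locmap (A:=prod_atlas AG AG) (B:=AG) (i1, i1) i1 (fun x => (x.1 * x.2)%g).
have sP : smooth_at P (row_mx e1 e1) := smul.2 (i1, i1) i1 dd d11.
(* The defect of the product from x + y in centred coordinates; it vanishes for x = 0 because 1 is
   neutral. *)
pose Phi (z : 'rV[R]_(m + m)) := P (z + row_mx e1 e1) - e1 - lsubmx z - rsubmx z.
have trans (z : 'rV[R]_(m + m)) : smooth_at (fun w => w + row_mx e1 e1) z.
  by apply: smooth_at_add; [exact: smooth_at_id|exact: smooth_at_cst].
have sPhi : smooth_at Phi 0.
  apply: smooth_at_sub; last exact/smooth_at_rsubmx/smooth_at_id.
  apply: smooth_at_sub; last exact/smooth_at_lsubmx/smooth_at_id.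
  apply: smooth_at_sub; last exact: smooth_at_cst.
  by apply: smooth_at_comp (trans 0); rewrite add0r.
(* The same defect with the factors exchanged, for the estimate in which the left factor varies. *)
pose Psi (z : 'rV[R]_(m + m)) := Phi (row_mx (rsubmx z) (lsubmx z)).
have sPsi : smooth_at Psi 0.
  apply: (@smooth_at_comp _ _ _ _ _ Phi).
    rewrite (_ : row_mx _ _ = 0)//; apply/rowP => j; rewrite !mxE.
    by case: splitP => k _; rewrite !mxE.
  by apply: smooth_at_row_mx; [exact/smooth_at_rsubmx/smooth_at_id|
    exact/smooth_at_lsubmx/smooth_at_id].
have Nimg : \forall y \near (0 : 'rV[R]_m), chart_img i1 (y + e1).
  have c0 : {for (0 : 'rV[R]_m), continuous (fun y : 'rV[R]_m => y + e1)}.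
    apply: smooth_at_continuous; apply: smooth_at_add; [exact: smooth_at_id|exact: smooth_at_cst].
  exact: (continuous_near c0 (add0r e1) (near_chart_img HG d1)).
have P1 y : chart_img i1 (y + e1) -> P (row_mx e1 (y + e1)) = y + e1.
  move=> yi; rewrite /P /locmap /= row_mxKl row_mxKr {1}/e1 (ch_chartK HG)// mul1g.
  exact: chart_invK.
have P2 y : chart_img i1 (y + e1) -> P (row_mx (y + e1) e1) = y + e1.
  move=> yi; rewrite /P /locmap /= row_mxKl row_mxKr (ch_chartK HG d1 : chart_inv i1 e1 = 1%g) mulg1.
  exact: chart_invK.
have Phi1 : \forall y \near (0 : 'rV[R]_m), Phi (row_mx 0 y) = 0.
  apply: filterS Nimg => y yi; rewrite /Phi add_row_mx add0r P1// row_mxKl row_mxKr.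
  by rewrite addrK subr0 subrr.
have Psi1 : \forall y \near (0 : 'rV[R]_m), Psi (row_mx 0 y) = 0.
  apply: filterS Nimg => y yi; rewrite /Psi row_mxKl row_mxKr /Phi add_row_mx add0r P2//.
  by rewrite row_mxKl row_mxKr addrK subr0 subrr.
have [C1 [C10 [r1 r10 est1]]] := bilinear_estimate sPhi Phi1.
have [C2 [C20 [r2 r20 est2]]] := bilinear_estimate sPsi Psi1.
have Ndom : \forall z \near (0 : 'rV[R]_(m + m)),
    chart_dom i1 (chart_inv i1 (lsubmx (z + row_mx e1 e1)) * chart_inv i1 (rsubmx (z + row_mx e1 e1)))%g.
  have N1 := near_chart_inv (prod_charted HG HG) dd (smul.1 _ (near_chart_dom HG d11)).
  have tc := smooth_at_continuous (trans 0).
  exact: (continuous_near tc (add0r _) N1).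
have /nbhs_ballP[r3 /= r30 r3P] := Ndom.
have /nbhs_ballP[r4 /= r40 r4P] := Nimg.
pose C := C1 + C2.
have C0 : 0 <= C by rewrite addr_ge0.
(* The last bound, 1 / (C + 1), yields C r <= 1. *)
pose r := Num.min (Num.min r1 r2) (Num.min (Num.min (r3 / 2) r4) (1 / (C + 1))).
have Cp : 0 < C + 1 by rewrite ltr_wpDl.
have r0 : 0 < r by rewrite !lt_min r10 r20 r40 !divr_gt0.
exists r, C; split=> //.
- have : r <= 1 / (C + 1) by rewrite !ge_min lexx !orbT.
  rewrite ler_pdivlMr// mulrC mulrDl mul1r => h.
  by rewrite (le_trans _ h)// lerDl ltW.
- move=> x xr; have xi : chart_img i1 (x + e1).
    apply: r4P; rewrite -ball_normE /= sub0r normrN.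
    by move: xr; rewrite !lt_min -!andbA => /and5P[].
  exists (chart_inv i1 (x + e1)); first exact: chart_inv_dom.
  by rewrite /centred (chart_invK HG)// addrK.
move=> g h h' [gd gr] [hd hr] [hd' hr'].
have Pc a b : chart_dom i1 a -> chart_dom i1 b ->
    P (row_mx (centred a) (centred b) + row_mx e1 e1) - e1 = centred (a * b)%g.
  move=> ad bd; rewrite add_row_mx /centred !subrK /P /locmap /= row_mxKl row_mxKr.
  by rewrite !(ch_chartK HG).
have Phic a b : chart_dom i1 a -> chart_dom i1 b ->
    Phi (row_mx (centred a) (centred b)) = centred (a * b)%g - centred a - centred b.
  by move=> ad bd; rewrite /Phi Pc// row_mxKl row_mxKr.
have Psic a b : chart_dom i1 a -> chart_dom i1 b ->
    Psi (row_mx (centred b) (centred a)) = centred (a * b)%g - centred a - centred b.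
  by move=> ad bd; rewrite /Psi row_mxKl row_mxKr Phic.
have lt1 a : `|centred a| < r -> [/\ `|centred a| < r1, `|centred a| < r2 & `|centred a| < r3 / 2].
  by rewrite !lt_min -!andbA => /and5P[].
have [g1 g2 g3] := lt1 _ gr; have [h1 h2 h3] := lt1 _ hr; have [k1 k2 k3] := lt1 _ hr'.
have LE C' : C' <= C -> C' * `|centred g| * `|centred h - centred h'| <=
    C * `|centred g| * `|centred h - centred h'|.
  by move=> le; rewrite ler_wpM2r// ler_wpM2r.
split.
- have := r3P (row_mx (centred g) (centred h)).
  rewrite add_row_mx /centred !subrK row_mxKl row_mxKr !(ch_chartK HG)//; apply.
  rewrite -ball_normE /= sub0r normrN (le_lt_trans (norm_row_mx _ _))//.
  by rewrite [ltRHS]splitr ltrD.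
- have := est1 _ _ _ g1 h1 k1; rewrite !Phic// sub_cancel1 => /le_trans; apply.
  by apply: LE; rewrite lerDl.
- have := est2 _ _ _ g2 h2 k2; rewrite !Psic// sub_cancel2 => /le_trans; apply.
  by apply: LE; rewrite lerDr.
Qed.

End chart_estimates.

(** * One-parameter subgroups *)

Section geometric_limits.
Context {R : realType}.

(** With q n = 2K / 2^n, the tail of the geometric series, the intervals [u n - q n, u n + q n] are
    nested; the limit is the supremum of their left ends. *)
Lemma geometric_limit_real (u : nat -> R) (K : R) : 0 <= K ->
  (forall n, `|u n.+1 - u n| <= K / 2 ^+ n) ->
  exists l, forall n, `|l - u n| <= 2 * K / 2 ^+ n.
Proof.
move=> K0 uK; pose q n := 2 * K / 2 ^+ n.
have q0 n : 0 <= q n by rewrite /q divr_ge0 ?mulr_ge0// exprn_ge0.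
have qS n : q n = K / 2 ^+ n + q n.+1.
  by rewrite /q exprS invfM; field.
have low n : u n - q n <= u n.+1 - q n.+1.
  by have := uK n; rewrite ler_distlC => /andP[h1 h2]; have := qS n; lra.
have up n : u n.+1 + q n.+1 <= u n + q n.
  by have := uK n; rewrite ler_distlC => /andP[h1 h2]; have := qS n; lra.
have lowD n k : u n - q n <= u (n + k)%N - q (n + k)%N.
  by elim: k => [|k IH]; rewrite ?addn0// addnS (le_trans IH).
have upD n k : u (n + k)%N + q (n + k)%N <= u n + q n.
  by elim: k => [|k IH]; rewrite ?addn0// addnS (le_trans _ IH).
have cross n k : u n - q n <= u k + q k.
  have [nk|/ltnW kn] := leqP n k.
    by rewrite -(subnKC nk); have := lowD n (k - n)%N; have := q0 (n + (k - n))%N; lra.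
  by rewrite -(subnKC kn); have := upD k (n - k)%N; have := q0 (k + (n - k))%N; lra.
pose E := [set u n - q n | n in [set: nat]].
have E0 : E !=set0 by exists (u 0%N - q 0%N); exists 0%N.
have ubE k : ubound E (u k + q k) by move=> _ [n _ <-].
exists (sup E) => n; rewrite ler_distlC; apply/andP; split.
  by rewrite lerBlDr; exact: ge_sup E0 (ubE n).
by rewrite -lerBlDr; apply: ub_le_sup; [exists (u 0%N + q 0%N)|exists n].
Qed.

Lemma geometric_limit m (u : nat -> 'rV[R]_m) (K : R) : 0 <= K ->
  (forall n, `|u n.+1 - u n| <= K / 2 ^+ n) ->
  exists l, forall n, `|l - u n| <= 2 * K / 2 ^+ n.
Proof.
move=> K0 uK.
have H j : exists l, forall n, `|l - u n 0 j| <= 2 * K / 2 ^+ n.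
  apply: geometric_limit_real => // n; apply: le_trans (uK n).
  by have := norm_entry_le (u n.+1 - u n) 0 j; rewrite !mxE.
have [l lP] := choice H.
exists (\row_j l j) => n; apply: mx_norm_le => [|i j].
  by rewrite divr_ge0 ?mulr_ge0// exprn_ge0.
by rewrite (ord1 i) !mxE.
Qed.

Lemma eq_geometric m (x y : 'rV[R]_m) (K : R) :
  (forall n, `|x - y| <= K / 2 ^+ n) -> x = y.
Proof.
move=> H; apply/eqP; rewrite -subr_eq0 -normr_le0; apply/ler_addgt0Pl => e e0; rewrite addr0.
have [n nK] : exists n : nat, K < e * n%:R.
  exists (Num.truncn (`|K| / e)).+1.
  have := truncnS_gt (`|K| / e); rewrite ltr_pdivrMr// mulrC.
  by apply: le_lt_trans; exact: ler_norm.
apply: (le_trans (H n)); rewrite ler_pdivrMr ?exprn_gt0//.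
apply: (le_trans (ltW nK)); rewrite ler_wpM2l ?(ltW e0)//.
by rewrite -natrX ler_nat ltnW// ltn_expl.
Qed.

(** Replaces the passage to the limit in inequalities that hold up to an error of order 2^-n. *)
Lemma le_geometric (x y L : R) : (forall n, x <= y + L / 2 ^+ n) -> x <= y.
Proof.
move=> H; have [//|yx] := leP x y.
have e : \row_(j < 1) x - \row_(j < 1) y = \row_(j < 1) (x - y) by apply/rowP => j; rewrite !mxE.
suff /rowP/(_ 0) : \row_(j < 1) x = \row_(j < 1) y by rewrite !mxE => xy; rewrite xy ltxx in yx.
apply: (@eq_geometric 1 _ _ L) => n; apply: mx_norm_le => [|i j].
  by have := H n; lra.
by rewrite !mxE ger0_norm ?subr_ge0 ?(ltW yx)//; have := H n; lra.
Qed.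

End geometric_limits.

(** * Powers of elements close to the identity *)

Section powers.
Context {R : realType} {m : nat} {G : topGroupType} {AG : atlas R m G}.
Hypothesis HL : is_lie_group AG.
Let HG : is_charted AG := manifold_charted (lie_group_manifold HL).
Let i1 := chart_at AG 1%g.
Local Notation c := (centred (AG:=AG)).
Local Notation near1 := (near_one (AG:=AG)).
Variables (r C : R).
Hypotheses (r0 : 0 < r) (C0 : 0 <= C) (Cr : C * r <= 1).
Hypothesis est : forall g h h', near1 r g -> near1 r h -> near1 r h' ->
  [/\ chart_dom i1 (g * h)%g,
      `|c (g * h)%g - c (g * h')%g - (c h - c h')| <= C * `|c g| * `|c h - c h'| &
      `|c (h * g)%g - c (h' * g)%g - (c h - c h')| <= C * `|c g| * `|c h - c h'|].

Lemma Cnorm_le1 g : near1 r g -> C * `|c g| <= 1.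
Proof.
by move=> [_ gr]; apply: le_trans Cr; rewrite ler_wpM2l// ltW.
Qed.

Lemma mul_expand g h : near1 r g -> near1 r h ->
  chart_dom i1 (g * h)%g /\ `|c (g * h)%g - c g - c h| <= C * `|c g| * `|c h|.
Proof.
move=> gr hr; have [d e _] := est gr hr (near_one1 HL r0).
by split=> //; move: e; rewrite mulg1 centred1 !subr0.
Qed.

Lemma mul_norm_le g h : near1 r g -> near1 r h ->
  `|c (g * h)%g| <= `|c g| + 2 * `|c h|.
Proof.
move=> gr hr; have [_ e] := mul_expand gr hr.
have -> : c (g * h)%g = (c (g * h)%g - c g - c h) + (c g + c h).
  by apply/rowP => j; rewrite !mxE; ring.
have := ler_normD (c (g * h)%g - c g - c h) (c g + c h).
have := ler_normD (c g) (c h).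
have := ler_wpM2r (normr_ge0 (c h)) (Cnorm_le1 gr).
lra.
Qed.

Lemma mul_near g h : near1 r g -> near1 r h -> `|c g| + 2 * `|c h| < r ->
  near1 r (g * h)%g.
Proof.
move=> gr hr lt; have [d _] := mul_expand gr hr; split=> //.
exact: le_lt_trans (mul_norm_le gr hr) lt.
Qed.

Lemma mul_dist_l g h h' : near1 r g -> near1 r h -> near1 r h' ->
  `|c (g * h)%g - c (g * h')%g| <= 2 * `|c h - c h'|.
Proof.
move=> gr hr hr'; have [_ e _] := est gr hr hr'.
rewrite -[X in `|X|](subrK (c h - c h')) (le_trans (ler_normD _ _))//.
have := ler_wpM2r (normr_ge0 (c h - c h')) (Cnorm_le1 gr).
lra.
Qed.

Lemma mul_dist_r g h h' : near1 r g -> near1 r h -> near1 r h' ->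
  `|c (h * g)%g - c (h' * g)%g| <= (1 + C * `|c g|) * `|c h - c h'|.
Proof.
move=> gr hr hr'; have [_ _ e] := est gr hr hr'.
rewrite -[X in `|X|](subrK (c h - c h')) (le_trans (ler_normD _ _))//.
by rewrite mulrDl mul1r addrC lerD2l.
Qed.

(** Each new factor adds at most 2|c a|, because C|c g| <= 1 near 1; the hypothesis keeps all
    intermediate powers in the chart. *)
Lemma pow_small a k : near1 r a -> 2 * k%:R * `|c a| < r ->
  near1 r (a ^+ k)%g /\ `|c (a ^+ k)%g| <= 2 * k%:R * `|c a|.
Proof.
move=> ar; elim: k => [|k IH] lt.
  by rewrite expg0 centred1 normr0 mulr0 mul0r; split=> //; exact: (near_one1 HL r0).
have na := normr_ge0 (c a).
have lt' : 2 * k%:R * `|c a| + 2 * `|c a| < r.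
  by apply: le_lt_trans lt; rewrite -[k.+1%:R]natr1 mulrDr mulr1 mulrDl.
have [kr kn] : near1 r (a ^+ k)%g /\ `|c (a ^+ k)%g| <= 2 * k%:R * `|c a|.
  by apply: IH; apply: le_lt_trans lt'; rewrite lerDl mulr_ge0.
rewrite expgSr; split.
  apply: mul_near => //; apply: le_lt_trans lt'; by rewrite lerD2r.
apply: (le_trans (mul_norm_le kr ar)).
by rewrite -[k.+1%:R]natr1 mulrDr mulr1 mulrDl lerD2r.
Qed.

(** Passing from the j-th power to the next costs at most C (2j|c a|)|c a|, and these errors sum to
    order k^2 |c a|^2. *)
Lemma pow_linear a k : near1 r a -> 2 * k%:R * `|c a| < r ->
  `|c (a ^+ k)%g - k%:R *: c a| <= 2 * C * (k%:R * `|c a|) ^+ 2.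
Proof.
move=> ar; elim: k => [|k IH] lt.
  by rewrite expg0 centred1 scale0r subr0 normr0 mul0r expr0n mulr0.
have na := normr_ge0 (c a).
have kp : (0 : R) <= k%:R by rewrite ler0n.
have lt' : 2 * k%:R * `|c a| < r.
  by apply: le_lt_trans lt; rewrite ler_wpM2r// ler_wpM2l// ler_nat.
have [kr kn] := pow_small ar lt'.
have [_ e] := mul_expand kr ar.
rewrite expgSr.
have -> : c (a ^+ k * a)%g - k.+1%:R *: c a =
    (c (a ^+ k * a)%g - c (a ^+ k)%g - c a) + (c (a ^+ k)%g - k%:R *: c a).
  by apply/rowP => j; rewrite !mxE -natr1; ring.
apply: (le_trans (ler_normD _ _)).
have e1 : C * `|c (a ^+ k)%g| * `|c a| <= C * (2 * k%:R * `|c a|) * `|c a|.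
  by rewrite ler_wpM2r// ler_wpM2l.
have e2 : 0 <= C * `|c a| ^+ 2 by rewrite mulr_ge0// exprn_ge0.
have -> : 2 * C * (k.+1%:R * `|c a|) ^+ 2 = C * (2 * k%:R * `|c a|) * `|c a| +
   2 * C * (k%:R * `|c a|) ^+ 2 + 2 * (k%:R + 1) * (C * `|c a| ^+ 2).
  by rewrite -natr1; ring.
have e3 : 0 <= 2 * (k%:R + 1) * (C * `|c a| ^+ 2) by rewrite mulr_ge0// mulr_ge0// addr_ge0.
have := IH lt'; lra.
Qed.

(** Changing the last factor costs 2|c a - c b|. The earlier ones are amplified by 1 + C|c b|, which
    over the accumulated 4k|c a - c b| adds 2|c a - c b| more, since 2kC|c b| <= 1. Together this is
    the constant 4. *)
Lemma pow_dist a b k : near1 r a -> near1 r b ->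
  2 * k%:R * `|c a| < r -> 2 * k%:R * `|c b| < r ->
  `|c (a ^+ k)%g - c (b ^+ k)%g| <= 4 * k%:R * `|c a - c b|.
Proof.
move=> ar br; elim: k => [|k IH] lta ltb.
  by rewrite !expg0 subrr normr0 mulr0 mul0r.
have kp : (0 : R) <= k%:R by rewrite ler0n.
have lta' : 2 * k%:R * `|c a| < r.
  by apply: le_lt_trans lta; rewrite ler_wpM2r// ler_wpM2l// ler_nat.
have ltb' : 2 * k%:R * `|c b| < r.
  by apply: le_lt_trans ltb; rewrite ler_wpM2r// ler_wpM2l// ler_nat.
have [akr akn] := pow_small ar lta'; have [bkr bkn] := pow_small br ltb'.
have D1 := mul_dist_l akr ar br.
have D2 := mul_dist_r br akr bkr.
have {}IH := IH lta' ltb'.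
rewrite !expgSr -(subrKA (c (a ^+ k * b)%g)) (le_trans (ler_normD _ _))//.
set d := `|c a - c b| in D1 D2 IH *.
have d0 : 0 <= d by exact: normr_ge0.
have cb0 : 0 <= C * `|c b| by rewrite mulr_ge0.
have e1 : (1 + C * `|c b|) * `|c (a ^+ k)%g - c (b ^+ k)%g| <= (1 + C * `|c b|) * (4 * k%:R * d).
  by rewrite ler_wpM2l// addr_ge0.
have e2 : C * (2 * k%:R * `|c b|) <= 1.
  by apply: le_trans Cr; rewrite ler_wpM2l// ltW.
have e3 : (1 + C * `|c b|) * (4 * k%:R * d) = 4 * k%:R * d + 2 * (C * (2 * k%:R * `|c b|)) * d by ring.
have e4 := ler_wpM2r d0 e2.
rewrite -natr1; lra.
Qed.


Variables (X : 'rV[R]_m) (a : nat -> G).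
Hypotheses (Xr : 16 * `|X| < r) (aX : forall n, chart_dom i1 (a n) /\ c (a n) = (2 ^+ n)^-1 *: X).
Hypothesis onto : forall x : 'rV[R]_m, `|x| < r -> exists2 g, chart_dom i1 g & c g = x.

(** Bounds one dyadic refinement: |X| is the cost of an additional factor [a n.+1], and 4C|X|^2 that
    of replacing each [a n] by the square of [a n.+1], at most 4 * 2^n times. *)
Let K : R := `|X| + 4 * C * `|X| ^+ 2.
Let steps (s : R) n := Num.truncn (s * 2 ^+ n).

Let two_gt0 n : (0 : R) < 2 ^+ n. Proof. exact: exprn_gt0. Qed.

Let X0 : 0 <= `|X|. Proof. exact: normr_ge0. Qed.

Let K0 : 0 <= K. Proof. by rewrite addr_ge0// mulr_ge0// ?exprn_ge0// mulr_ge0. Qed.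

Lemma norm_step n : `|c (a n)| = `|X| / 2 ^+ n.
Proof. by have [_ ->] := aX n; rewrite normrZ ger0_norm ?invr_ge0 ?(ltW (two_gt0 n))// mulrC. Qed.

Lemma step_near n : near1 r (a n).
Proof.
split; first by have [] := aX n.
apply: le_lt_trans Xr; rewrite norm_step ler_pdivrMr ?two_gt0//.
have h : (1 : R) <= 2 ^+ n by apply: exprn_ege1; rewrite ler1n.
have := ler_wpM2l X0 h; have := X0; lra.
Qed.

Lemma steps_le s n : 0 <= s -> (steps s n)%:R / 2 ^+ n <= s.
Proof. by move=> s0; rewrite ler_pdivrMr// truncn_le// mulr_ge0// ltW. Qed.

Lemma steps_gt s n : s - (2 ^+ n)^-1 <= (steps s n)%:R / 2 ^+ n.
Proof.
rewrite ler_pdivlMr// mulrBl mulVf ?gt_eqF// lerBlDr natr1 ltW//.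
exact: truncnS_gt.
Qed.

Lemma step_pow k n (b : R) : b <= 4 -> k%:R / 2 ^+ n <= b ->
  near1 r (a n ^+ k)%g /\ `|c (a n ^+ k)%g| <= 2 * b * `|X|.
Proof.
move=> b4 kb.
have e : 2 * k%:R * `|c (a n)| = 2 * (k%:R / 2 ^+ n) * `|X| by rewrite norm_step; ring.
have h := ler_wpM2r X0 kb.
have h2 := ler_wpM2r X0 b4.
have := @pow_small (a n) k (step_near n); rewrite e => -[|h1 h3].
  have := Xr; have := X0; lra.
by split=> //; apply: le_trans h3 _; lra.
Qed.

Lemma step_pow_linear k n (b : R) : b <= 4 -> k%:R / 2 ^+ n <= b ->
  `|c (a n ^+ k)%g - (k%:R / 2 ^+ n) *: X| <= 2 * C * (b * `|X|) ^+ 2.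
Proof.
move=> b4 kb.
have e : k%:R * `|c (a n)| = (k%:R / 2 ^+ n) * `|X| by rewrite norm_step; ring.
have h := ler_wpM2r X0 kb.
have h2 := ler_wpM2r X0 b4.
have h0 : 0 <= k%:R / 2 ^+ n * `|X| by rewrite mulr_ge0// divr_ge0.
have := @pow_linear (a n) k (step_near n); rewrite -mulrA e (aX n).2 scalerA => /(_ _)/le_trans; apply.
  have := Xr; lra.
by rewrite ler_wpM2l ?mulr_ge0// ler_sqr// nnegrE (le_trans h0).
Qed.

Lemma step_double n : near1 r (a n.+1 ^+ 2)%g /\
  `|c (a n.+1 ^+ 2)%g| <= 2 * `|X| / 2 ^+ n /\
  `|c (a n.+1 ^+ 2)%g - c (a n)| <= C * `|X| ^+ 2 / (4 * (2 ^+ n) ^+ 2).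
Proof.
have aS := step_near n.+1.
have nS : `|c (a n.+1)| = `|X| / (2 * 2 ^+ n) by rewrite norm_step exprS.
have h : 2 * 2%:R * `|c (a n.+1)| = 2 * `|X| / 2 ^+ n.
  by rewrite nS; field; rewrite gt_eqF.
have lt : 2 * 2%:R * `|c (a n.+1)| < r.
  rewrite h ltr_pdivrMr//.
  have h1 : (1 : R) <= 2 ^+ n by apply: exprn_ege1; rewrite ler1n.
  have := ler_wpM2l (ltW r0) h1; have := Xr; have := X0; lra.
have [h1 h2] := @pow_small (a n.+1) 2 aS lt.
split=> //; split; first by rewrite -h.
have [_] := mul_expand aS aS; rewrite -expg2.
have -> : c (a n.+1 ^+ 2)%g - c (a n.+1) - c (a n.+1) = c (a n.+1 ^+ 2)%g - c (a n).
  rewrite !(aX _).2 -addrA -opprD -scalerDl; congr (_ - _ *: _).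
  by rewrite exprS; field; rewrite gt_eqF.
move=> /le_trans; apply; rewrite nS le_eqVlt; apply/orP; left; apply/eqP.
by field; rewrite gt_eqF.
Qed.

Let near1_1 : near1 r 1%g. Proof. exact: (near_one1 HL r0). Qed.

Lemma steps_double s n : 0 <= s -> exists b : bool, steps s n.+1 = (steps s n * 2 + b)%N.
Proof.
move=> s0; rewrite /steps.
have s2 : 0 <= s * 2 ^+ n by rewrite mulr_ge0// ltW.
have [h1 h2] := andP (truncn_itv s2).
set k := Num.truncn (s * 2 ^+ n) in h1 h2 *.
have e : s * 2 ^+ n.+1 = s * 2 ^+ n * 2 by rewrite exprS; ring.
rewrite e; have [lt|ge] := ltP (s * 2 ^+ n * 2) (k * 2).+1%:R.
  exists false; rewrite addn0; apply: truncn_def.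
  by rewrite lt andbT natrM ler_pM2r.
exists true; rewrite addn1; apply: truncn_def; rewrite ge/=.
by move: h2; rewrite -natr1 -!(natr1 _) natrM; lra.
Qed.

Lemma steps_add s t n : 0 <= s -> 0 <= t ->
  exists b : bool, steps (s + t) n = (steps s n + steps t n + b)%N.
Proof.
move=> s0 t0; rewrite /steps mulrDl.
have s2 : 0 <= s * 2 ^+ n by rewrite mulr_ge0// ltW.
have t2 : 0 <= t * 2 ^+ n by rewrite mulr_ge0// ltW.
have [h1 h2] := andP (truncn_itv s2); have [h3 h4] := andP (truncn_itv t2).
set k := Num.truncn (s * 2 ^+ n) in h1 h2 *; set l := Num.truncn (t * 2 ^+ n) in h3 h4 *.
have [lt|ge] := ltP (s * 2 ^+ n + t * 2 ^+ n) (k + l).+1%:R.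
  exists false; rewrite addn0; apply: truncn_def.
  by rewrite lt andbT natrD lerD.
exists true; rewrite addn1; apply: truncn_def; rewrite ge/=.
by move: h2 h4; rewrite -!(natr1 _) natrD; lra.
Qed.

Lemma dist_step n (b : bool) g : near1 r g -> 
  `|c (g * a n ^+ b)%g - c g| <= 2 * `|X| / 2 ^+ n.
Proof.
move=> gr; case: b; last first.
  by rewrite expg0 mulg1 subrr normr0 divr_ge0// mulr_ge0.
rewrite expg1 -{2}[g]mulg1; apply: (le_trans (mul_dist_l gr (step_near n) near1_1)).
by rewrite centred1 subr0 norm_step mulrA.
Qed.

(** The number of steps at level n + 1 is 2k + b with a binary digit b. The square of [a n.+1] is
    within O(4^-n) of [a n], and taking k-th powers multiplies this distance by 4k, of order 2^n.
    The powers of the square need 2k(2|X| / 2^n) < r, which is where 16|X| < r comes from. *)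
Lemma step_dist s n : 0 <= s <= 4 ->
  `|c (a n.+1 ^+ steps s n.+1)%g - c (a n ^+ steps s n)%g| <= K / 2 ^+ n.
Proof.
move=> /andP[s0 s4].
have kn := steps_le n s0.
have [b ->] := steps_double n s0; rewrite expgnDr mulnC expgnA.
set k := steps s n in kn *.
have [d1 [d2 d3]] := step_double n.
have kX : k%:R * `|X| <= 4 * 2 ^+ n * `|X|.
  by rewrite ler_wpM2r// -ler_pdivrMr// (le_trans kn).
have kd : 2 * k%:R * `|c (a n.+1 ^+ 2)%g| < r.
  have e : 2 * k%:R * (2 * `|X| / 2 ^+ n) < r.
    have -> : 2 * k%:R * (2 * `|X| / 2 ^+ n) = 4 * (k%:R / 2 ^+ n) * `|X| by ring.
    by have := ler_wpM2r X0 (le_trans kn s4); have := Xr; have := X0; lra.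
  by apply: le_lt_trans e; rewrite ler_wpM2l// mulr_ge0.
have ka : 2 * k%:R * `|c (a n)| < r.
  rewrite norm_step; have -> : 2 * k%:R * (`|X| / 2 ^+ n) = 2 * (k%:R / 2 ^+ n) * `|X| by ring.
  by have := ler_wpM2r X0 (le_trans kn s4); have := Xr; have := X0; lra.
have [kr _] := pow_small d1 kd.
have e1 := dist_step n.+1 b kr.
have e2 := pow_dist d1 (step_near n) kd ka.
rewrite -(subrKA (c ((a n.+1 ^+ 2) ^+ k)%g)) (le_trans (ler_normD _ _))//.
have e3 : 4 * k%:R * (C * `|X| ^+ 2 / (4 * (2 ^+ n) ^+ 2)) <= 4 * C * `|X| ^+ 2 / 2 ^+ n.
  have -> : 4 * k%:R * (C * `|X| ^+ 2 / (4 * (2 ^+ n) ^+ 2)) = (k%:R / 2 ^+ n) * (C * `|X| ^+ 2 / 2 ^+ n).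
    by field; rewrite gt_eqF.
  have -> : 4 * C * `|X| ^+ 2 / 2 ^+ n = 4 * (C * `|X| ^+ 2 / 2 ^+ n) by ring.
  by rewrite ler_wpM2r ?(le_trans kn)// divr_ge0 ?mulr_ge0 ?exprn_ge0// ltW.
have e4 : 4 * k%:R * `|c (a n.+1 ^+ 2)%g - c (a n)| <= 4 * k%:R * (C * `|X| ^+ 2 / (4 * (2 ^+ n) ^+ 2)).
  by rewrite ler_wpM2l// mulr_ge0.
have e5 : 2 * `|X| / 2 ^+ n.+1 = `|X| / 2 ^+ n by rewrite exprS; field; rewrite gt_eqF.
have -> : K / 2 ^+ n = `|X| / 2 ^+ n + 4 * C * `|X| ^+ 2 / 2 ^+ n by rewrite /K mulrDl.
lra.
Qed.

(** The condition on s stands inside the existential so that [choice] yields a function on all of R;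
    outside [0, 4] its value is 1. *)
Lemma ray_exists s : exists g, 0 <= s <= 4 ->
  [/\ near1 r g, forall n, `|c g - c (a n ^+ steps s n)%g| <= 2 * K / 2 ^+ n &
      `|c g - s *: X| <= 2 * C * (s * `|X|) ^+ 2].
Proof.
have [s4|] := boolP (0 <= s <= 4); last by exists 1%g.
have [l lP] := geometric_limit K0 (fun n => step_dist n s4).
have /andP[s0 s4'] := s4.
have lr : `|l| < r.
  have : `|l| <= 2 * s * `|X|.
    apply: (@le_geometric _ _ _ (2 * K)) => n.
    have [_ h] := step_pow s4' (steps_le n s0).
    rewrite -[l in `|l|](subrK (c (a n ^+ steps s n)%g)) (le_trans (ler_normD _ _))//.
    by rewrite addrC lerD.
  by have := ler_wpM2r X0 s4'; have := Xr; have := X0; lra.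
have [g gd gl] := onto lr; exists g => _; split=> [|n|].
- by split=> //; rewrite gl.
- by rewrite gl.
- rewrite gl; apply: (@le_geometric _ _ _ (2 * K + `|X|)) => n.
  have h := step_pow_linear s4' (steps_le n s0).
  set p := c _ in h; set x := _ / _ in h.
  have -> : l - s *: X = (l - p) + (p - x *: X) + (x - s) *: X.
    by apply/rowP => j; rewrite !mxE; ring.
  have hx : `|(x - s) *: X| <= `|X| / 2 ^+ n.
    rewrite normrZ mulrC ler_wpM2l// ler0_norm; last by rewrite subr_le0 /x steps_le.
    by have := steps_gt s n; rewrite -/x; lra.
  have := ler_normD (l - p + (p - x *: X)) ((x - s) *: X).
  have := ler_normD (l - p) (p - x *: X).
  have := lP n; rewrite -/p mulrDl; lra.
Qed.

(* [ray s] is the limit of [a n ^+ k] with k the integer part of 2^n s. *)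
Lemma half_ray : exists ray : R -> G,
  (forall s, 0 <= s <= 4 -> near1 r (ray s) /\ `|c (ray s) - s *: X| <= 2 * C * (s * `|X|) ^+ 2) /\
  (forall s t, 0 <= s -> 0 <= t -> s + t <= 4 -> ray (s + t) = (ray s * ray t)%g).
Proof.
have [ray rayP] := choice ray_exists.
exists ray; split=> [s s4|s t s0 t0 st]; first by have [] := rayP s s4.
have s4 : 0 <= s <= 4 by rewrite s0/=; lra.
have t4 : 0 <= t <= 4 by rewrite t0/=; lra.
have st4 : 0 <= s + t <= 4 by rewrite addr_ge0.
have [sr sl _] := rayP _ s4; have [tr tl _] := rayP _ t4; have [str stl _] := rayP _ st4.
have d : chart_dom i1 (ray s * ray t)%g by have [] := mul_expand sr tr.
suff e : c (ray (s + t)) = c (ray s * ray t)%g.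
  have [d' _] := str.
  by rewrite -(ch_chartK HG d) -(ch_chartK HG d') -(subrK (chart i1 1%g) (chart i1 (ray (s + t)))) -/(c _) e subrK.
(* Five errors of size 2K / 2^n: one for ray(s + t), and two each for ray s and ray t, as
   multiplication may double a distance. The term 2|X| pays for the carry b in the addition of the
   integer parts. *)
apply: (@eq_geometric _ _ _ _ (10 * K + 2 * `|X|)) => n.
have [b bE] := steps_add n s0 t0.
have {}stl := stl n; have {}sl := sl n; have {}tl := tl n.
have [snr _] := step_pow (andP s4).2 (steps_le n s0).
have [tnr _] := step_pow (andP t4).2 (steps_le n t0).
have hb : (steps s n + steps t n)%:R / 2 ^+ n <= s + t.
  by rewrite natrD mulrDl lerD// steps_le.
have [pr _] := step_pow st hb.
rewrite bE expgnDr expgnDr in stl.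
rewrite expgnDr in pr.
set A := (a n ^+ steps s n)%g in pr sl stl snr *; set B := (a n ^+ steps t n)%g in pr tl stl tnr *.
have e1 := dist_step n b pr.
have e2 := mul_dist_l snr tnr tr.
have e3 := mul_dist_r tr snr sr.
have e4 : (1 + C * `|c (ray t)|) * `|c A - c (ray s)| <= 2 * (2 * K / 2 ^+ n).
  rewrite [X in _ * X]distrC ler_pM// ?addr_ge0// ?mulr_ge0//.
  by have := Cnorm_le1 tr; lra.
have := ler_distD (c (A * B * a n ^+ b)%g) (c (ray (s + t))) (c (ray s * ray t)%g).
have := ler_distD (c (A * B)%g) (c (A * B * a n ^+ b)%g) (c (ray s * ray t)%g).
have := ler_distD (c (A * ray t)%g) (c (A * B)%g) (c (ray s * ray t)%g).
rewrite distrC in tl.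
have -> : (10 * K + 2 * `|X|) / 2 ^+ n = 5 * (2 * K / 2 ^+ n) + 2 * `|X| / 2 ^+ n by ring.
lra.
Qed.

End powers.

Lemma is_derive_quadratic (R : realType) m (f : R -> 'rV[R]_m) (X : 'rV[R]_m) (K : R) :
  (\forall s \near (0 : R), `|f s - f 0 - s *: X| <= K * s ^+ 2) -> is_derive (0 : R) 1 f X.
Proof.
move=> H.
have C : (fun h : R => h^-1 *: (f (h *: 1 + 0) - f 0)) @ (0 : R)^' --> X.
  apply/cvgrPdist_le => e e0.
  have K1 : 0 < `|K| + 1 by rewrite ltr_wpDl.
  have h1 : \forall s \near (0 : R)^', `|s| <= e / (`|K| + 1).
    by apply: dnbhs0_le; rewrite divr_gt0.
  have h2 : \forall s \near (0 : R)^', `|f s - f 0 - s *: X| <= K * s ^+ 2 by exact: nbhs_dnbhs H.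
  have h3 : \forall s \near (0 : R)^', s != 0 by exact: nbhs_dnbhs_neq.
  apply: filterS3 h1 h2 h3 => s a1 a2 s0.
  rewrite addr0 [s *: 1]mulr1.
  have -> : X - s^-1 *: (f s - f 0) = - (s^-1 *: (f s - f 0 - s *: X)).
    by apply/rowP => j; rewrite !mxE; field.
  rewrite normrN normrZ normfV ler_pdivrMl ?normr_gt0//.
  apply: le_trans a2 _; rewrite -[s ^+ 2]real_normK ?num_real//.
  have k1 : K <= `|K| + 1 by rewrite (le_trans (ler_norm K))// lerDl.
  apply: (le_trans (ler_wpM2r (exprn_ge0 _ (normr_ge0 _)) k1)).
  rewrite expr2 mulrCA ler_wpM2l//.
  by move: a1; rewrite ler_pdivlMr// mulrC.
split; first by apply/cvg_ex; exists X.
Transparent derive.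
exact: cvg_lim C.
Opaque derive.
Qed.

(** Samples the difference quotient at the points 1/(k + 1), to be raised afterwards to the power k
    + 1. *)
Lemma is_derive_quotient (R : realType) m (f : R -> 'rV[R]_m) (X : 'rV[R]_m) (P : R -> Prop) (e : R) :
  0 < e -> is_derive (0 : R) 1 f X -> (\forall s \near (0 : R), P s) ->
  exists k : nat, `|k.+1%:R *: (f (k.+1%:R)^-1 - f 0) - X| <= e /\ P (k.+1%:R)^-1.
Proof.
move=> e0 [df fX] nP.
have C : (fun h : R => h^-1 *: (f (h *: 1 + 0) - f 0)) @ (0 : R)^' --> X.
  rewrite -fX.
Transparent derive.
  exact: df.
Opaque derive.
have /nbhs_norm0P[d /= d0 dP] := nP.
have /cvgrPdist_le/(_ e e0)/nbhs_norm0P[d' /= d'0 d'P] := C.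
pose k := Num.truncn (Num.min d d')^-1.
have dd : 0 < Num.min d d' by rewrite lt_min d0.
have kd : (k.+1%:R)^-1 < Num.min d d' :> R.
  by rewrite -[ltRHS]invrK ltf_pV2 ?posrE ?invr_gt0// truncnS_gt.
have kn : `|(k.+1%:R)^-1| = (k.+1%:R)^-1 :> R by rewrite ger0_norm.
move: kd; rewrite lt_min => /andP[kd kd'].
exists k; split; last by apply: dP; rewrite /= kn.
have := d'P (k.+1%:R)^-1; rewrite /= kn => /(_ kd').
rewrite addr0 [_ *: 1]mulr1 invrK distrC; apply.
by rewrite gt_eqF ?invr_gt0.
Qed.

(** The algebra behind [gamD]: a, b, c and d are the values of [ray] at 1, s + 1, t + 1 and s + t +
    1. *)
Lemma mulg_divK (G : groupType) (a b c d : G) : (a * b = b * a -> a * d = b * c ->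
  a^-1 * d = (a^-1 * b) * (a^-1 * c))%g.
Proof.
move=> ab ad; have -> : d = (a^-1 * (b * c))%g by rewrite -ad mulKg.
rewrite !mulgA; congr (_ * c)%g; rewrite -!mulgA; congr (_ * _)%g.
by apply: (can_inj (mulKg a)); rewrite mulVKg mulgA ab mulgK.
Qed.

(** * Existence of one-parameter subgroups and the derivative of the exponential *)

Section exponential.
Context {R : realType} {m : nat} {G : topGroupType} {AG : atlas R m G}.
Hypothesis HL : is_lie_group AG.
Let HG : is_charted AG := manifold_charted (lie_group_manifold HL).
Let i1 := chart_at AG 1%g.
Local Notation c := (centred (AG:=AG)).
Local Notation near1 := (near_one (AG:=AG)).

Lemma chart_centred g : chart i1 g = c g + chart i1 1%g.
Proof. by rewrite /centred subrK. Qed.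

Lemma near_centred (P : G -> Prop) : (\forall g \near (1 : G)%g, P g) ->
  exists2 d : R, 0 < d & forall g, near1 d g -> P g.
Proof.
move=> nP; have /nbhs_ballP[d /= d0 dP] := near_chart_inv HG (ch_dom_at HG 1%g) nP.
exists d => // g [gd cd]; rewrite -(ch_chartK HG gd); apply: dP.
by rewrite -ball_normE /= -normrN opprB.
Qed.

Lemma near_one_near (d : R) : 0 < d -> \forall g \near (1 : G)%g, near1 d g.
Proof.
move=> d0; have d1 := ch_dom_at HG 1%g.
have n1 : \forall u \near chart i1 1%g, `|u - chart i1 1%g| < d.
  by apply/nbhs_ballP; exists d => //= u; rewrite -ball_normE /= -normrN opprB.
by apply: filterS2 (near_chart_dom HG d1) (near_chart HG d1 n1) => g.
Qed.

Section local_subgroup.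
Variables (ray : R -> G) (X : 'rV[R]_m) (K : R).
Hypothesis rayK : forall s, 0 <= s <= 4 ->
  chart_dom i1 (ray s) /\ `|c (ray s) - s *: X| <= K * s ^+ 2.
Hypothesis rayD : forall s t, 0 <= s -> 0 <= t -> s + t <= 4 -> ray (s + t) = (ray s * ray t)%g.

(* Extends [ray] to negative parameters without inverting in the chart. *)
Let gam s := ((ray 1)^-1 * ray (s + 1))%g.

Lemma rayC s t : 0 <= s -> 0 <= t -> s + t <= 4 -> (ray s * ray t = ray t * ray s)%g.
Proof. by move=> s0 t0 st; rewrite -!rayD//; [rewrite addrC|rewrite addrC]. Qed.

Lemma ray0 : ray 0 = 1%g.
Proof.
have := @rayD 0 0 (lexx _) (lexx _); rewrite addr0 => /(_ (ler0n _ 4)).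
by move=> /(congr1 (fun g => (ray 0)^-1 * g)%g); rewrite mulKg mulVg.
Qed.

Lemma gamD s t : -1 <= s <= 1 -> -1 <= t <= 1 -> -1 <= s + t <= 1 ->
  gam (s + t) = (gam s * gam t)%g.
Proof.
move=> /andP[s1 s2] /andP[t1 t2] /andP[u1 u2].
apply: mulg_divK; first by apply: rayC; lra.
rewrite -rayD; [|lra|lra|lra]; rewrite -rayD; [|lra|lra|lra].
by congr ray; ring.
Qed.

Lemma gam_pos s : 0 <= s <= 1 -> gam s = ray s.
Proof.
by move=> /andP[s0 s1]; rewrite /gam addrC rayD ?mulKg//; lra.
Qed.

Lemma gam0 : gam 0 = 1%g.
Proof. by rewrite gam_pos ?lexx ?ler01// ray0. Qed.

Lemma gam_neg s : -1 <= s <= 0 -> gam s = (ray (- s))^-1%g.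
Proof.
move=> /andP[s0 s1]; have := @gamD s (- s); rewrite subrr gam0 (@gam_pos (- s)); last by lra.
move=> e; apply: (can_inj (mulgK (ray (- s)))); rewrite mulVg -e//; lra.
Qed.

(** [gam] is additive only as long as s, t and s + t stay in [-1, 1]. Halving s often enough brings
    it there, and [gamma_def] shows that further halvings do not change the value. *)
Let gamma s := (gam (s / 2 ^+ Num.truncn `|s|) ^+ (2 ^ Num.truncn `|s|))%g.

Let le_two (s : R) k : (Num.truncn `|s| <= k)%N -> -1 <= s / 2 ^+ k <= 1.
Proof.
move=> sk; rewrite -ler_norml normrM normfV [`|2 ^+ k|]ger0_norm ?exprn_ge0//.
rewrite ler_pdivrMr ?exprn_gt0// mul1r ltW// (lt_le_trans (truncnS_gt _))//.
by rewrite -natrX ler_nat (leq_trans _ (ltn_expl k (ltnSn 1)))// ltnS.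
Qed.

Let gamma_def s k : (Num.truncn `|s| <= k)%N -> gamma s = (gam (s / 2 ^+ k) ^+ (2 ^ k))%g.
Proof.
move=> /subnKC <-; elim: (k - _)%N => [|j IH]; first by rewrite addn0.
have l1 := @le_two s (Num.truncn `|s| + j) (leq_addr _ _).
have l2 := @le_two s (Num.truncn `|s| + j.+1) (leq_addr _ _).
rewrite IH addnS expnS expgnA expg2.
have e : s / 2 ^+ (Num.truncn `|s| + j) = s / 2 ^+ (Num.truncn `|s| + j).+1 + s / 2 ^+ (Num.truncn `|s| + j).+1.
  by rewrite exprS; field; rewrite expf_eq0 pnatr_eq0 andbF.
rewrite addnS in l2.
by rewrite e gamD// -e.
Qed.

Let gammaD s t : gamma (s + t) = (gamma s * gamma t)%g.
Proof.
pose k := maxn (Num.truncn `|s + t|) (maxn (Num.truncn `|s|) (Num.truncn `|t|)).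
have ks : (Num.truncn `|s| <= k)%N by rewrite !leq_max leqnn orbT.
have kt : (Num.truncn `|t| <= k)%N by rewrite !leq_max leqnn !orbT.
have kst : (Num.truncn `|(s + t)%R : R| <= k)%N by rewrite !leq_max leqnn.
rewrite (gamma_def ks) (gamma_def kt) (gamma_def kst) mulrDl.
have l1 := le_two ks; have l2 := le_two kt; have l3 := le_two kst; rewrite mulrDl in l3.
rewrite gamD// expgMn// /commute -gamD// addrC gamD// addrC//.
Qed.

Let gamma_local s : `|s| < 1 -> gamma s = gam s.
Proof.
move=> s1; have -> : gamma s = (gam (s / 2 ^+ 0) ^+ (2 ^ 0))%g.
  by apply: gamma_def; rewrite (@truncn_def _ `|s| 0%N)// normr_ge0.
by rewrite expr0 divr1 expn0 expg1.
Qed.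

Let ray_near (d : R) : 0 < d -> \forall s \near (0 : R), near1 d (ray `|s|).
Proof.
move=> d0.
have b0 : 0 < `|X| + 4 * `|K| + 1 by rewrite ltr_wpDl// addr_ge0// mulr_ge0.
have e0 : 0 < Num.min 4 (d / (`|X| + 4 * `|K| + 1)) by rewrite lt_min ltr0n divr_gt0.
apply/nbhs_norm0P; exists (Num.min 4 (d / (`|X| + 4 * `|K| + 1))) => //.
move=> s /=; rewrite lt_min ltr_pdivlMr// => /andP[s4 sd].
have [dom h] := @rayK `|s| (introT andP (conj (normr_ge0 s) (ltW s4))).
split=> //; rewrite -[c _](subrK (`|s| *: X)) (le_lt_trans (ler_normD _ _))//.
apply: le_lt_trans sd; rewrite normrZ normr_id.
have k1 : K * `|s| ^+ 2 <= `|K| * (4 * `|s|).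
  rewrite (le_trans (ler_wpM2r (exprn_ge0 _ (normr_ge0 _)) (ler_norm K)))//.
  by rewrite ler_wpM2l// expr2 ler_wpM2r// ltW.
have s0 := normr_ge0 s.
lra.
Qed.

Let gamma_sign s : `|s| < 1 -> gamma s = ray `|s| \/ gamma s = (ray `|s|)^-1%g.
Proof.
move=> s1; rewrite gamma_local//; move: (s1); rewrite ltr_norml => /andP[h1 h2].
have [s0|s0] := leP 0 s; [left|right].
  by rewrite gam_pos ?ger0_norm//; lra.
by rewrite gam_neg ?ltr0_norm//; lra.
Qed.

Let near_small : \forall s \near (0 : R), `|s| < 1.
Proof. by apply/nbhs_norm0P; exists 1 => /=. Qed.

Let gamma0 : gamma 0 = 1%g.
Proof. by rewrite gamma_local ?normr0// gam0. Qed.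

Let gamma_cts0 : {for (0 : R), continuous gamma}.
Proof.
move=> U; rewrite gamma0 => U1; rewrite /nbhs /=.
have invc : {for (1%g : G), continuous (fun g : G => (g^-1)%g)} by exact: (lie_group_inv HL).1.
(* At negative parameters [gamma] is the inverse of a point of the ray, so the inverse must be close
   to 1 as well. *)
have U1' : \forall g \near (1%g : G), U g^-1%g by apply: invc; rewrite invg1.
have [d d0 dP] := near_centred (filterI U1 U1').
apply: filterS2 (ray_near d0) near_small => s /dP[h1 h2] s1.
by change (U (gamma s)); have [->|->] := gamma_sign s1.
Qed.

Let gamma_cts : continuous gamma.
Proof.
move=> s U Us.
have mc : {for (1%g : G), continuous (fun g : G => (gamma s * g)%g)}.
  exact: (smooth_mull HL (gamma s) 1%g).1.
have n1 : \forall g \near (1%g : G), U (gamma s * g)%g by apply: mc; rewrite mulg1.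
have n2 : \forall t \near (0 : R), U (gamma s * gamma t)%g by move: gamma_cts0; rewrite /prop_for /continuous_at gamma0 => /(_ _ n1).
have /nbhs_norm0P[d /= d0 dP] := n2.
apply/nbhs_normP; exists d => //= t; rewrite /= -normrN opprB => td.
have := dP (t - s) td; rewrite -gammaD addrC subrK.
exact.
Qed.

(** For s >= 0 the bound is that of the ray. For s < 0 the product of gamma(s) and ray(|s|) is 1,
    and the product estimate gives c(gamma s) = - c(ray |s|) + O(s^2). *)
Let gamma_derive (C r : R) : 0 < r -> 0 <= C -> C * r <= 1 ->
  (forall g h, near1 r g -> near1 r h -> `|c (g * h)%g - c g - c h| <= C * `|c g| * `|c h|) ->
  is_derive (0 : R) 1 (chart i1 \o gamma) X.
Proof.
move=> r0 C0 Cr est.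
(* Within r / 2 one has C|y| <= 1/2, so that C|x||y| can be absorbed into |x| to obtain |x| <=
   2|y|. *)
have r20 : 0 < r / 2 by rewrite divr_gt0.
have nr : \forall s \near (0 : R), near1 (r / 2) (gamma s).
  by apply: gamma_cts0; rewrite gamma0; exact: near_one_near.
have gK : \forall s \near (0 : R), `|c (gamma s) - s *: X| <=
    (`|K| + 2 * C * (`|X| + `|K|) ^+ 2) * s ^+ 2.
  apply: filterS2 near_small (filterI nr (ray_near r20)) => s s1 [gr rr].
  have [dom h] := @rayK `|s| (introT andP (conj (normr_ge0 s) (ltW (lt_trans s1 (ltr_nat R 1 4))))).
  have S0 := normr_ge0 s.
  have S2 : `|s| ^+ 2 = s ^+ 2 by rewrite real_normK// num_real.
  have S3 : `|s| ^+ 2 <= `|s| by rewrite expr2 ler_piMl// ltW.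
  have K0 := normr_ge0 K.
  have KK : K * `|s| ^+ 2 <= `|K| * s ^+ 2 by rewrite S2 ler_wpM2r ?ler_norm// exprn_even_ge0.
  have rn : `|c (ray `|s|)| <= (`|X| + `|K|) * `|s|.
    rewrite -[c _](subrK (`|s| *: X)) (le_trans (ler_normD _ _))// normrZ normr_id.
    by have := ler_wpM2l K0 S3; rewrite S2; lra.
  have q0 : 0 <= 2 * C * (`|X| + `|K|) ^+ 2 * s ^+ 2.
    by rewrite mulr_ge0 ?exprn_even_ge0// mulr_ge0 ?mulr_ge0// exprn_ge0// addr_ge0.
  rewrite mulrDl.
  have [s0|s0] := leP 0 s.
    have es : `|s| = s by rewrite ger0_norm.
    have -> : gamma s = ray `|s|.
      by rewrite gamma_local// es gam_pos// s0 -es ltW.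
    by rewrite es in h KK *; lra.
  have es : `|s| = - s by rewrite ltr0_norm.
  have gE : gamma s = (ray `|s|)^-1%g.
    rewrite gamma_local// es gam_neg//; move: s1; rewrite es; lra.
  have w g : near1 (r / 2) g -> near1 r g by move=> [? ?]; split=> //; lra.
  have := est _ _ (w _ gr) (w _ rr); rewrite {1}gE mulVg centred1 sub0r.
  set x := c (gamma s); set y := c _ => e.
  have Cy : C * `|y| <= 1 / 2.
    by have := ler_wpM2l C0 (ltW rr.2); rewrite -/y; lra.
  have y0 := normr_ge0 y; have x0 := normr_ge0 x.
  have xy : `|x| <= 2 * `|y|.
    have e1 := ler_wpM2l x0 Cy.
    have xe : x = - (- x - y) - y by apply/rowP => j; rewrite !mxE; ring.
    by have := ler_normB (- (- x - y)) y; rewrite -xe normrN; lra.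
  have e2 : C * `|x| * `|y| <= 2 * C * (`|X| + `|K|) ^+ 2 * s ^+ 2.
    have -> : 2 * C * (`|X| + `|K|) ^+ 2 * s ^+ 2 = C * (2 * ((`|X| + `|K|) * `|s|)) * ((`|X| + `|K|) * `|s|).
      by rewrite -S2; ring.
    rewrite ler_pM ?mulr_ge0// ler_wpM2l// (le_trans xy)// ler_wpM2l//.
  have -> : x - s *: X = - (- x - y) - (y - `|s| *: X).
    by rewrite es; apply/rowP => j; rewrite !mxE; ring.
  rewrite (le_trans (ler_normB _ _))// normrN; lra.
apply: (is_derive_quadratic (K := `|K| + 2 * C * (`|X| + `|K|) ^+ 2)).
apply: filterS gK => s; rewrite /= gamma0; exact.
Qed.

Lemma ray_one_parameter (C r : R) : 0 < r -> 0 <= C -> C * r <= 1 ->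
  (forall g h, near1 r g -> near1 r h -> `|c (g * h)%g - c g - c h| <= C * `|c g| * `|c h|) ->
  exists gamma, one_parameter_subgroup AG X gamma.
Proof.
move=> r0 C0 Cr est; exists gamma; split; [exact: gamma_cts|exact: gammaD|].
exact: gamma_derive r0 C0 Cr est.
Qed.

End local_subgroup.

Section small.
Variables (r C : R).
Hypotheses (r0 : 0 < r) (C0 : 0 <= C) (Cr : C * r <= 1).
Hypothesis onto : forall x : 'rV[R]_m, `|x| < r -> exists2 g, chart_dom i1 g & c g = x.
Hypothesis est : forall g h h', near1 r g -> near1 r h -> near1 r h' ->
  [/\ chart_dom i1 (g * h)%g,
      `|c (g * h)%g - c (g * h')%g - (c h - c h')| <= C * `|c g| * `|c h - c h'| &
      `|c (h * g)%g - c (h' * g)%g - (c h - c h')| <= C * `|c g| * `|c h - c h'|].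

Lemma small_one_parameter X : 16 * `|X| < r -> exists gamma, one_parameter_subgroup AG X gamma.
Proof.
move=> Xr.
have Hn n : exists g, chart_dom i1 g /\ c g = (2 ^+ n)^-1 *: X.
  have [|g g1 g2] := onto (x := (2 ^+ n)^-1 *: X); last by exists g.
  rewrite normrZ ger0_norm ?invr_ge0 ?exprn_ge0// mulrC.
  have n0 := normr_ge0 X.
  apply: le_lt_trans (_ : `|X| < r); last by lra.
  by rewrite ler_pdivrMr ?exprn_gt0// ler_peMr// exprn_ege1// ler1n.
have [a aP] := choice Hn.
have [ray [h1 h2]] := half_ray HL r0 C0 Cr est Xr aP onto.
apply: (ray_one_parameter (ray := ray) (K := 2 * C * `|X| ^+ 2) _ h2 r0 C0 Cr).
  move=> s /h1[[d _] e]; split=> //; apply: le_trans e _.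
  by rewrite exprMn [s ^+ 2 * _]mulrC !mulrA.
by move=> g h gr hr; have [] := mul_expand HL r0 est gr hr.
Qed.

(* Read off from gamma 1 = gamma (1/k)^k as k grows.  Being uniform in the
   subgroup, this makes the uniqueness of [gamma] unnecessary for
   differentiating [lie_exp] at 0. *)
Lemma one_parameter_chart X gamma : 4 * `|X| < r -> one_parameter_subgroup AG X gamma ->
  `|c (gamma 1) - X| <= 2 * C * `|X| ^+ 2 /\ `|c (gamma 1)| <= 2 * `|X| /\ near1 r (gamma 1).
Proof.
move=> Xr [gc gD gX].
have g0 : gamma 0 = 1%g.
  have := gD 0 0; rewrite addr0.
  by move=> /(congr1 (fun g => (gamma 0)^-1 * g)%g); rewrite mulKg mulVg.
have gk (k : nat) x : gamma (k%:R * x) = (gamma x ^+ k)%g.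
  elim: k => [|k IH]; first by rewrite mul0r g0 expg0.
  by rewrite -natr1 mulrDl mul1r gD IH expgSr.
have nd : \forall s \near (0 : R), chart_dom i1 (gamma s).
  have n1 : \forall g \near (1%g : G), chart_dom i1 g by exact: near_chart_dom (ch_dom_at HG _).
  have gc0 : {for (0 : R), continuous gamma} by exact: gc.
  by move: gc0; rewrite /prop_for /continuous_at g0 => /(_ _ n1).
have X0 := normr_ge0 X.
(* The precision asked of the difference quotient. With |X| < r / 4 and e n <= r / 8 one gets 2(|X|
   + e n) < r, as [pow_small] requires. *)
pose e n := r / 8 / 2 ^+ n.
have e0 n : 0 < e n by rewrite divr_gt0 ?exprn_gt0// divr_gt0.
have er n : e n <= r / 8.
  by rewrite ler_pdivrMr ?exprn_gt0// ler_peMr ?exprn_ege1 ?ler1n// divr_ge0// ltW.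
have H n : near1 r (gamma 1) /\ `|c (gamma 1)| <= 2 * `|X| + 2 * e n /\
    `|c (gamma 1) - X| <= e n + 2 * C * (`|X| + e n) ^+ 2.
  have [k [h d]] := is_derive_quotient (e0 n) gX nd.
  move: h; rewrite /= g0 -/(c _); set v := gamma _ in d *; move=> h.
  have v1 : gamma 1 = (v ^+ k.+1)%g by rewrite -gk mulfV// pnatr_eq0.
  have kv : k.+1%:R * `|c v| <= `|X| + e n.
    have -> : k.+1%:R * `|c v| = `|(k.+1%:R *: c v - X) + X|.
      by rewrite subrK normrZ ger0_norm.
    by rewrite (le_trans (ler_normD _ _))// addrC lerD.
  have en := er n.
  have vr : near1 r v.
    split=> //; apply: le_lt_trans (_ : `|X| + e n < r); last by lra.
    by apply: le_trans kv; rewrite ler_peMl// ler1n.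
  have lt : 2 * k.+1%:R * `|c v| < r by rewrite -mulrA; lra.
  have [p1 p2] := pow_small HL r0 C0 Cr est vr lt.
  have p3 := pow_linear HL r0 C0 Cr est vr lt.
  rewrite -v1 in p1 p2 p3.
  split=> //; split; first by apply: (le_trans p2); rewrite -mulrA; lra.
  rewrite -(subrKA (k.+1%:R *: c v)) (le_trans (ler_normD _ _))// addrC lerD//.
  apply: (le_trans p3); rewrite ler_wpM2l ?mulr_ge0// ler_sqr// nnegrE ?mulr_ge0//.
  by rewrite addr_ge0// ltW.
split; last first.
  split; last by have [] := H 0%N.
  apply: (@le_geometric _ _ _ (r / 4)) => n; have [_ [h _]] := H n.
  by apply: (le_trans h); rewrite /e; lra.
apply: (@le_geometric _ _ _ (r / 8 + 2 * C * (2 * `|X| * (r / 8) + (r / 8) ^+ 2))) => n.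
have [_ [_ h]] := H n; apply: (le_trans h).
have q : (e n) ^+ 2 <= (r / 8) ^+ 2 / 2 ^+ n.
  have -> : (r / 8) ^+ 2 / 2 ^+ n = (r / 8) * e n by rewrite /e; ring.
  by rewrite expr2 ler_wpM2r// ltW.
have C2 : 0 <= 2 * C by rewrite mulr_ge0.
have := ler_wpM2l C2 q.
rewrite /e; lra.
Qed.

End small.

Lemma lie_exp_one_parameter X : (exists gamma, one_parameter_subgroup AG X gamma) ->
  exists2 gamma, one_parameter_subgroup AG X gamma & lie_exp AG X = gamma 1.
Proof.
move=> ex; rewrite /lie_exp.
by case: xgetP => [g _ gP|/(_ _) no]; [exists g|have [g /no] := ex].
Qed.

(** One-parameter subgroups have been obtained for small velocities, and s X is small near s = 0.
    The value at 0 comes from the bound |c| <= 2|Y| for Y = 0. *)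
Lemma is_derive_lie_exp X : (\forall s \near (0 : R), chart_dom i1 (lie_exp AG (s *: X))) /\
  lie_exp AG 0 = 1%g /\ is_derive (0 : R) 1 (fun s => chart i1 (lie_exp AG (s *: X))) X.
Proof.
have [r [C [r0 C0 Cr onto est]]] := product_estimate HL.
have E Y : 16 * `|Y| < r -> `|c (lie_exp AG Y) - Y| <= 2 * C * `|Y| ^+ 2 /\
    `|c (lie_exp AG Y)| <= 2 * `|Y| /\ near1 r (lie_exp AG Y).
  move=> Yr.
  have [g gP ->] := lie_exp_one_parameter (small_one_parameter r0 C0 Cr onto est Yr).
  apply: one_parameter_chart => //.
  by have := normr_ge0 Y; lra.
have nX : \forall s \near (0 : R), 16 * `|s *: X| < r.
  have x1 : 0 < 16 * `|X| + 1 by rewrite ltr_wpDl// mulr_ge0.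
  apply/nbhs_norm0P; exists (r / (16 * `|X| + 1)) => /=; first by rewrite divr_gt0.
  move=> s /=; rewrite ltr_pdivlMr// normrZ; have := normr_ge0 s; lra.
have e0 : lie_exp AG 0 = 1%g.
  have [|_ [h [d _]]] := E 0; first by rewrite normr0 mulr0.
  move: h; rewrite normr0 mulr0 normr_le0 => /eqP h.
  rewrite -(ch_chartK HG d) chart_centred h add0r (ch_chartK HG)//.
  exact: ch_dom_at.
split; first by apply: filterS nX => s /E[_ [_ []]].
split=> //; apply: (is_derive_quadratic (K := 2 * C * `|X| ^+ 2)).
apply: filterS nX => s /E[h _]; rewrite scale0r e0 -/(c _); apply: (le_trans h).
by rewrite normrZ exprMn real_normK ?num_real// [s ^+ 2 * _]mulrC mulrA.
Qed.

End exponential.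

(** From here on fundamental fields are tangent maps of orbit maps, to which the calculus of related
    fields applies. *)
Lemma fundamentalE (R : realType) (m n : nat) (G : topGroupType) (M : topologicalType)
    (AG : atlas R m G) (AM : atlas R n M) (sigma : G -> M -> M) :
  is_lie_group AG -> is_charted AM -> is_smooth_action AG AM sigma ->
  forall X p, fundamental AG AM sigma X p = act_field AG AM sigma X p.
Proof.
move=> HL HM Hs X p.
have HG := manifold_charted (lie_group_manifold HL).
have [nd [e0 de]] := is_derive_lie_exp HL X.
have so := smooth_orbit HL HM Hs p 1%g.
have s1 : sigma 1%g p = p by case: Hs.
pose i1 := chart_at AG 1%g; pose j := chart_at AM p.
have d1 : chart_dom i1 1%g by exact: ch_dom_at.
have dj : chart_dom j (sigma 1%g p) by rewrite s1; exact: ch_dom_at.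
have sF := so.2 i1 j d1 dj.
set f := fun s => chart i1 _ in de.
have f0 : f 0 = chart i1 1%g by rewrite /f scale0r e0.
rewrite /fundamental.
have -> : 'D_1 (fun s : R => chart j (sigma (lie_exp AG (s *: X)) p)) 0 =
   'D_1 (fun s : R => locmap (A:=AG) (B:=AM) i1 j (fun h => sigma h p) (f s)) 0.
  apply: near_eq_derive => //; apply: filterS nd => s ds.
  by rewrite /locmap /f /= (ch_chartK HG).
have [df fX] := de.
rewrite derive_comp; last 2 first.
- exact/derivable1_diffP.
- by rewrite f0; exact: smooth_at_differentiable.
rewrite f0 fX /act_field tangent_mapE s1 /Jloc deriveEjacobian//.
exact: smooth_at_differentiable.
Qed.

(** * Schouten brackets of frames *)

Section cyclic_sums.
Context {R : comPzRingType} {m n : nat}.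
Variables (t : 'M[R]_m) (X : 'I_m -> 'I_n -> R) (P : 'M[R]_n).
Variables (dX : 'I_m -> 'I_n -> 'I_n -> R) (dP : 'I_n -> 'I_n -> 'I_n -> R).
Hypotheses (t_skew : t^T = - t) (P_skew : P^T = - P).

Let tC i j : t j i = - t i j.
Proof. by have /matrixP/(_ i j) := t_skew; rewrite !mxE. Qed.

Let PC a b : P b a = - P a b.
Proof. by have /matrixP/(_ a b) := P_skew; rewrite !mxE. Qed.

Let F1 a b c := \sum_i \sum_j t i j * ((\sum_l dX i l a * P l c) * X j b).
Let F2 a b c := \sum_i \sum_j t i j * (X i a * \sum_l dX j l b * P l c).
Let F3 a b c := \sum_i \sum_j t i j * ((\sum_l X i l * dP l a b) * X j c).

Let lie i a b := \sum_l (X i l * dP l a b) - \sum_l (dX i l a * P l b) - \sum_l (P a l * dX i l b).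

(* Each of the terms of the Schouten bracket with sum_ij t_ij X_i (x) X_j
   reappears, after a cyclic permutation of the indices, in the Lie
   derivatives. *)
Lemma schouten_lie_sum a b c :
  let S a b c := \sum_l ((\sum_i \sum_j t i j * (dX i l a * X j b + X i a * dX j l b)) * P l c
     + dP l a b * (\sum_i \sum_j t i j * (X i l * X j c))) in
  let L a b c := \sum_i \sum_j t i j * (lie i a b * X j c) in
  S a b c + S b c a + S c a b = L a b c + L b c a + L c a b.
Proof.
move=> S L.
have SE a' b' c' : S a' b' c' = F1 a' b' c' + F2 a' b' c' + F3 a' b' c'.
  rewrite /S big_split /=; congr (_ + _).
    rewrite /F1 /F2 -big_split /=.
    under eq_bigr do rewrite big_distrl /=.
    rewrite exchange_big /=; apply: eq_bigr => i _.
    under eq_bigr do rewrite big_distrl /=.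
    rewrite exchange_big /= -big_split; apply: eq_bigr => j _ /=.
    rewrite big_distrl !big_distrr -big_split /=; apply: eq_bigr => l _.
    by ring.
  under eq_bigr do rewrite big_distrr /=.
  rewrite exchange_big /=; apply: eq_bigr => i _.
  under eq_bigr do rewrite big_distrr /=.
  rewrite exchange_big /=; apply: eq_bigr => j _.
  rewrite big_distrl big_distrr /=; apply: eq_bigr => l _; ring.
have LE a' b' c' : L a' b' c' = F3 a' b' c' + F2 c' a' b' + F1 b' c' a'.
  have -> : F2 c' a' b' = \sum_i \sum_j - t i j * ((\sum_l dX i l a' * P l b') * X j c').
    rewrite /F2 exchange_big /=; apply: eq_bigr => i _; apply: eq_bigr => j _.
    by rewrite tC [X in _ * X]mulrC.
  have -> : F1 b' c' a' = \sum_i \sum_j - t i j * ((\sum_l P a' l * dX i l b') * X j c').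
    apply: eq_bigr => i _; apply: eq_bigr => j _; rewrite mulNr -mulrN -mulNr; congr (_ * (_ * _)).
    by rewrite -sumrN; apply: eq_bigr => l _; rewrite PC; ring.
  rewrite /L /F3 -!big_split /=; apply: eq_bigr => i _; rewrite -!big_split /=.
  by apply: eq_bigr => j _; rewrite /lie; ring.
rewrite !SE !LE; ring.
Qed.

End cyclic_sums.

Lemma quadratic_mxE {R : comPzRingType} (m n n' : nat) (t : 'M[R]_m) (A : 'M[R]_(m, n)) (B : 'M[R]_(m, n')) a b :
  (A^T *m t *m B) a b = \sum_i \sum_j t i j * (A i a * B j b).
Proof.
rewrite mxE; under eq_bigr do rewrite mxE big_distrl /=.
rewrite exchange_big /=; apply: eq_bigr => i _; apply: eq_bigr => j _.
by rewrite !mxE; ring.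
Qed.

Lemma mx_sub2E {R : zmodType} m n (A B C : 'M[R]_(m, n)) i j :
  (A - B - C) i j = A i j - B i j - C i j.
Proof. by rewrite !mxE. Qed.

Lemma derive_trmx {R : realType} {E : normedModType R} m n (A : E -> 'M[R]_(m, n)) x v :
  smooth_at A x -> 'D_v (fun y => (A y)^T) x = ('D_v A x)^T.
Proof.
move=> sA; apply/matrixP => i j; rewrite [RHS]mxE.
rewrite derive_mxE; last exact/smooth_at_derivable/smooth_at_trmx.
rewrite derive_mxE; last exact: smooth_at_derivable.
by congr ('D_v _ x); apply/funext => y; rewrite mxE.
Qed.

Lemma derive_rowfun {R : realType} {E : normedModType R} m n (A : E -> 'M[R]_(m, n)) i x v :
  smooth_at A x -> 'D_v (fun y => row i (A y)) x = row i ('D_v A x).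
Proof.
move=> sA.
have sr : smooth_at (fun y => row i (A y)) x.
  apply/smooth_at_mxP => k j; move/smooth_at_mxP/(_ i j) : sA.
  by congr smooth_at; apply/funext => y; rewrite mxE.
apply/rowP => j; rewrite [RHS]mxE derive_mxE; last exact: smooth_at_derivable.
rewrite derive_mxE; last exact: smooth_at_derivable.
by congr ('D_v _ x); apply/funext => y; rewrite mxE.
Qed.

Lemma derive_quadratic {R : realType} {E : normedModType R} m n (t : 'M[R]_m)
    (F : E -> 'M[R]_(m, n)) x v : smooth_at F x ->
  'D_v (fun y => (F y)^T *m t *m F y) x =
    ('D_v F x)^T *m t *m F x + (F x)^T *m t *m 'D_v F x.
Proof.
move=> sF; have sT := smooth_at_trmx sF.
have st : smooth_at (fun=> t : 'M[R]_m) x by exact: smooth_at_cst.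
rewrite (derive_mulmx v (smooth_at_mulmx sT st) sF); congr (_ *m _ + _).
rewrite (derive_mulmx v sT st) derive_cst mulmx0 addr0; congr (_ *m _).
exact: derive_trmx.
Qed.

Section local_frames.
Context {R : realType} {n : nat}.
Implicit Types (P Q : 'rV[R]_n -> 'M[R]_n) (X : 'rV[R]_n -> 'rV[R]_n).

Definition local_schouten P Q u (a b c : 'I_n) : R :=
  let term a b c :=
    \sum_l (partial l Q u a b * P u l c + partial l P u a b * Q u l c) in
  term a b c + term b c a + term c a b.

(** The Lie derivative of a bivector field in coordinates; row l of ['J X u] is the derivative of X
    along the l-th coordinate. *)
Definition local_lie X P u : 'M[R]_n :=
  'D_(X u) P u - ('J X u)^T *m P u - P u *m 'J X u.

Lemma local_schouten_frame m (t : 'M[R]_m) (F : 'rV[R]_n -> 'M[R]_(m, n)) P u a b c :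
  t^T = - t -> (P u)^T = - P u -> smooth_at F u -> smooth_at P u ->
  let L a b c := \sum_i \sum_j t i j * (local_lie (fun v => row i (F v)) P u a b * F u j c) in
  local_schouten P (fun v => (F v)^T *m t *m F v) u a b c = L a b c + L b c a + L c a b.
Proof.
move=> tS PS sF sP L.
have := schouten_lie_sum (fun i a => F u i a) (fun i l a => 'D_(delta_mx 0 l) F u i a)
  (fun l a b => 'D_(delta_mx 0 l) P u a b) tS PS a b c.
have LE a' b' c' : L a' b' c' = \sum_i \sum_j t i j *
    ((\sum_l (F u i l * 'D_(delta_mx 0 l) P u a' b') - \sum_l ('D_(delta_mx 0 l) F u i a' * P u l b')
      - \sum_l (P u a' l * 'D_(delta_mx 0 l) F u i b')) * F u j c').
  apply: eq_bigr => i _; apply: eq_bigr => j _; congr (_ * (_ * _)).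
  have sr : smooth_at (fun v => row i (F v)) u.
    apply/smooth_at_mxP => k l; move/smooth_at_mxP/(_ i l) : sF.
    by congr smooth_at; apply/funext => y; rewrite mxE.
  have JE l k : 'J (fun v => row i (F v)) u l k = 'D_(delta_mx 0 l) F u i k.
    have := row_jacobian l (smooth_at_differentiable sr).
    by rewrite derive_rowfun// => /rowP/(_ k); rewrite !mxE.
  rewrite /local_lie derive_rowE; last exact: smooth_at_differentiable.
  rewrite mx_sub2E; congr (_ - _ - _).
  - by rewrite summxE; apply: eq_bigr => l _; rewrite !mxE.
  - by rewrite mxE; apply: eq_bigr => l _; rewrite mxE JE.
  - by rewrite [LHS]mxE; apply: eq_bigr => l _; rewrite JE.
rewrite !LE => <-; rewrite /local_schouten /partial.
have TE a' b' c' : \sum_l ('D_(delta_mx 0 l) (fun v => (F v)^T *m t *m F v) u a' b' * P u l c' +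
    'D_(delta_mx 0 l) P u a' b' * ((F u)^T *m t *m F u) l c') =
  \sum_l ((\sum_i \sum_j t i j * ('D_(delta_mx 0 l) F u i a' * F u j b' +
      F u i a' * 'D_(delta_mx 0 l) F u j b')) * P u l c' +
    'D_(delta_mx 0 l) P u a' b' * (\sum_i \sum_j t i j * (F u i l * F u j c'))).
  apply: eq_bigr => l _; rewrite quadratic_mxE derive_quadratic// [X in X * _]mxE.
  rewrite !quadratic_mxE -big_split /=; congr (_ * _ + _); apply: eq_bigr => i _.
  by rewrite -big_split; apply: eq_bigr => j _ /=; rewrite mulrDr.
by rewrite !TE.
Qed.

(** Leibniz's rule: the rows of [B] are the brackets of X with the fields of the frame. *)
Lemma local_lie_frame m (t : 'M[R]_m) (F : 'rV[R]_n -> 'M[R]_(m, n)) X u :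
  smooth_at F u ->
  let B := 'D_(X u) F u - F u *m 'J X u in
  local_lie X (fun v => (F v)^T *m t *m F v) u = B^T *m t *m F u + (F u)^T *m t *m B.
Proof.
move=> sF B; rewrite /local_lie derive_quadratic// /B.
set D := 'D_(X u) F u; set J := 'J X u; set f := F u.
rewrite linearB /= trmx_mul !mulmxBl mulmxBr !mulmxA.
move: (D^T *m t *m f) (f^T *m t *m D) (J^T *m f^T *m t *m f) (f^T *m t *m f *m J) => w x y z.
by apply/matrixP => i j; rewrite !mxE; ring.
Qed.

End local_frames.

Section frames.
Context {R : realType} {n : nat} {M : topologicalType} {A : atlas R n M}.
Hypothesis HA : is_charted A.

Definition frame m (X : 'I_m -> M -> 'rV[R]_n) (p : M) : 'M[R]_(m, n) := \matrix_i X i p.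

Definition frame2 m (t : 'M[R]_m) (X : 'I_m -> M -> 'rV[R]_n) (p : M) : 'M[R]_n :=
  (frame X p)^T *m t *m frame X p.

Let frame_in i m (X : 'I_m -> M -> 'rV[R]_n) u : 'M[R]_(m, n) := \matrix_k vector_in (A:=A) i (X k) u.

Let row_frame_in i m (X : 'I_m -> M -> 'rV[R]_n) k :
  (fun u => row k (frame_in i X u)) = vector_in (A:=A) i (X k).
Proof. by apply/funext => u; exact: rowK. Qed.

Lemma bivector_in_frame2 (i : chart_index A) m (t : 'M[R]_m) X :
  bivector_in i (frame2 t X) = fun u => (frame_in i X u)^T *m t *m frame_in i X u.
Proof.
apply/funext => u; rewrite /bivector_in /frame2.
have -> : frame_in i X u = frame X (chart_inv i u) *m to_chart i u.
  by apply/row_matrixP => k; rewrite row_mul !rowK.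
by rewrite trmx_mul !mulmxA.
Qed.

Lemma smooth_frame_in (i : chart_index A) m (X : 'I_m -> M -> 'rV[R]_n) p :
  (forall k, smooth_field_at A (X k) p) -> chart_dom i p -> smooth_at (frame_in i X) (chart i p).
Proof.
move=> sX ip; apply/smooth_at_mxP => k l.
have /smooth_at_mxP/(_ 0 l) := sX k i ip.
by congr smooth_at; apply/funext => u; rewrite !mxE.
Qed.

Lemma frame2_2vector m (t : 'M[R]_m) (X : 'I_m -> M -> 'rV[R]_n) : t^T = - t ->
  (forall k p, smooth_field_at A (X k) p) -> is_2vector_field A (frame2 t X).
Proof.
move=> tS sX; split=> [p|i].
  by rewrite /skew_mx /frame2 !trmx_mul trmxK tS mulNmx mulmxN mulmxA.
rewrite bivector_in_frame2; apply: smooth_at_on => _ [p ip <-].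
have sF := smooth_frame_in (sX ^~ p) ip.
by apply: smooth_at_mulmx => //; apply: smooth_at_mulmx; [exact: smooth_at_trmx|exact: smooth_at_cst].
Qed.

Lemma vector_in_chart_at X p :
  vector_in (A:=A) (chart_at A p) X (chart (chart_at A p) p) = X p.
Proof. by rewrite (vector_inE HA)// ?(Jloc_id HA) ?mulmx1//; exact: ch_dom_at. Qed.

Definition bivector_lie X P p : 'M[R]_n :=
  local_lie (vector_in (A:=A) (chart_at A p) X) (bivector_in (A:=A) (chart_at A p) P)
    (chart (chart_at A p) p).

Lemma bivector_in_chart_at P p :
  bivector_in (A:=A) (chart_at A p) P (chart (chart_at A p) p) = P p.
Proof.
by rewrite (bivector_inE HA)// ?(Jloc_id HA) ?mulmx1 ?trmx1 ?mul1mx//; exact: ch_dom_at.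
Qed.

Lemma smooth_bivector_in P i p : is_2vector_field A P -> chart_dom i p ->
  smooth_at (bivector_in (A:=A) i P) (chart i p).
Proof.
move=> [_ sP] ip; apply: smooth_on_at (sP i); [exact: ch_img_open|exact: chart_img_chart].
Qed.

Lemma schouten_frame2 P m (t : 'M[R]_m) (X : 'I_m -> M -> 'rV[R]_n) p a b c :
  is_2vector_field A P -> t^T = - t -> (forall k, smooth_field_at A (X k) p) ->
  let L a b c := \sum_i \sum_j t i j * (bivector_lie (X i) P p a b * X j p 0 c) in
  schouten A P (frame2 t X) p a b c = L a b c + L b c a + L c a b.
Proof.
move=> vP tS sX L; have ip := ch_dom_at HA p.
have PS : (bivector_in (A:=A) (chart_at A p) P (chart (chart_at A p) p))^T =
    - bivector_in (A:=A) (chart_at A p) P (chart (chart_at A p) p).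
  by rewrite bivector_in_chart_at; exact: vP.1.
have := local_schouten_frame a b c tS PS (smooth_frame_in sX ip) (smooth_bivector_in vP ip).
rewrite -bivector_in_frame2.
have LE a' b' c' : \sum_i \sum_j t i j * (local_lie (fun v => row i (frame_in (chart_at A p) X v))
     (bivector_in (A:=A) (chart_at A p) P) (chart (chart_at A p) p) a' b' *
   frame_in (chart_at A p) X (chart (chart_at A p) p) j c') = L a' b' c'.
  apply: eq_bigr => i _; apply: eq_bigr => j _.
  by rewrite row_frame_in [frame_in _ _ _ _ _]mxE vector_in_chart_at.
by cbv beta zeta; rewrite !LE => e; exact e.
Qed.

Lemma bivector_lie_frame2 X m (t : 'M[R]_m) (Y : 'I_m -> M -> 'rV[R]_n) p :
  smooth_field_at A X p -> (forall k, smooth_field_at A (Y k) p) ->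
  let B := \matrix_k vector_bracket A X (Y k) p in
  bivector_lie X (frame2 t Y) p = B^T *m t *m frame Y p + (frame Y p)^T *m t *m B.
Proof.
move=> sX sY B; have ip := ch_dom_at HA p.
have sF := smooth_frame_in sY ip.
rewrite /bivector_lie bivector_in_frame2 local_lie_frame//.
have -> : frame_in (chart_at A p) Y (chart (chart_at A p) p) = frame Y p.
  by apply/row_matrixP => k; rewrite !rowK vector_in_chart_at.
suff -> : 'D_(vector_in (A:=A) (chart_at A p) X (chart (chart_at A p) p)) (frame_in (chart_at A p) Y)
    (chart (chart_at A p) p) - frame Y p *m 'J (vector_in (A:=A) (chart_at A p) X)
    (chart (chart_at A p) p) = B by [].
apply/row_matrixP => k; rewrite rowK -(vector_bracketE HA) linearB /=.
rewrite -derive_rowfun// row_mul rowK vector_in_chart_at row_frame_in.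
by rewrite -[X in _ - X = _]deriveEjacobian//; exact/smooth_at_differentiable/sX.
Qed.

End frames.

Lemma cyclic_quadratic {R : comPzRingType} (x x' x'' y y' y'' z z' z'' : R) :
  (x - y *+ 2 + z) + (x' - y' *+ 2 + z') + (x'' - y'' *+ 2 + z'') =
  (x + x' + x'') - (y + y' + y'') *+ 2 + (z + z' + z'').
Proof. ring. Qed.

Section trilinear_expansion.
Context {R : realType} {m n : nat}.
Implicit Types (x y : 'I_m -> 'I_m -> 'I_m -> R) (B : 'M[R]_(m, n)).

Lemma tri_actE x B a b c :
  tri_act x B a b c = \sum_i \sum_j \sum_k x i j k * (B i a * B j b * B k c).
Proof.
rewrite /tri_act; under eq_bigr do rewrite big_distrl /=.
under [RHS]eq_bigr do rewrite exchange_big /=.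
rewrite [RHS]exchange_big /=; apply: eq_bigr => k _.
rewrite [RHS]exchange_big /=; apply: eq_bigr => j _.
rewrite !big_distrl /=; apply: eq_bigr => i _; ring.
Qed.

Lemma tri_actD x y B a b c :
  tri_act (fun i j k => x i j k + y i j k) B a b c = tri_act x B a b c + tri_act y B a b c.
Proof.
rewrite !tri_actE -big_split; apply: eq_bigr => i _ /=; rewrite -big_split.
by apply: eq_bigr => j _ /=; rewrite -big_split; apply: eq_bigr => k _ /=; rewrite mulrDl.
Qed.

Lemma tri_actZ (l : R) x B a b c :
  tri_act (fun i j k => l * x i j k) B a b c = l * tri_act x B a b c.
Proof.
rewrite !tri_actE big_distrr; apply: eq_bigr => i _; rewrite big_distrr.
by apply: eq_bigr => j _; rewrite big_distrr; apply: eq_bigr => k _; exact: esym (mulrA _ _ _).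
Qed.

Lemma tri_act_cycle x B a b c :
  tri_act x B b c a = tri_act (fun i j k => x j k i) B a b c.
Proof.
rewrite !tri_actE [RHS]exchange_big /=; apply: eq_bigr => i _.
rewrite [RHS]exchange_big /=; apply: eq_bigr => j _; apply: eq_bigr => k _; ring.
Qed.

End trilinear_expansion.

Definition cyclic_sum {R : zmodType} {T : Type} (y : T -> T -> T -> R) a b c :=
  y a b c + y b c a + y c a b.

Lemma tri_act_cyclic_sum {R : realType} m n (y : 'I_m -> 'I_m -> 'I_m -> R) (B : 'M[R]_(m, n)) a b c :
  cyclic_sum (tri_act y B) a b c = tri_act (cyclic_sum y) B a b c.
Proof.
rewrite /cyclic_sum tri_actD tri_actD; congr (_ + _ + _); first exact: tri_act_cycle.
by rewrite tri_act_cycle tri_act_cycle.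
Qed.

(* The components, in a frame X with [X_i, X_k] = sum_p (C i)_kp X_p, of the
   Schouten square of sum_ij t_ij X_i (x) X_j. *)
Section structure_tensor.
Context {R : realType} {m : nat}.
Variables (t : 'M[R]_m) (C : 'I_m -> 'M[R]_m).

Definition structure_tensor : 'I_m -> 'I_m -> 'I_m -> R :=
  cyclic_sum (fun p q r => \sum_i t i r * ((C i)^T *m t + t *m C i) p q).

End structure_tensor.

Lemma structure_tensorN {R : realType} m (t : 'M[R]_m) (C : 'I_m -> 'M[R]_m) a b c :
  structure_tensor t (fun i => - C i) a b c = -1 * structure_tensor t C a b c.
Proof.
rewrite /structure_tensor /cyclic_sum !mulrDr !big_distrr /=.
congr (_ + _ + _); apply: eq_bigr => i _;
  by rewrite linearN mulNmx mulmxN /= -opprD mulN1r -mulrN mxE.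
Qed.

Section schouten_frames.
Context {R : realType} {n : nat} {M : topologicalType} {A : atlas R n M}.
Hypothesis HA : is_charted A.

(** The Lie derivative of the bivector along X_i has components (C i)^T t + t (C i) in the frame;
    inserting it into [schouten_frame2] gives the structure tensor. With C = [bracket_mx] or its
    opposite this serves left-invariant, right-invariant and fundamental fields. *)
Lemma schouten_involutive m (t : 'M[R]_m) (X : 'I_m -> M -> 'rV[R]_n) (C : 'I_m -> 'M[R]_m) p a b c :
  t^T = - t -> (forall k q, smooth_field_at A (X k) q) ->
  (forall i, \matrix_k vector_bracket A (X i) (X k) p = C i *m frame X p) ->
  schouten A (frame2 t X) (frame2 t X) p a b c = tri_act (structure_tensor t C) (frame X p) a b c.
Proof.
move=> tS sX XC.
have := schouten_frame2 HA a b c (frame2_2vector tS sX) tS (sX ^~ p); cbv beta zeta.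
rewrite /structure_tensor -tri_act_cyclic_sum /cyclic_sum.
have LE a' b' c' : \sum_i \sum_j t i j *
    (bivector_lie (A:=A) (X i) (frame2 t X) p a' b' * X j p 0 c') =
    tri_act (fun p0 q r => \sum_i t i r * ((C i)^T *m t + t *m C i) p0 q) (frame X p) a' b' c'.
  rewrite tri_actE.
  transitivity (\sum_i \sum_j \sum_p0 \sum_q
     t i j * ((C i)^T *m t + t *m C i) p0 q * (frame X p p0 a' * frame X p q b' * frame X p j c')).
    apply: eq_bigr => i _; apply: eq_bigr => j _.
    have -> : bivector_lie (A:=A) (X i) (frame2 t X) p =
       (frame X p)^T *m ((C i)^T *m t + t *m C i) *m frame X p.
      have := bivector_lie_frame2 HA t (sX i p) (sX ^~ p); cbv beta zeta => ->.
      by rewrite XC trmx_mul !(mulmxDr, mulmxDl) !mulmxA.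
    rewrite quadratic_mxE; have -> : X j p 0 c' = frame X p j c' by rewrite mxE.
    rewrite big_distrl big_distrr; apply: eq_bigr => p0 _ /=.
    rewrite big_distrl big_distrr; apply: eq_bigr => q _ /=; ring.
  under eq_bigr do rewrite exchange_big /=.
  rewrite exchange_big /=; apply: eq_bigr => p0 _.
  under eq_bigr do rewrite exchange_big /=.
  rewrite exchange_big /=; apply: eq_bigr => q _.
  rewrite exchange_big /=; apply: eq_bigr => j _.
  by rewrite big_distrl.
by rewrite !LE => e; exact e.
Qed.

Lemma schouten_invariant P m (t : 'M[R]_m) (X : 'I_m -> M -> 'rV[R]_n) p a b c :
  is_2vector_field A P -> t^T = - t -> (forall k, smooth_field_at A (X k) p) ->
  (forall k, bivector_lie (A:=A) (X k) P p = 0) ->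
  schouten A P (frame2 t X) p a b c = 0.
Proof.
move=> vP tS sX X0; have := schouten_frame2 HA a b c vP tS sX; cbv beta zeta => ->.
have L0 a' b' c' : \sum_i \sum_j t i j * (bivector_lie (A:=A) (X i) P p a' b' * X j p 0 c') = 0.
  by apply: big1 => i _; apply: big1 => j _; rewrite X0 mxE mul0r mulr0.
by rewrite !L0 !addr0.
Qed.

Lemma schouten_commuting m m' (t : 'M[R]_m) (t' : 'M[R]_m') X Y p a b c :
  t^T = - t -> t'^T = - t' ->
  (forall k q, smooth_field_at A (X k) q) -> (forall k q, smooth_field_at A (Y k) q) ->
  (forall i k, vector_bracket A (X i) (Y k) p = 0) ->
  schouten A (frame2 t' Y) (frame2 t X) p a b c = 0.
Proof.
move=> tS tS' sX sY XY.
apply: schouten_invariant => //; first exact: frame2_2vector.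
move=> k; have := bivector_lie_frame2 HA t' (sX k p) (sY ^~ p); cbv beta zeta => ->.
have -> : \matrix_k0 vector_bracket A (X k) (Y k0) p = 0.
  by apply/row_matrixP => j; rewrite rowK XY row0.
by rewrite trmx0 !mul0mx mulmx0 addr0.
Qed.

Lemma schoutenC P Q p a b c : schouten A P Q p a b c = schouten A Q P p a b c.
Proof.
rewrite /schouten; congr (_ + _ + _); apply: eq_bigr => l _; exact: addrC.
Qed.

Lemma bivector_in_sub (i : chart_index A) (P Q : M -> 'M[R]_n) :
  bivector_in i (fun p => P p - Q p) = (fun u => bivector_in i P u - bivector_in i Q u).
Proof. by apply/funext => u; rewrite /bivector_in mulmxBr mulmxBl. Qed.

Lemma is_2vector_sub P Q : is_2vector_field A P -> is_2vector_field A Q ->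
  is_2vector_field A (fun p => P p - Q p).
Proof.
move=> vP vQ; split=> [p|i].
  have := vP.1 p; have := vQ.1 p; rewrite /skew_mx linearB /= => -> ->.
  by rewrite opprB opprK addrC.
rewrite bivector_in_sub; apply: smooth_at_on => _ [p ip <-].
by apply: smooth_at_sub; exact: smooth_bivector_in.
Qed.

Lemma schouten_sub P Q p a b c : is_2vector_field A P -> is_2vector_field A Q ->
  schouten A (fun p => P p - Q p) (fun p => P p - Q p) p a b c =
  schouten A P P p a b c - schouten A P Q p a b c *+ 2 + schouten A Q Q p a b c.
Proof.
move=> vP vQ; have ip := ch_dom_at HA p.
have sP := smooth_bivector_in HA vP ip; have sQ := smooth_bivector_in HA vQ ip.
rewrite /schouten bivector_in_sub.
set P' := bivector_in (chart_at A p) P in sP *; set Q' := bivector_in (chart_at A p) Q in sQ *.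
set u := chart (chart_at A p) p in sP sQ *.
have D l : partial l (fun v => P' v - Q' v) u = partial l P' u - partial l Q' u.
  by rewrite /partial deriveB//; exact: smooth_at_derivable.
have T a' b' c' : \sum_l (partial l (fun v => P' v - Q' v) u a' b' * (P' u - Q' u) l c' +
    partial l (fun v => P' v - Q' v) u a' b' * (P' u - Q' u) l c') =
  \sum_l (partial l P' u a' b' * P' u l c' + partial l P' u a' b' * P' u l c')
  - (\sum_l (partial l Q' u a' b' * P' u l c' + partial l P' u a' b' * Q' u l c')) *+ 2
  + \sum_l (partial l Q' u a' b' * Q' u l c' + partial l Q' u a' b' * Q' u l c').
  rewrite -sumrMnl -sumrB -big_split; apply: eq_bigr => l _ /=; rewrite D.
  move: (partial l P' u) (partial l Q' u) (P' u) (Q' u) => dP dQ p0 q0.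
  by rewrite !mxE mulr2n; ring.
exact (etrans (congr2 +%R (congr2 +%R (T a b c) (T b c a)) (T c a b)) (cyclic_quadratic _ _ _ _ _ _ _ _ _)).
Qed.

End schouten_frames.

(** * Inverses of symplectic forms and Hamiltonian fields *)

Section local_inverse.
Context {R : realType} {n : nat}.
Implicit Types (P W : 'rV[R]_n -> 'M[R]_n) (X : 'rV[R]_n -> 'rV[R]_n).

Definition local_extd W u (a b c : 'I_n) : R :=
  partial a W u b c + partial b W u c a + partial c W u a b.

Lemma derive_inverse P W u v : smooth_at P u -> smooth_at W u ->
  (\forall y \near u, W y *m P y = 1%:M) ->
  'D_v P u = - (P u *m 'D_v W u *m P u).
Proof.
move=> sP sW WP.
have PW : P u *m W u = 1%:M by apply: mulmx1C; exact: nbhs_singleton WP.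
have : 'D_v (fun y => W y *m P y) u = 0.
  by rewrite (near_eq_derive _ WP) derive_cst.
rewrite derive_mulmx// => /(congr1 (mulmx (P u))).
rewrite mulmxDr mulmx0 !mulmxA PW mul1mx addrC => /eqP; rewrite addr_eq0 => /eqP.
exact.
Qed.

(** Differentiating W P = 1 gives dP = - P dW P = P^T dW P, so each term is dW contracted with three
    copies of P and the cyclic sum is dW antisymmetrised. The factor 2 arises because both halves of
    the Schouten bracket coincide. *)
Lemma local_schouten_inverse P W u a b c : smooth_at P u -> smooth_at W u ->
  (\forall y \near u, W y *m P y = 1%:M) -> (P u)^T = - P u ->
  local_schouten P P u a b c = 2 * tri_act (local_extd W u) (P u) a b c.
Proof.
move=> sP sW WP PS.
have TE a' b' c' : \sum_l (partial l P u a' b' * P u l c' + partial l P u a' b' * P u l c') =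
    2 * tri_act (fun p q l => partial l W u p q) (P u) a' b' c'.
  rewrite big_split /= -mulr2n -[LHS]mulr_natl; congr (_ * _); apply: eq_bigr => l _.
  set x := _ * _; suff -> : x = (\sum_j (\sum_i partial l W u i j * P u i a') * P u j b') * P u l c' by [].
  rewrite /x /partial (derive_inverse (delta_mx 0 l) sP sW WP) -!mulNmx -PS quadratic_mxE.
  congr (_ * _); rewrite exchange_big /=; apply: eq_bigr => i _; rewrite big_distrl /=.
  by apply: eq_bigr => j _; rewrite mulrA.
rewrite /local_schouten !TE -!mulrDr; congr (2 * _).
rewrite -/(cyclic_sum (tri_act (fun p q l => partial l W u p q) (P u)) a b c) tri_act_cyclic_sum.
apply: tri_act_ext => i j k; rewrite /cyclic_sum /local_extd.
by rewrite addrC addrA [LHS]addrC addrA.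
Qed.

End local_inverse.

Section hamiltonian_lie.
Context {R : comPzRingType} {n : nat}.
Variables (P H : 'M[R]_n) (h : 'I_n -> R) (dP : 'I_n -> 'I_n -> 'I_n -> R).
Hypotheses (P_skew : P^T = - P) (H_sym : H^T = H).
Hypothesis dP_skew : forall l a b, dP l b a = - dP l a b.
Hypothesis jacobi : forall a b c,
  cyclic_sum (fun a b c => \sum_l dP l a b * P l c) a b c = 0.

Let PC a b : P b a = - P a b.
Proof. by have /matrixP/(_ a b) := P_skew; rewrite !mxE. Qed.

(* The Hessian terms cancel by symmetry and the others add up to the Jacobi
   identity. *)
Lemma hamiltonian_lie_sum a b :
  let J l a := \sum_c (H l c * P c a + h c * dP l c a) in
  \sum_l (\sum_c h c * P c l) * dP l a b - \sum_l J l a * P l b - \sum_l P a l * J l b = 0.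
Proof.
move=> J.
have E1 : \sum_l J l a * P l b = \sum_l \sum_c H l c * P c a * P l b
    + \sum_c h c * \sum_l dP l c a * P l b.
  under [X in _ = _ + X]eq_bigr do rewrite big_distrr /=.
  rewrite [X in _ = _ + X]exchange_big -big_split; apply: eq_bigr => l _ /=.
  by rewrite big_distrl -big_split; apply: eq_bigr => c _ /=; ring.
have E2 : \sum_l P a l * J l b = - \sum_l \sum_c H l c * P c a * P l b
    + \sum_c h c * \sum_l dP l b c * P l a.
  under [X in _ = _ + X]eq_bigr do rewrite big_distrr /=.
  rewrite [X in _ = _ + X]exchange_big [X in _ = - X + _]exchange_big -sumrN -big_split.
  apply: eq_bigr => l _ /=.
  rewrite big_distrr -sumrN -big_split; apply: eq_bigr => c _ /=.
  have -> : H c l = H l c by have /matrixP/(_ l c) := H_sym; rewrite mxE.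
  by rewrite (PC l a) (dP_skew l b c); ring.
have E3 : \sum_l (\sum_c h c * P c l) * dP l a b = - \sum_c h c * \sum_l dP l a b * P l c.
  under eq_bigr do rewrite big_distrl /=.
  rewrite exchange_big -sumrN; apply: eq_bigr => c _ /=.
  by rewrite big_distrr -sumrN; apply: eq_bigr => l _ /=; rewrite (PC l c); ring.
have E4 : \sum_c h c * (\sum_l dP l a b * P l c) + \sum_c h c * (\sum_l dP l b c * P l a)
    + \sum_c h c * (\sum_l dP l c a * P l b) = 0.
  by rewrite -!big_split big1// => c _ /=; rewrite -!mulrDr; rewrite [X in _ * X](jacobi a b c) mulr0.
move: E1 E2 E3 E4.
move: (\sum_l \sum_c _) (\sum_c h c * _) (\sum_c h c * \sum_l dP l b c * _) (\sum_c h c * \sum_l dP l c a * _) => x y z w.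
move=> -> -> -> e.
have -> : - y - (x + w) - (- x + z) = - (y + z + w) by ring.
by rewrite e oppr0.
Qed.

End hamiltonian_lie.

Lemma half_zero {R : numDomainType} (x y z : R) : (x + x) + (y + y) + (z + z) = 0 -> x + y + z = 0.
Proof.
move=> e; have : (x + y + z) *+ 2 = 0 by rewrite -[RHS]e mulr2n; ring.
by move/eqP; rewrite mulrn_eq0 => /eqP.
Qed.

Lemma local_lie_hamiltonian {R : realType} n (P : 'rV[R]_n -> 'M[R]_n)
    (X : 'rV[R]_n -> 'rV[R]_n) (H : 'rV[R]_n -> R) u :
  smooth_at P u -> smooth_at H u -> (forall v, (P v)^T = - P v) ->
  (\forall v \near u, X v = (\row_c 'D_(delta_mx 0 c) H v) *m P v) ->
  (forall a b c, local_schouten P P u a b c = 0) ->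
  local_lie X P u = 0.
Proof.
move=> sP sH PS XH jac.
pose g v : 'rV[R]_n := \row_c 'D_(delta_mx 0 c) H v.
have sg : smooth_at g u.
  apply/smooth_at_mxP => i j; have := smooth_at_derive (delta_mx 0 j) sH.
  by congr smooth_at; apply/funext => v; rewrite mxE.
have sX : smooth_at X u.
  by apply: smooth_at_near (smooth_at_mulmx sg sP); apply: filterS XH => v ->.
have dPS l a b : 'D_(delta_mx 0 l) P u b a = - 'D_(delta_mx 0 l) P u a b.
  have := derive_trmx (delta_mx 0 l) sP.
  have -> : (fun v => (P v)^T) = (fun v => - P v) by apply/funext => v; exact: PS.
  rewrite deriveN; last exact: smooth_at_derivable.
  by move=> /matrixP/(_ a b); rewrite !mxE => ->.
pose Hs : 'M[R]_n := \matrix_(l, c) 'D_(delta_mx 0 l) g u 0 c.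
have gE l c : 'D_(delta_mx 0 l) g u 0 c = 'D_(delta_mx 0 l) ('D_(delta_mx 0 c) H) u.
  have E : (fun y => g y 0 c) = 'D_(delta_mx 0 c) H by apply/funext => y; rewrite mxE.
  have sgd := @smooth_at_derivable _ _ _ _ _ (delta_mx 0 l) sg.
  exact (etrans (derive_mxE 0 c sgd) (congr1 (fun f => 'D_(delta_mx 0 l) f u) E)).
have HsE l c : Hs l c = 'D_(delta_mx 0 l) ('D_(delta_mx 0 c) H) u.
  by rewrite /Hs mxE; exact: gE.
have HsS : Hs^T = Hs.
  apply/matrixP => i j; rewrite mxE.
  exact (etrans (HsE j i) (etrans (derive_swap_scalar _ _ sH) (esym (HsE i j)))).
have XuE : X u = g u *m P u by exact: nbhs_singleton XH.
have JE l a : 'J X u l a = \sum_c (Hs l c * P u c a + g u 0 c * 'D_(delta_mx 0 l) P u c a).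
  have := row_jacobian l (smooth_at_differentiable sX).
  rewrite (near_eq_derive _ XH) (derive_mulmx _ sg sP) => /rowP/(_ a).
  rewrite !mxE -big_split => ->; apply: eq_bigr => c _ /=.
  by rewrite [in RHS]mxE.
apply/matrixP => a b; rewrite /local_lie mx_sub2E [RHS]mxE.
(* The Schouten bracket of P with itself counts every Jacobi term twice, hence [half_zero]. *)
have jac' a' b' c' : cyclic_sum (fun a b c => \sum_l 'D_(delta_mx 0 l) P u a b * P u l c) a' b' c' = 0.
  have := jac a' b' c'; rewrite /local_schouten /cyclic_sum /partial.
  rewrite !big_split /= => e; apply: half_zero; exact: e.
have := hamiltonian_lie_sum (fun c => g u 0 c) (PS u) HsS dPS jac' a b; cbv beta zeta => e.
rewrite -[RHS]e; congr (_ - _ - _).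
- rewrite derive_rowE ?summxE; last exact: smooth_at_differentiable.
  by apply: eq_bigr => l _; rewrite mxE XuE mxE.
- by rewrite mxE; apply: eq_bigr => l _; rewrite mxE JE.
- by rewrite mxE; apply: eq_bigr => l _; rewrite JE.
Qed.

Lemma conj_inverse {R : comPzRingType} n (O C w p : 'M[R]_n) :
  O *m C = 1%:M -> C *m O = 1%:M -> w *m p = 1%:M ->
  (O *m w *m O^T) *m (C^T *m p *m C) = 1%:M.
Proof.
move=> OC CO wp; rewrite !mulmxA -(mulmxA (O *m w)) -trmx_mul CO trmx1 mulmx1.
by rewrite -(mulmxA O) wp mulmx1.
Qed.

Section inverse_tensors.
Context {R : realType} {n : nat} {M : topologicalType} {A : atlas R n M}.
Hypothesis HA : is_charted A.
Variables (w pi : M -> 'M[R]_n).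
Hypothesis wpi : forall p, w p *m pi p = 1%:M.

Lemma form_bivector_in i p : chart_dom i p ->
  form_in (A:=A) i w (chart i p) *m bivector_in (A:=A) i pi (chart i p) = 1%:M.
Proof.
move=> ip; have jp := ch_dom_at HA p; rewrite (form_inE HA)// (bivector_inE HA)//.
have OC := Jloc_inv HA ip jp; have CO := Jloc_inv HA jp ip.
exact (conj_inverse OC CO (wpi p)).
Qed.

Lemma inverse_skewr (B C : 'M[R]_n) : B *m C = 1%:M -> B^T = - B -> C^T = - C.
Proof.
move=> BC BS; have := congr1 trmx BC; rewrite trmx_mul BS mulmxN trmx1 => e.
by rewrite -[C^T]mulmx1 -BC mulmxA -[_ *m B]opprK e mulNmx mul1mx.
Qed.

Lemma inverse_2vector_field : is_2form A w -> is_2vector_field A pi.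
Proof.
move=> [wS sw]; split=> [p|i]; first exact: inverse_skewr (wpi p) (wS p).
apply: smooth_at_on => _ [p ip <-].
have sf : smooth_at (form_in (A:=A) i w) (chart i p).
  by apply: smooth_on_at (sw i); [exact: ch_img_open|exact: chart_img_chart].
have un q : chart_dom i q -> form_in (A:=A) i w (chart i q) \in unitmx.
  by move=> iq; have [] := mulmx1_unit (form_bivector_in iq).
apply: smooth_at_near (smooth_at_invmx (un _ ip) sf).
apply: filterS (near_chart_img HA ip) => _ [q iq <-].
by rewrite -[RHS](mulKmx (un _ iq)) (form_bivector_in iq) mulmx1.
Qed.

Lemma inverse_2form : is_2vector_field A pi -> is_2form A w.
Proof.
move=> [pS sp]; split=> [p|i]; first exact: inverse_skewr (mulmx1C (wpi p)) (pS p).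
apply: smooth_at_on => _ [p ip <-].
have sf : smooth_at (bivector_in (A:=A) i pi) (chart i p).
  by apply: smooth_on_at (sp i); [exact: ch_img_open|exact: chart_img_chart].
have un q : chart_dom i q -> bivector_in (A:=A) i pi (chart i q) \in unitmx.
  by move=> iq; have [] := mulmx1_unit (form_bivector_in iq).
apply: smooth_at_near (smooth_at_invmx (un _ ip) sf).
apply: filterS (near_chart_img HA ip) => _ [q iq <-].
by rewrite -[RHS](mulmxK (un _ iq)) (form_bivector_in iq) mul1mx.
Qed.

Lemma schouten_inverse p a b c : is_2form A w ->
  schouten A pi pi p a b c = 2 * tri_act (extd A w p) (pi p) a b c.
Proof.
move=> fw; have vp := inverse_2vector_field fw; have ip := ch_dom_at HA p.
have sw : smooth_at (form_in (A:=A) (chart_at A p) w) (chart (chart_at A p) p).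
  by apply: smooth_on_at (fw.2 _); [exact: ch_img_open|exact: chart_img_chart].
have sp := smooth_bivector_in HA vp ip.
have inv : \forall u \near chart (chart_at A p) p,
    form_in (A:=A) (chart_at A p) w u *m bivector_in (A:=A) (chart_at A p) pi u = 1%:M.
  by apply: filterS (near_chart_img HA ip) => _ [q iq <-]; exact: form_bivector_in.
have := local_schouten_inverse a b c sp sw inv.
by rewrite (bivector_in_chart_at HA) => /(_ (vp.1 p)).
Qed.

End inverse_tensors.

Section gradient.
Context {R : realType} {n : nat} {M : topologicalType} {A : atlas R n M}.
Hypothesis HA : is_charted A.

Definition gradient i (H : M -> R) (u : 'rV[R]_n) : 'rV[R]_n :=
  \row_c 'D_(delta_mx 0 c) (H \o chart_inv (a:=A) i) u.

Lemma gradient_change i j H p : smooth_fun A (H : M -> R^o) ->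
  chart_dom i p -> chart_dom j p ->
  gradient i H (chart i p) = gradient j H (chart j p) *m (Jloc (A:=A) (B:=A) i j id p)^T.
Proof.
move=> sH ip jp; apply/rowP => c; rewrite mxE.
have sj : smooth_at (H \o chart_inv (a:=A) j : _ -> R) (chart j p).
  apply: smooth_on_at (sH j); [exact: ch_img_open|exact: chart_img_chart].
have sl : smooth_at (locmap (A:=A) (B:=A) i j id) (chart i p).
  exact: (smooth_map_at_id HA p).2.
have lE : locmap (A:=A) (B:=A) i j id (chart i p) = chart j p.
  by rewrite /locmap /= (ch_chartK HA).
have nE : \forall u \near chart i p, (H \o chart_inv (a:=A) i) u =
    (H \o chart_inv (a:=A) j) (locmap (A:=A) (B:=A) i j id u).
  have := near_chart_inv HA ip (near_chart_dom HA jp).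
  by apply: filterS => u ju; rewrite /locmap /= (ch_chartK HA).
have dl := smooth_at_differentiable sl.
have dj := smooth_at_differentiable sj.
rewrite (near_eq_derive _ nE) (@derive_comp_row _ _ _ (H \o chart_inv (a:=A) j)) ?lE//.
rewrite [RHS]mxE; apply: eq_bigr => k _.
rewrite [X in _ = X * _]mxE [X in _ = _ * X]mxE mulrC; congr (_ * _).
have := row_jacobian c dl => /rowP/(_ k).
have -> : row c ('J (locmap (A:=A) (B:=A) i j id) (chart i p)) 0 k = Jloc (A:=A) (B:=A) i j id p c k.
  by rewrite [LHS]mxE.
by move=> ->; rewrite derive_mxE//; exact: smooth_at_derivable.
Qed.

Lemma smooth_gradient i H p : smooth_fun A (H : M -> R^o) -> chart_dom i p ->
  smooth_at (H \o chart_inv (a:=A) i : _ -> R) (chart i p).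
Proof.
by move=> sH ip; apply: smooth_on_at (sH i); [exact: ch_img_open|exact: chart_img_chart].
Qed.

(** The relation between X and the differential of H is known at each q in the chart selected by q;
    [gradient_change] moves it to the chart of p, where it can be differentiated. *)
Lemma bivector_lie_hamiltonian (pi : M -> 'M[R]_n) (X : M -> 'rV[R]_n) (H : M -> R) p :
  is_2vector_field A pi -> smooth_fun A (H : M -> R^o) ->
  (forall q, X q = gradient (chart_at A q) H (chart (chart_at A q) q) *m pi q) ->
  (forall a b c, schouten A pi pi p a b c = 0) ->
  bivector_lie (A:=A) X pi p = 0.
Proof.
move=> vp sH XH jac; have ip := ch_dom_at HA p.
apply: (local_lie_hamiltonian (H := H \o chart_inv (a:=A) (chart_at A p))).
- exact: smooth_bivector_in.
- exact: smooth_gradient.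
- move=> v; rewrite /bivector_in !trmx_mul trmxK vp.1 mulNmx mulmxN mulmxA //.
- apply: filterS (near_chart_img HA ip) => _ [q iq <-].
  have jq := ch_dom_at HA q.
  rewrite -/(gradient (chart_at A p) H (chart (chart_at A p) q)).
  rewrite (gradient_change sH iq jq) (vector_inE HA)// (bivector_inE HA)// XH.
  rewrite !mulmxA -[X in _ = X *m pi q *m _]mulmxA -trmx_mul (Jloc_inv HA jq iq).
  by rewrite trmx1 mulmx1.
- exact: jac.
Qed.

End gradient.

(** * The bivector fields t^L, t^R and t_M *)

Section frame_fields.
Context {R : realType} {m : nat} {G : topGroupType} {AG : atlas R m G}.
Hypothesis HL : is_lie_group AG.
Let HG : is_charted AG := manifold_charted (lie_group_manifold HL).

Definition basis_fields {n} {M : Type} (X : 'rV[R]_m -> M -> 'rV[R]_n) (i : 'I_m) := X (delta_mx 0 i).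

Definition bracket_mx (i : 'I_m) : 'M[R]_m :=
  \matrix_k lie_bracket AG (delta_mx 0 i) (delta_mx 0 k).

Lemma frame_mx n (M : topologicalType) (T : M -> 'M[R]_(m, n)) (p : M) :
  frame (basis_fields (fun X q => X *m T q)) p = T p.
Proof. by apply/row_matrixP => i; rewrite rowK /basis_fields -rowE. Qed.

Lemma left_2vectorE t : left_2vector AG t = frame2 t (basis_fields (left_field AG)).
Proof. by apply/funext => g; rewrite /frame2 frame_mx. Qed.

Lemma right_2vectorE t : right_2vector AG t = frame2 t (basis_fields (right_field AG)).
Proof. by apply/funext => g; rewrite /frame2 frame_mx. Qed.

Lemma frame_left g : frame (basis_fields (left_field AG)) g = Ad_mx AG g *m frame (basis_fields (right_field AG)) g.
Proof.
have rE : frame (basis_fields (right_field AG)) g = tangent_map AG AG (fun h => (h * g)%g) 1%g.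
  exact: frame_mx.
apply: etrans _ (congr1 (mulmx (Ad_mx AG g)) (esym rE)).
apply/row_matrixP => i; apply: etrans (rowK _ _) _.
apply: etrans _ (esym (row_mul i _ _)).
have -> : basis_fields (left_field AG) i g = right_field AG (Ad AG g (delta_mx 0 i)) g.
  exact: esym (right_field_Ad HL _ _).
by rewrite /right_field AdE rowE.
Qed.

Lemma left_bracket_mx g i : \matrix_k vector_bracket AG (basis_fields (left_field AG) i)
   (basis_fields (left_field AG) k) g = bracket_mx i *m frame (basis_fields (left_field AG)) g.
Proof.
apply/row_matrixP => k; rewrite rowK row_mul rowK (bracket_left_field HL).
by rewrite frame_mx.
Qed.

Lemma right_bracket_mx g i : \matrix_k vector_bracket AG (basis_fields (right_field AG) i)
   (basis_fields (right_field AG) k) g = - bracket_mx i *m frame (basis_fields (right_field AG)) g.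
Proof.
apply/row_matrixP => k; rewrite rowK mulNmx [RHS]linearN /= row_mul rowK (bracket_right_field HL).
by rewrite frame_mx.
Qed.

Lemma schouten_left t g a b c : t^T = - t ->
  schouten AG (left_2vector AG t) (left_2vector AG t) g a b c =
  tri_act (structure_tensor t bracket_mx) (frame (basis_fields (left_field AG)) g) a b c.
Proof.
move=> tS; rewrite left_2vectorE; apply: (schouten_involutive HG) => //.
  by move=> k q; exact: smooth_left_field.
exact: left_bracket_mx.
Qed.

Lemma schouten_right t g a b c : t^T = - t ->
  schouten AG (right_2vector AG t) (right_2vector AG t) g a b c =
  - tri_act (structure_tensor t bracket_mx) (frame (basis_fields (right_field AG)) g) a b c.
Proof.
move=> tS; rewrite right_2vectorE.
have := schouten_involutive HG (t := t) (X := basis_fields (right_field AG)) (C := fun i => - bracket_mx i)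
   (p := g) a b c tS (fun k q => smooth_right_field HL _ q) (right_bracket_mx g).
move=> ->; rewrite (tri_act_ext _ a b c (structure_tensorN t bracket_mx)) tri_actZ.
exact: mulN1r.
Qed.

Lemma schouten_left_right t g a b c : t^T = - t ->
  schouten AG (left_2vector AG t) (right_2vector AG t) g a b c = 0.
Proof.
move=> tS; rewrite schoutenC left_2vectorE right_2vectorE.
apply: (schouten_commuting HG) => //.
- by move=> k q; exact: smooth_left_field.
- by move=> k q; exact: smooth_right_field.
- by move=> i k; exact: bracket_left_right.
Qed.

Lemma twist_bracketE t i j k : t^T = - t ->
  twist_bracket AG t i j k = structure_tensor t bracket_mx i j k.
Proof.
move=> tS; rewrite /twist_bracket (schouten_left 1%g i j k tS).
have -> : frame (basis_fields (left_field AG)) 1%g = 1%:M.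
  by apply/row_matrixP => l; rewrite [LHS]rowK rowE mulmx1; exact: left_field1.
exact: tri_act1.
Qed.

Lemma poisson_twist_2vector t : t^T = - t -> is_2vector_field AG (poisson_twist AG t).
Proof.
move=> tS; apply: is_2vector_sub => //.
  by rewrite left_2vectorE; apply: frame2_2vector => // k g; exact: smooth_left_field.
by rewrite right_2vectorE; apply: frame2_2vector => // k g; exact: smooth_right_field.
Qed.

Lemma poisson_twist_poisson t : connected [set: G] -> t^T = - t -> is_r_matrix AG t ->
  is_poisson AG (poisson_twist AG t).
Proof.
move=> Gc tS rt; split=> [|g a b c]; first exact: poisson_twist_2vector.
have vL : is_2vector_field AG (left_2vector AG t).
  by rewrite left_2vectorE; apply: frame2_2vector => // k q; exact: smooth_left_field.
have vR : is_2vector_field AG (right_2vector AG t).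
  by rewrite right_2vectorE; apply: frame2_2vector => // k q; exact: smooth_right_field.
have := schouten_sub HG g a b c vL vR.
move=> e; apply: etrans e _.
apply: etrans (congr2 +%R (congr2 (fun x y => x - y *+ 2) (schouten_left g a b c tS)
  (schouten_left_right g a b c tS)) (schouten_right g a b c tS)) _.
have cancel (x y : R) : x = y -> x - 0 *+ 2 - y = 0 by move=> ->; rewrite mul0rn subr0 subrr.
(* The left frame is Ad_g times the right frame, so at g the trivector [t, t]^L is Ad_g [t, t] read
   in the right frame; Ad-invariance identifies it with [t, t]^R. *)
apply: cancel; apply: etrans (congr1 (fun B => tri_act _ B a b c) (frame_left g)) _.
apply: etrans (tri_actM _ _ _ a b c) _; apply: tri_act_ext => i j k.
have e l1 l2 l3 := esym (twist_bracketE l1 l2 l3 tS).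
apply: etrans (tri_act_ext _ i j k e) _.
exact: etrans (ad_invariant_Ad HL Gc rt g i j k) (esym (e i j k)).
Qed.

End frame_fields.

Lemma trmx_mulBl {R : comPzRingType} n l (T : 'M[R]_(n, l)) (P Q : 'M[R]_n) :
  T^T *m (P - Q) *m T = T^T *m P *m T - T^T *m Q *m T.
Proof. by rewrite mulmxBr mulmxBl. Qed.

Lemma col_mx_block {R : comPzRingType} m n l (B : 'M[R]_(m, l)) (C : 'M[R]_(n, l)) (P : 'M[R]_m) (Q : 'M[R]_n) :
  (col_mx B C)^T *m block_mx P 0 0 Q *m col_mx B C = B^T *m P *m B + C^T *m Q *m C.
Proof.
by rewrite tr_col_mx mul_row_block !mulmx0 addr0 add0r mul_row_col.
Qed.

Lemma frame2_mul {R : comPzRingType} m n l (t : 'M[R]_m) (F : 'M[R]_(m, n)) (T : 'M[R]_(n, l)) :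
  T^T *m (F^T *m t *m F) *m T = (F *m T)^T *m t *m (F *m T).
Proof. by rewrite trmx_mul !mulmxA. Qed.

Section action_fields.
Context {R : realType} {m n : nat} {G : topGroupType} {M : topologicalType}.
Context {AG : atlas R m G} {AM : atlas R n M} {sigma : G -> M -> M}.
Hypotheses (HL : is_lie_group AG) (HM : is_charted AM) (Hs : is_smooth_action AG AM sigma).
Let HG : is_charted AG := manifold_charted (lie_group_manifold HL).

Local Notation act := (basis_fields (act_field AG AM sigma)).

Lemma frame_act p : frame act p = tangent_map AG AM (fun h => sigma h p) 1%g.
Proof. exact: (frame_mx (fun p => tangent_map AG AM (fun h => sigma h p) 1%g)). Qed.

Lemma fundamental_frame i p a : fundamental AG AM sigma (delta_mx 0 i) p 0 a = frame act p i a.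
Proof. by rewrite (fundamentalE HL HM Hs) [RHS]mxE. Qed.

Lemma fundamental2E t : fundamental2 AG AM sigma t = frame2 t act.
Proof.
apply/funext => p; apply/matrixP => a b; rewrite /frame2 quadratic_mxE mxE.
apply: eq_bigr => i _; apply: eq_bigr => j _.
by rewrite !fundamental_frame mulrA.
Qed.

Lemma fundamental3E x p a b c : fundamental3 AG AM sigma x p a b c = tri_act x (frame act p) a b c.
Proof.
rewrite tri_actE; apply: eq_bigr => i _; apply: eq_bigr => j _; apply: eq_bigr => k _.
have S (r y z w : R) : r * y * z * w = r * (y * z * w) by rewrite !mulrA.
by rewrite !fundamental_frame; exact: S.
Qed.

Lemma act_bracket_mx p i : \matrix_k vector_bracket AM (act i) (act k) p =
  - bracket_mx (AG:=AG) i *m frame act p.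
Proof.
rewrite mulNmx -mulmxN; apply/row_matrixP => k; apply: etrans (rowK _ _) _.
apply: etrans (bracket_act_field HL HM Hs _ _ _) _; rewrite row_mul rowK frame_act mulmxN.
by [].
Qed.

Lemma act_2vector t : t^T = - t -> is_2vector_field AM (frame2 t act).
Proof. by move=> tS; apply: frame2_2vector => // k q; exact: smooth_act_field. Qed.

Lemma schouten_fundamental2 t p a b c : t^T = - t ->
  schouten AM (frame2 t act) (frame2 t act) p a b c =
  - fundamental3 AG AM sigma (twist_bracket AG t) p a b c.
Proof.
move=> tS.
have e1 := schouten_involutive HM a b c tS (fun k q => smooth_act_field HL HM Hs _ q) (act_bracket_mx p).
apply: etrans e1 _; rewrite fundamental3E.
apply: etrans (tri_act_ext _ a b c (structure_tensorN t (bracket_mx (AG:=AG)))) _.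
rewrite tri_actZ mulN1r; congr (- _); apply: tri_act_ext => i j k.
exact: esym (twist_bracketE HL i j k tS).
Qed.

Lemma push2_prod_action g p P Q :
  push2 (prod_atlas AG AM) AM (fun x => sigma x.1 x.2) (g, p) (block_mx P 0 0 Q) =
  push2 AG AM (fun h => sigma h p) g P + push2 AM AM (sigma g) p Q.
Proof.
rewrite /push2 (tangent_map_prod HG HM HM (smooth_act HL HM Hs (g, p))).
exact: col_mx_block.
Qed.

Lemma frame_left_orbit g p :
  frame (basis_fields (left_field AG)) g *m tangent_map AG AM (fun h => sigma h p) g =
  frame act p *m tangent_map AM AM (sigma g) p.
Proof.
apply/row_matrixP => i; rewrite !row_mul.
apply: etrans (congr1 (fun v => v *m _) (rowK _ _)) _.
apply: etrans _ (esym (congr1 (fun v => v *m _) (rowK _ _))).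
exact: (left_field_orbit HL HM Hs).
Qed.

Lemma frame_right_orbit g p :
  frame (basis_fields (right_field AG)) g *m tangent_map AG AM (fun h => sigma h p) g =
  frame act (sigma g p).
Proof.
apply/row_matrixP => i; rewrite row_mul.
apply: etrans (congr1 (fun v => v *m _) (rowK _ _)) _.
apply: etrans _ (esym (rowK _ _)).
exact: (right_field_orbit HL HM Hs).
Qed.

(** The image of t^L cancels that of t_M at p, and t^R supplies t_M at gp. [Q] is arbitrary, so that
    with G acting on itself by left multiplication and [Q] = t^L the same computation gives the
    multiplicativity of t^L - t^R. *)
Lemma push2_twisted t (Q : M -> 'M[R]_n) g p :
  push2 (prod_atlas AG AM) AM (fun x => sigma x.1 x.2) (g, p)
    (block_mx (poisson_twist AG t g) 0 0 (Q p - frame2 t act p)) =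
  push2 AM AM (sigma g) p (Q p) - frame2 t act (sigma g p).
Proof.
rewrite push2_prod_action /poisson_twist left_2vectorE right_2vectorE.
have e1 : push2 AG AM (fun h => sigma h p) g (frame2 t (basis_fields (left_field AG)) g) =
    push2 AM AM (sigma g) p (frame2 t act p).
  apply: etrans (frame2_mul _ _ _) _; apply: etrans _ (esym (frame2_mul _ _ _)).
  by rewrite frame_left_orbit.
have e2 : push2 AG AM (fun h => sigma h p) g (frame2 t (basis_fields (right_field AG)) g) =
    frame2 t act (sigma g p).
  by apply: etrans (frame2_mul _ _ _) _; rewrite frame_right_orbit.
have S (V : zmodType) (a b c : V) : a - b + (c - a) = c - b.
  by rewrite addrC addrA subrK.
apply: etrans (congr2 +%R (trmx_mulBl _ _ _) (trmx_mulBl _ _ _)) _.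
apply: etrans (congr2 (fun x y => x - y + _) e1 e2) _.
exact: S.
Qed.

End action_fields.

Section poisson_lie.
Context {R : realType} {m : nat} {G : topGroupType} {AG : atlas R m G}.
Hypotheses (HL : is_lie_group AG) (Gc : connected [set: G]).
Let HG : is_charted AG := manifold_charted (lie_group_manifold HL).

Lemma poisson_twist_lie_group t : t^T = - t -> is_r_matrix AG t ->
  is_poisson_lie_group AG (poisson_twist AG t).
Proof.
move=> tS rt; split=> //; first exact: poisson_twist_poisson.
split; first exact: lie_group_mul.
move=> [g h]; rewrite /prod_2vector /=.
have := push2_twisted HL HG (mul_smooth_action HL) t (left_2vector AG t) g h.
have -> : frame2 t (basis_fields (act_field AG AG (fun g h : G => (g * h)%g))) = right_2vector AG t.
  by rewrite right_2vectorE.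
move=> e.
have E : push2 AG AG (fun k => (g * k)%g) h (left_2vector AG t h) = left_2vector AG t (g * h)%g.
  rewrite left_2vectorE; apply: etrans (frame2_mul _ _ _) _.
  suff -> : frame (basis_fields (left_field AG)) h *m tangent_map AG AG [eta *%g g] h =
    frame (basis_fields (left_field AG)) (g * h)%g by [].
  apply/row_matrixP => i; rewrite row_mul.
  apply: etrans (congr1 (fun v => v *m _) (rowK _ _)) _.
  apply: etrans _ (esym (rowK _ _)); exact: left_field_translate.
exact (etrans e (congr1 (fun x => x - right_2vector AG t (g * h)%g) E)).
Qed.

End poisson_lie.

(** * Moment maps *)

Lemma mulmx1_unitl {R : comUnitRingType} n (A B : 'M[R]_n) : A *m B = 1%:M -> A \in unitmx.
Proof. by case/mulmx1_unit. Qed.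

Lemma skew_sandwich {R : comPzRingType} m n (D : 'M[R]_(m, n)) (w : 'M[R]_n) (X : 'rV[R]_m) j :
  w^T = - w ->
  ((delta_mx 0 j : 'rV[R]_m) *m D *m w *m (X *m D)^T) 0 0 = - (X *m D *m w *m D^T) 0 j.
Proof.
move=> wS; rewrite -[LHS]trace_mx11 -mxtrace_tr trace_mx11.
have -> : ((delta_mx 0 j : 'rV[R]_m) *m D *m w *m (X *m D)^T)^T =
    - (X *m D *m w *m D^T *m (delta_mx 0 j)^T).
  by rewrite !trmx_mul !trmxK wS mulNmx mulmxN !mulmxA.
by rewrite [LHS]mxE trmx_delta -colE mxE.
Qed.

Section moment_maps.
Context {R : realType} {m n : nat} {G : topGroupType} {M : topologicalType}.
Context {AG : atlas R m G} {AM : atlas R n M} {sigma : G -> M -> M}.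
Context {w pi : M -> 'M[R]_n} {mu : M -> 'rV[R]_m}.
Hypotheses (HL : is_lie_group AG) (HM : is_charted AM).
Hypothesis Hw : is_symplectic_form AM w.
Hypothesis Hham : is_symplectic_hamiltonian AG AM sigma w mu.
Hypothesis pi_induced : induces w pi.
Let HG : is_charted AG := manifold_charted (lie_group_manifold HL).
Let Hs : is_smooth_action AG AM sigma := hamiltonian_action Hham.

Local Notation act := (basis_fields (act_field AG AM sigma)).

Lemma induced_inverse p : w p *m pi p = 1%:M.
Proof.
apply/row_matrixP => i; rewrite row_mul [row i 1%:M]rowE mulmx1 rowE.
exact: pi_induced.
Qed.

Lemma induced_2vector : is_2vector_field AM pi.
Proof. by case: Hw => fw _ _; exact: (inverse_2vector_field HM induced_inverse). Qed.

Lemma tri_act0 k l (B : 'M[R]_(k, l)) x a b c : (forall i j h, x i j h = 0) -> tri_act x B a b c = 0.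
Proof.
move=> x0; rewrite tri_actE; apply: big1 => i _; apply: big1 => j _; apply: big1 => h _.
by rewrite x0 mul0r.
Qed.

Lemma induced_poisson p a b c : schouten AM pi pi p a b c = 0.
Proof.
case: Hw => fw dw _; rewrite (schouten_inverse HM induced_inverse)//.
by rewrite tri_act0 ?mulr0.
Qed.

Let H (X : 'rV[R]_m) (q : M) : R := pairing (mu q) X.

Lemma smooth_pairing X : smooth_fun AM (H X : M -> R^o).
Proof.
move=> i; apply: smooth_at_on => _ [p ip <-].
have smu : smooth_at (mu \o chart_inv (a:=AM) i) (chart i p).
  by apply: smooth_on_at (moment_smooth Hham i); [exact: ch_img_open|exact: chart_img_chart].
have -> : (H X : M -> R^o) \o chart_inv (a:=AM) i = (fun u => ((mu \o chart_inv (a:=AM) i) u *m X^T) 0 0 : R^o) by [].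
have sc : smooth_at (fun=> X^T : 'cV[R]_m) (chart i p) by exact: smooth_at_cst.
have := smooth_at_mulmx smu sc.
by move/smooth_at_mxP/(_ 0 0).
Qed.

Lemma gradient_pairing X q :
  gradient (A:=AM) (chart_at AM q) (H X) (chart (chart_at AM q) q) = act_field AG AM sigma X q *m w q.
Proof.
apply/rowP => c; rewrite mxE.
have := moment_fundamental Hham X q (delta_mx 0 c).
rewrite /dfun /interior_product (fundamentalE HL HM Hs).
have sH := smooth_gradient HM (smooth_pairing X) (ch_dom_at HM q).
rewrite -deriveE; last exact: smooth_at_differentiable sH.
move=> ->.
by rewrite trmx_delta -colE mxE.
Qed.

Lemma act_hamiltonian X q : act_field AG AM sigma X q =
  gradient (A:=AM) (chart_at AM q) (H X) (chart (chart_at AM q) q) *m pi q.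
Proof. by rewrite gradient_pairing -mulmxA induced_inverse mulmx1. Qed.

Lemma bivector_lie_act X p : bivector_lie (A:=AM) (act_field AG AM sigma X) pi p = 0.
Proof.
apply: (bivector_lie_hamiltonian HM induced_2vector (smooth_pairing X) (act_hamiltonian X)).
exact: induced_poisson.
Qed.

Lemma twistedE t : twisted AG AM sigma pi t = (fun p => pi p - frame2 t act p).
Proof. by rewrite /twisted (fundamental2E HL HM Hs). Qed.

Lemma twisted_2vector t : t^T = - t -> is_2vector_field AM (twisted AG AM sigma pi t).
Proof.
move=> tS; rewrite twistedE; apply: is_2vector_sub => //; first exact: induced_2vector.
exact: (act_2vector HL HM Hs).
Qed.

Lemma twisted_poisson t : t^T = - t ->
  (forall p a b c, fundamental3 AG AM sigma (twist_bracket AG t) p a b c = 0) ->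
  is_poisson AM (twisted AG AM sigma pi t).
Proof.
move=> tS t0; split=> [|p a b c]; first exact: twisted_2vector.
rewrite twistedE; apply: etrans (schouten_sub HM p a b c induced_2vector (act_2vector HL HM Hs tS)) _.
have e1 : schouten AM pi (frame2 t act) p a b c = 0.
  apply: (schouten_invariant HM) => //; first exact: induced_2vector.
    by move=> k; exact: smooth_act_field.
  by move=> k; exact: bivector_lie_act.
rewrite induced_poisson e1 (schouten_fundamental2 HL HM Hs)// t0.
by rewrite mul0rn subr0 oppr0 addr0.
Qed.

(** Obtained by inverting the invariance T w(gp) T^T = w(p) of the symplectic form. *)
Lemma symplectic_push2 g p : push2 AM AM (sigma g) p (pi p) = pi (sigma g p).
Proof.
have [_ _ /(_ p)] := hamiltonian_symplectic Hham g.
cbv zeta; rewrite /push2; set T := tangent_map _ _ _ _ => e.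
have e1 : (T *m w (sigma g p)) *m (T^T *m pi p) = 1%:M by rewrite mulmxA e induced_inverse.
have e2 := mulmx1C e1.
rewrite -[LHS]mulmx1 -(induced_inverse (sigma g p)) !mulmxA.
by rewrite -[X in X *m pi _]mulmxA e2 mul1mx.
Qed.

Lemma twisted_poisson_action t : connected [set: G] -> t^T = - t ->
  (forall p a b c, fundamental3 AG AM sigma (twist_bracket AG t) p a b c = 0) ->
  is_r_matrix AG t ->
  is_poisson_action AG AM sigma (poisson_twist AG t) (twisted AG AM sigma pi t).
Proof.
move=> Gc tS t0 rt; split.
- exact: poisson_twist_lie_group.
- exact: twisted_poisson.
- exact: Hs.
split; first by case: Hs.
move=> [g p]; rewrite twistedE.
apply: etrans (push2_twisted HL HM Hs t pi g p) _.
by rewrite symplectic_push2.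
Qed.

Lemma act_fieldE X p : act_field AG AM sigma X p = X *m frame act p.
Proof. by rewrite (frame_act). Qed.

Lemma Ad_mx_inv g : Ad_mx AG g *m Ad_mx AG g^-1%g = 1%:M.
Proof. by rewrite -(Ad_mxM HL) mulVg (Ad_mx1 HL). Qed.

Lemma derive_Ad_mx_inv X Y :
  let i1 := chart_at AG 1%g in let e1 := chart i1 1%g in
  smooth_at (fun u => Ad_mx AG (chart_inv (a:=AG) i1 u)^-1%g) e1 /\
  Y *m 'D_X (fun u => Ad_mx AG (chart_inv (a:=AG) i1 u)^-1%g) e1 = - lie_bracket AG X Y.
Proof.
move=> i1 e1; have sW := smooth_Ad_mx HL.
have WP : \forall u \near e1, Ad_mx AG (chart_inv (a:=AG) i1 u) *m Ad_mx AG (chart_inv (a:=AG) i1 u)^-1%g = 1%:M.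
  by apply: near_all => u; exact: Ad_mx_inv.
have un g : Ad_mx AG g \in unitmx := mulmx1_unitl (Ad_mx_inv g).
have sP : smooth_at (fun u => Ad_mx AG (chart_inv (a:=AG) i1 u)^-1%g) e1.
  have sI := @smooth_at_invmx _ _ _ (fun u => Ad_mx AG (chart_inv (a:=AG) i1 u)) e1
    (un (chart_inv (a:=AG) i1 e1)) sW.
  apply: smooth_at_near sI; apply: near_all => u.
  by rewrite -[RHS](mulKmx (un (chart_inv (a:=AG) i1 u))) Ad_mx_inv mulmx1.
have g1 : chart_inv (a:=AG) i1 e1 = 1%g by rewrite (ch_chartK HG)//; exact: ch_dom_at.
split=> //.
apply: etrans (congr1 (mulmx Y) (derive_inverse X sP sW WP)) _.
rewrite g1 invg1 (Ad_mx1 HL) mul1mx mulmx1 mulmxN; congr (- _).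
exact: derive_Ad_mx.
Qed.

(** The derivative at g = 1 of the j-th component of mu(g p), computed twice: by the moment map
    condition along the orbit map, and by equivariance from the derivative of Ad of g^-1. It is
    taken in the chart at 1. *)
Lemma moment_derivative X j p :
  (act_field AG AM sigma (delta_mx 0 j) p *m w p *m (act_field AG AM sigma X p)^T) 0 0 =
  coad AG X (mu p) 0 j.
Proof.
pose i1 := chart_at AG 1%g; pose e1 := chart i1 1%g; pose jp := chart_at AM p.
have d1 : chart_dom i1 1%g by exact: ch_dom_at.
have g1 : chart_inv (a:=AG) i1 e1 = 1%g by rewrite (ch_chartK HG).
have s1 : sigma 1%g p = p by case: Hs.
have so := smooth_orbit HL HM Hs p 1%g.
have dj : chart_dom jp (sigma 1%g p) by rewrite s1; exact: ch_dom_at.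
have sl := so.2 i1 jp d1 dj.
pose lo := locmap (A:=AG) (B:=AM) i1 jp (fun h => sigma h p).
have lo1 : lo e1 = chart jp p by rewrite /lo /locmap /= g1 s1.
have sH := smooth_gradient HM (smooth_pairing (delta_mx 0 j)) (ch_dom_at HM p).
have dl : 'D_X lo e1 = act_field AG AM sigma X p.
  rewrite deriveEjacobian; last exact: smooth_at_differentiable.
  by rewrite /act_field tangent_mapE s1.
have L : 'D_X (fun u => (H (delta_mx 0 j) \o chart_inv (a:=AM) jp) (lo u)) e1 =
  (act_field AG AM sigma (delta_mx 0 j) p *m w p *m (act_field AG AM sigma X p)^T) 0 0.
  rewrite derive_comp ?lo1 ?dl; [|exact: smooth_at_differentiable|exact: smooth_at_differentiable].
  have := moment_fundamental Hham (delta_mx 0 j) p (act_field AG AM sigma X p).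
  rewrite /dfun /interior_product (fundamentalE HL HM Hs) => <-.
  rewrite deriveE//; exact: smooth_at_differentiable sH.
pose P u := Ad_mx AG (chart_inv (a:=AG) i1 u)^-1%g.
have [sP dP] := derive_Ad_mx_inv X (delta_mx 0 j).
have nE : \forall u \near e1, (H (delta_mx 0 j) \o chart_inv (a:=AM) jp) (lo u) =
    (mu p *m ((delta_mx 0 j : 'rV[R]_m) *m P u)^T) 0 0.
  have := near_chart_inv HG d1 (so.1 _ (near_chart_dom HM dj)).
  apply: filterS => u du.
  rewrite /lo /locmap /= (ch_chartK HM)// /H (moment_equivariant Hham).
  rewrite {1}/pairing trmx_delta -colE mxE [LHS]mxE AdE.
  by [].
rewrite -L (near_eq_derive _ nE).
have sc : smooth_at (fun=> delta_mx 0 j : 'rV[R]_m) e1 by exact: smooth_at_cst.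
have sm : smooth_at (fun=> mu p) e1 by exact: smooth_at_cst.
have sdP := smooth_at_mulmx sc sP.
have sT := smooth_at_trmx sdP.
have dd := derive_mxE 0 0 (smooth_at_derivable (smooth_at_mulmx sm sT)).
rewrite -dd (derive_mulmx X sm sT) derive_cst mul0mx add0r (derive_trmx X sdP).
rewrite (derive_mulmx X sc sP) derive_cst mul0mx add0r.
rewrite dP linearN mulmxN /= mxE [RHS]mxE.
by [].
Qed.

(** Writes ad* at mu(p) through w and the frame of fundamental fields, so that admissibility becomes
    a statement about the matrices that occur in pi - t_M. *)
Lemma coad_moment X p : coad AG X (mu p) = - (X *m frame act p *m w p *m (frame act p)^T).
Proof.
case: Hw => -[wS _] _ _.
apply/rowP => j; rewrite -moment_derivative !act_fieldE [RHS]mxE.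
exact (skew_sandwich _ _ _ (wS p)).
Qed.

(** Common to the admissible and the compact case. With F the frame of fundamental fields, the
    dressing map is 1 - (t F w) F^T and pi - t_M is (1 - F^T (t F w)) pi. As for any 1 - AB and 1 -
    BA, injectivity of the first gives that of the second. *)
Lemma twisted_nondegenerate t : t^T = - t ->
  (forall p zeta, coad AG (zeta *m t) (mu p) + zeta = 0 -> zeta = 0) ->
  is_nondegenerate AM (twisted AG AM sigma pi t).
Proof.
move=> tS inj; split=> [|p]; first exact: twisted_2vector.
have wp := mulmx1C (induced_inverse p).
suff un : twisted AG AM sigma pi t p \in unitmx.
  exists (fun v => v *m invmx (twisted AG AM sigma pi t p)) => v; rewrite /sharp_map.
    exact: mulmxK.
  exact: mulmxKV.
rewrite -row_free_unit; apply: inj_row_free => v; rewrite twistedE mulmxBr.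
move=> /eqP; rewrite subr_eq0 => /eqP vE.
(* The sign offsets the one in [coad_moment]: the image of zeta t under ad* is then exactly -
   zeta. *)
pose zeta := - (v *m (frame act p)^T).
have zE : zeta *m t *m frame act p = - (v *m pi p).
  by rewrite vE /frame2 /zeta !mulNmx !mulmxA.
have z0 : zeta = 0.
  apply: (inj p); rewrite coad_moment zE !mulNmx opprK -(mulmxA v) wp mulmx1.
  exact: subrr.
rewrite -[v]mulmx1 -wp mulmxA -[v *m _]opprK -zE z0 !mul0mx oppr0 mul0mx.
by [].
Qed.

Lemma admissible_nondegenerate t : t^T = - t ->
  (forall xi, range mu xi -> admissible AG t xi) ->
  is_nondegenerate AM (twisted AG AM sigma pi t).
Proof.
move=> tS adm; apply: twisted_nondegenerate => // p zeta z0.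
have [_ inj _] : admissible AG t (mu p) by apply: adm; exists p.
have c0 : coad AG 0 (mu p) = 0 by rewrite coad_moment !mul0mx oppr0.
have e0 : dressing AG (mu p) (0, 0) = 0 by apply: etrans (addr0 _) c0.
have m1 : (zeta *m t, zeta) \in twist_complement t by rewrite inE; exists zeta.
have m0 : (0, 0) \in twist_complement t.
  by rewrite inE; exists 0 => //; rewrite /twist_sharp mul0mx.
exact (congr1 snd (inj _ _ m1 m0 (etrans z0 (esym e0)))).
Qed.

(** The Schouten bracket of [piM] is twice the exterior derivative of its inverse, transported by
    [piM]; as [piM] is invertible, the vanishing of the one gives that of the other. *)
Lemma nondegenerate_symplectic piM : is_nondegenerate AM piM -> is_poisson AM piM ->
  exists wt, is_symplectic_form AM wt /\ induces wt piM.
Proof.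
move=> [vp bp] [_ Pp].
have un p : piM p \in unitmx.
  rewrite -row_free_unit; apply: inj_row_free => v v0.
  by apply: (bij_inj (bp p)); rewrite /sharp_map v0 mul0mx.
pose wt p : 'M[R]_n := invmx (piM p).
have wP p : wt p *m piM p = 1%:M by exact: mulVmx.
have fw : is_2form AM wt := inverse_2form HM wP vp.
exists wt; split; last by move=> p v; rewrite /sharp_map /interior_product -mulmxA wP mulmx1.
split=> // [p a b c|p]; last first.
  exists (fun v => v *m piM p) => v; rewrite /interior_product.
    exact: mulmxKV.
  exact: mulmxK.
rewrite -[LHS](tri_act1 (extd AM wt p)) -(mulmxV (un p)) tri_actM; apply: tri_act0 => i j k.
have := schouten_inverse HM wP p i j k fw; rewrite Pp => /esym/eqP.
by rewrite mulf_eq0 pnatr_eq0 => /eqP.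
Qed.

End moment_maps.

Lemma linear_delta {R : pzRingType} {V : lmodType R} m (f : 'rV[R]_m -> V) X :
  (forall a Y Z, f (a *: Y + Z) = a *: f Y + f Z) ->
  f X = \sum_i X 0 i *: f (delta_mx 0 i).
Proof.
move=> fl.
have f0 : f 0 = 0 by have := fl (-1) 0 0; rewrite scaler0 addr0 scaleN1r addNr.
rewrite {1}(row_sum_delta X).
apply: (big_ind2 (fun x y => f x = y)) => // [x1 y1 x2 y2 <- <-|i _].
  by have := fl 1 x1 x2; rewrite !scale1r.
by have := fl (X 0 i) (delta_mx 0 i) 0; rewrite f0 !addr0.
Qed.

Lemma smooth_fun_continuous {R : realType} n (V : normedModType R) (M : topologicalType)
    (A : atlas R n M) (f : M -> V) : is_charted A -> smooth_fun A f -> continuous f.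
Proof.
move=> HA sf p; have ip := ch_dom_at HA p.
have sp : smooth_at (f \o chart_inv (a:=A) (chart_at A p)) (chart (chart_at A p) p).
  by apply: smooth_on_at (sf _); [exact: ch_img_open|exact: chart_img_chart].
move=> U; rewrite /nbhs /= => fU.
have := smooth_at_continuous sp; rewrite /prop_for /continuous_at /= (ch_chartK HA)// => /(_ _ fU) nU.
apply: filterS2 (near_chart_dom HA ip) (near_chart HA ip nU) => q iq /=.
by rewrite (ch_chartK HA).
Qed.

Lemma norm_mulmx_row {R : realType} m n (x : 'rV[R]_m) (t : 'M[R]_(m, n)) :
  `|x *m t| <= m%:R * `|x| * `|t|.
Proof.
apply: mx_norm_le => [|i j]; first by rewrite !mulr_ge0.
rewrite (ord1 i) mxE (le_trans (ler_norm_sum _ _ _))//.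
apply: (@le_trans _ _ (\sum_(k < m) `|x| * `|t|)).
  by apply: ler_sum => k _; rewrite normrM ler_pM// norm_entry_le.
by rewrite sumr_const card_ord -mulrA mulr_natl.
Qed.

Section compact_moment.
Context {R : realType} {m n : nat} {G : topGroupType} {M : topologicalType}.
Context {AG : atlas R m G} {AM : atlas R n M} {sigma : G -> M -> M}.
Context {w pi : M -> 'M[R]_n} {mu : M -> 'rV[R]_m}.
Hypotheses (HL : is_lie_group AG) (HM : is_charted AM).
Hypothesis Hw : is_symplectic_form AM w.
Hypothesis Hham : is_symplectic_hamiltonian AG AM sigma w mu.
Hypothesis pi_induced : induces w pi.

(** The constant is the sum of the absolute values of the structure constants. *)
Lemma coad_bound : exists2 C, 0 <= C & forall X xi, `|coad AG X xi| <= C * `|X| * `|xi|.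
Proof.
pose d (i j k : 'I_m) : R := lie_bracket AG (delta_mx 0 i) (delta_mx 0 j) 0 k.
exists (\sum_j \sum_k \sum_i `|d i j k|) => [|X xi].
  by do 3 (apply: sumr_ge0 => ? _).
apply: mx_norm_le => [|i0 j].
  by rewrite !mulr_ge0//; do 3 (apply: sumr_ge0 => ? _).
rewrite mxE normrN (linear_delta (f := fun X => lie_bracket AG X _) X); last first.
  by move=> a Y Z; exact: lie_bracket_linearl.
rewrite /pairing mxE (le_trans (ler_norm_sum _ _ _))//.
apply: (@le_trans _ _ (\sum_k `|xi| * \sum_i `|X| * `|d i j k|)).
  apply: ler_sum => k _; rewrite normrM ler_pM ?norm_entry_le//.
  rewrite mxE summxE (le_trans (ler_norm_sum _ _ _))//.
  by apply: ler_sum => i _; rewrite mxE normrM ler_pM// norm_entry_le.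
under eq_bigr do rewrite -mulr_sumr mulrA.
rewrite -mulr_sumr [leLHS]mulrC [`|xi| * _]mulrC -[leRHS]mulrA.
apply: ler_wpM2r; first by rewrite mulr_ge0.
rewrite [leRHS](bigD1 j)//= lerDl; apply: sumr_ge0 => j' _.
by do 2 (apply: sumr_ge0 => ? _).
Qed.

Lemma compact_moment_bound : compact [set: M] -> exists2 B, 0 <= B & forall p, `|mu p| <= B.
Proof.
move=> cM.
have cmu : continuous mu by exact: smooth_fun_continuous (moment_smooth Hham).
have cR : compact (mu @` [set: M]).
  by apply: continuous_compact => //; exact: continuous_subspaceT.
have [B [_ BP]] := compact_bounded cR.
exists (`|B| + 1) => // p; apply: BP; last by exists p.
by rewrite (le_lt_trans (ler_norm B))// ltrDl.
Qed.

Lemma compact_nondegenerate : compact [set: M] ->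
  \forall t \near (0 : 'M[R]_m), t^T = - t -> is_nondegenerate AM (twisted AG AM sigma pi t).
Proof.
move=> cM; have [C C0 CP] := coad_bound; have [B B0 BP] := compact_moment_bound cM.
(* Chosen so that |ad*_{z t} mu(p)| <= K|t||z|: C bounds ad*, m is the loss in |z t|, and B bounds
   mu. A nonzero z in the kernel would force 1 <= K|t|, which the radius 1 / (K + 1) excludes even
   for K = 0. *)
pose K := C * m%:R * B.
have K0 : 0 <= K by rewrite !mulr_ge0.
have K1 : 0 < K + 1 by rewrite ltr_wpDl.
apply/nbhs_norm0P; exists (K + 1)^-1 => /=; first by rewrite invr_gt0.
move=> t /= tK tS; apply: (twisted_nondegenerate HL HM Hw Hham pi_induced) => // p z z0.
apply/eqP; rewrite -normr_le0 leNgt; apply/negP => z1.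
have zE : z = - coad AG (z *m t) (mu p).
  by apply/eqP; rewrite -addr_eq0 addrC; apply/eqP.
have : `|z| <= K * `|t| * `|z|.
  rewrite {1}zE normrN (le_trans (CP _ _))//.
  apply: le_trans (ler_wpM2l _ (BP p)) _; first by rewrite mulr_ge0.
  have -> : K * `|t| * `|z| = C * (m%:R * `|z| * `|t|) * B by rewrite /K; ring.
  by rewrite ler_wpM2r// ler_wpM2l// norm_mulmx_row.
rewrite -{1}[`|z|]mul1r ler_pM2r// => h.
have : (K + 1) * `|t| < 1 by rewrite mulrC -ltr_pdivlMr// div1r.
have := normr_ge0 t; lra.
Qed.

End compact_moment.

(** Twists are skew matrices; a neighbourhood of 0 among all matrices, restricted to the skew ones,
    is a neighbourhood of 0 in the second exterior power. *)
Theorem theorem3p1 (R : realType) (n m : nat)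
  (M : topologicalType) (AM : atlas R n M) (M_manifold : is_manifold AM)
  (w : M -> 'M[R]_n) (w_symplectic : is_symplectic_form AM w)
  (G : topGroupType) (AG : atlas R m G) (G_lie : is_lie_group AG)
  (G_connected : connected [set: G])
  (sigma : G -> M -> M) (mu : M -> 'rV[R]_m)
  (sigma_hamiltonian : is_symplectic_hamiltonian AG AM sigma w mu)
  (pi : M -> 'M[R]_n) (pi_induced : induces w pi) :
  let piM := twisted AG AM sigma pi in
  [/\ forall t : 'M[R]_m, skew_mx t ->
        (forall p a b c,
          fundamental3 AG AM sigma (twist_bracket AG t) p a b c = 0) ->
        is_poisson AM (piM t) /\
        (is_r_matrix AG t ->
         is_poisson_action AG AM sigma (poisson_twist AG t) (piM t)),
      forall t : 'M[R]_m, skew_mx t ->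
        (forall xi, range mu xi -> admissible AG t xi) ->
        is_nondegenerate AM (piM t),
      compact [set: M] ->
        \forall t \near (0 : 'M[R]_m), skew_mx t -> is_nondegenerate AM (piM t) &
      forall t : 'M[R]_m, skew_mx t ->
        (forall p a b c,
          fundamental3 AG AM sigma (twist_bracket AG t) p a b c = 0) ->
        (forall xi, range mu xi -> admissible AG t xi) ->
        [/\ is_nondegenerate AM (piM t), is_poisson AM (piM t) &
            exists wt : M -> 'M[R]_n,
              is_symplectic_form AM wt /\ induces wt (piM t)]].
Proof.
move=> piM.
have HM := manifold_charted M_manifold.
have poisson t := twisted_poisson G_lie HM w_symplectic sigma_hamiltonian pi_induced (t := t).
have nondeg t := admissible_nondegenerate G_lie HM w_symplectic sigma_hamiltonian pi_induced (t := t).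
split.
- move=> t tS t0; split; first exact: poisson.
  exact: (twisted_poisson_action G_lie HM w_symplectic sigma_hamiltonian pi_induced).
- exact: nondeg.
- exact: (compact_nondegenerate G_lie HM w_symplectic sigma_hamiltonian pi_induced).
- move=> t tS t0 adm; split; [exact: nondeg|exact: poisson|].
  by apply: nondegenerate_symplectic; [exact: HM|exact: nondeg|exact: poisson].
Qed.
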